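(* Let $n\ge2$ and $1\le m<n$. On the ball $\{z\in\mathbb C^n:|z|<e^{-1}\}$ set $$u(z)=n\log|z|^2+2\log\bigl(-\log|z|^2\bigr)\quad (z\ne0),\qquad u(0)=-\infty.$$ Then $u$ is $m$-subharmonic on this ball, and for every $p>0$, $$e^{-pu}\in L^1_{\mathrm{loc}}\iff p\le1.$$ Consequently $1\in\mathcal I_m(u)_0$ but $1\notin\mathcal I_{m,+}(u)_0$.
   Context: Let $\beta=dd^c|z|^2$ on $\mathbb C^n$. A real constant-coefficient $(1,1)$-form $\alpha$ is $m$-positive if $\alpha^k\wedge\beta^{n-k}\ge0$ for $1\le k\le m$. For an open set $\Omega\subset\mathbb C^n$, a locally integrable, upper semicontinuous function $u:\Omega\to[-\infty,\infty)$ is $m$-subharmonic, written $u\in \mathrm{SH}_m(\Omega)$, if it is subharmonic and $dd^c u\wedge\alpha_1\wedge\cdots\wedge\alpha_{m-1}\wedge\beta^{n-m}\ge0$ (as a current) for all constant-coefficient $m$-positive $(1,1)$-forms $\alpha_j$. For $u\in C^2$ this is equivalent to nonnegativity of the first $m$ elementary symmetric functions of the eigenvalues of the complex Hessian. For an $m$-subharmonic germ $u$ at the origin, with $\mathcal O_{\mathbb C^n,0}$ the ring of germs of holomorphic functions at $0$, define $$\mathcal I_m(u)_0=\{F\in\mathcal O_{\mathbb C^n,0}: |F|^2e^{-u}\text{ is Lebesgue integrable on a neighborhood of }0\},$$ $$\mathcal I_{m,+}(u)_0=\bigcup_{\varepsilon>0}\mathcal I_m((1+\varepsilon)u)_0=\bigcup_{p>1}\mathcal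 I_m(pu)_0 .$$ *)

(* Defs.v *)
From HB Require Import structures.
From mathcomp Require Import all_boot all_order all_fingroup all_algebra complex.
From mathcomp Require Import all_classical all_reals all_analysis.

Set Implicit Arguments.
Unset Strict Implicit.
Unset Printing Implicit Defensive.

Import Order.TTheory GRing.Theory Num.Theory.
Import numFieldNormedType.Exports.

Local Open Scope classical_set_scope.
Local Open Scope ring_scope.

(* The complex numbers over R, as a numClosedFieldType: this is what gives
   them (and row vectors over them) the topology and the complex normed-module
   structure of MathComp-Analysis. *)
Definition C (R : realType) : numClosedFieldType := R[i].

Definition Cn (R : realType) (n : nat) := 'rV[C R]_n.

Section TupleMeasure.
Context d (T : measurableType d) (R : realType).
Variable mu : {sigma_finite_measure set T -> \bar R}.

Definition cons_tuple n (p : T * n.-tuple T) : n.+1.-tuple T :=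
  [tuple of p.1 :: p.2].

Lemma measurable_cons_tuple n : measurable_fun setT (@cons_tuple n).
Proof. exact: (measurable_cons measurable_fst measurable_snd). Qed.


Section ConsMeasure.
Variables (n : nat) (nu : {sigma_finite_measure set (n.-tuple T) -> \bar R}).

Definition cons_measure : set (n.+1.-tuple T) -> \bar R :=
  pushforward (mu \x nu)%E (@cons_tuple n).

Let measurable_preimage A : measurable A -> measurable (@cons_tuple n @^-1` A).
Proof.
by move=> mA; rewrite -[X in measurable X]setTI; exact: measurable_cons_tuple.
Qed.

Let cons_measure0 : cons_measure set0 = 0%E.
Proof. by rewrite /cons_measure /pushforward preimage_set0 measure0. Qed.

Let cons_measure_ge0 A : (0 <= cons_measure A)%E.
Proof. by rewrite /cons_measure /pushforward; apply: measure_ge0. Qed.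

Let cons_measure_sigma_additive : semi_sigma_additive cons_measure.
Proof.
move=> F mF tF mUF; rewrite /cons_measure /pushforward preimage_bigcup.
apply: measure_semi_sigma_additive.
- by move=> k; exact: measurable_preimage.
- apply/trivIsetP => /= i j _ _ ij; rewrite -preimage_setI.
  by move/trivIsetP : tF => /(_ _ _ _ _ ij) ->//; rewrite preimage_set0.
- by rewrite -preimage_bigcup; exact: measurable_preimage.
Qed.

HB.instance Definition _ := isMeasure.Build _ _ _ cons_measure
  cons_measure0 cons_measure_ge0 cons_measure_sigma_additive.

Let cons_measure_sigma_finite : sigma_finite setT cons_measure.
Proof.
have /sigma_finiteP[F [TF ndF Foo]] := sigma_finiteT mu.
have /sigma_finiteP[G [TG ndG Goo]] := sigma_finiteT nu.
pose uncons (t : n.+1.-tuple T) : T * n.-tuple T :=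
  (tnth t ord0, [tuple of behead t]).
have unconsK A : @cons_tuple n @^-1` (uncons @^-1` A) = A.
  apply/seteqP; split=> -[x t];
    by rewrite /preimage /= /uncons (_ : [tuple of _] = t) //; exact: val_inj.
have muncons : measurable_fun setT uncons.
  apply/measurable_fun_pairP; split; first exact: measurable_tnth.
  exact: measurable_behead.
exists (fun k => uncons @^-1` (F k `*` G k)).
  rewrite predeqE => t; split=> // _.
  have [i _ Fi] : (\bigcup_i F i) (tnth t ord0) by rewrite -TF.
  have [j _ Gj] : (\bigcup_i G i) [tuple of behead t] by rewrite -TG.
  exists (maxn i j) => //; split => /=.
  - by move: Fi; exact/subsetPset/ndF/leq_maxl.
  - by move: Gj; exact/subsetPset/ndG/leq_maxr.
move=> k; have [mF Fk] := Foo k; have [mG Gk] := Goo k; split.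
  by rewrite -[X in measurable X]setTI; apply: muncons => //; exact: measurableX.
rewrite /cons_measure /pushforward unconsK product_measure1E//.
by rewrite lte_mul_pinfty// ge0_fin_numE.
Qed.

HB.instance Definition _ := Measure_isSigmaFinite.Build _ _ _ cons_measure
  cons_measure_sigma_finite.

End ConsMeasure.

(* The product measure mu \x ... \x mu (n factors). *)
Fixpoint tuple_measure n : {sigma_finite_measure set (n.-tuple T) -> \bar R} :=
  match n with
  | 0 => \d_([tuple] : 0.-tuple T)
  | n'.+1 => cons_measure (tuple_measure n')
  end.

End TupleMeasure.
Section ComplexSpace.
Variables (R : realType) (n : nat).
Local Notation Cn := (Cn R n).

Definition real_scale (t : R) (v : Cn) : Cn := (t%:C%C : C R) *: v.

Definition mulI (v : Cn) : Cn := ('i%C : C R) *: v.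

Definition sqnorm (z : Cn) : R := \sum_(j < n) Normc.normc (z ord0 j) ^+ 2.

Definition eball (a : Cn) (r : R) : set Cn :=
  [set z | Num.sqrt (sqnorm (z - a)) < r].

Definition closed_eball (a : Cn) (r : R) : set Cn :=
  [set z | Num.sqrt (sqnorm (z - a)) <= r].

(* Lebesgue measure of C^n = R^2n, carried by the real coordinate tuples
   (x_1, ..., x_n, y_1, ..., y_n) with z_j = x_j + i y_j. *)
Definition lebesgue_Cn := tuple_measure (@lebesgue_measure R) (n + n).

Definition of_real_coords (t : (n + n).-tuple (measurableTypeR R)) : Cn :=
  \row_(j < n) ((tnth t (lshift n j) +i* tnth t (rshift n j))%C : C R).

Definition vol (D : set Cn) : \bar R := lebesgue_Cn (of_real_coords @^-1` D).

Definition integral_Cn (D : set Cn) (f : Cn -> \bar R) : \bar R :=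
  (\int[lebesgue_Cn]_(t in of_real_coords @^-1` D) f (of_real_coords t))%E.

Definition integrable_Cn (D : set Cn) (f : Cn -> \bar R) : Prop :=
  lebesgue_Cn.-integrable (of_real_coords @^-1` D) (f \o of_real_coords).

Definition L1loc (Omega : set Cn) (f : Cn -> \bar R) : Prop :=
  forall K, compact K -> K `<=` Omega -> integrable_Cn K f.

Definition dder (v : Cn) (f : Cn -> R) (z : Cn) : R :=
  derive1 (fun t : R => f (z + real_scale t v)) 0.

Fixpoint Ck (k : nat) (f : Cn -> R) : Prop :=
  continuous f /\
  match k with
  | 0 => True
  | k'.+1 => forall v : Cn,
      (forall z, derivable (fun t : R => f (z + real_scale t v)) 0 1) /\
      Ck k' (dder v f)
  end.

Definition smooth (f : Cn -> R) : Prop := forall k, Ck k f.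

Definition test_function (Omega : set Cn) (f : Cn -> R) : Prop :=
  smooth f /\
  exists K, [/\ compact K, K `<=` Omega & forall z, ~ K z -> f z = 0].

(* Real 2-forms at a point, as functions of two tangent vectors. *)
Definition form2 := Cn -> Cn -> R.

(* A real 2-form is of type (1,1) iff it is invariant under multiplication of
   both arguments by i. *)
Definition is_form11 (w : form2) : Prop :=
  [/\ forall v, {morph w^~ v : v1 v2 / v1 + v2},
      forall t v1 v2, w (real_scale t v1) v2 = t * w v1 v2,
      forall v1 v2, w v1 v2 = - w v2 v1 &
      forall v1 v2, w (mulI v1) (mulI v2) = w v1 v2].

(* d^c = i(dbar - d), that is d^c f (v) = - df(iv); thus dd^c = 2i d dbar. *)
Definition dc (f : Cn -> R) (z v : Cn) : R := - dder (mulI v) f z.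

Definition ddc (f : Cn -> R) (z : Cn) : form2 := fun v w =>
  dder v (fun y => dc f y w) z - dder w (fun y => dc f y v) z.

Definition beta : form2 := ddc sqnorm 0.

(* The positively oriented real basis e_1, i e_1, ..., e_n, i e_n of C^n. *)
Definition real_basis (p : 'I_n * bool) : Cn :=
  if p.2 then mulI (delta_mx ord0 p.1) else delta_mx ord0 p.1.

(* The coefficient of w_1 /\ ... /\ w_n (with ws = [:: w_1; ...; w_n]) with
   respect to dx_1 /\ dy_1 /\ ... /\ dx_n /\ dy_n, i.e. its value on
   real_basis, by the alternation formula for the wedge of n 2-forms. *)
Definition wedge_top (ws : seq form2) : R :=
  2 ^- n * \sum_(s : {perm 'I_n * bool}) (-1) ^+ s *
    \prod_(j < n) nth (fun _ _ => 0) ws j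
      (real_basis (s (j, false))) (real_basis (s (j, true))).

Definition m_positive (m : nat) (alpha : form2) : Prop :=
  is_form11 alpha /\
  forall k, (1 <= k <= m)%N ->
    0 <= wedge_top (nseq k alpha ++ nseq (n - k) beta).

(* dd^c u /\ alpha_1 /\ ... /\ alpha_(m-1) /\ beta^(n-m) >= 0 as a current on
   Omega; the forms alpha_j and beta being closed, this current maps a test
   function f to the integral of u dd^c f /\ alpha_1 /\ ... /\ beta^(n-m). *)
Definition ddc_wedge_nonneg (Omega : set Cn) (m : nat) (u : Cn -> \bar R)
    (alpha : 'I_m.-1 -> form2) : Prop :=
  forall f, test_function Omega f -> (forall z, 0 <= f z) ->
    (0 <= integral_Cn Omega (fun z => u z *
      (wedge_top (ddc f z :: [seq alpha j | j <- enum 'I_m.-1] ++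
                  nseq (n - m) beta))%:E))%E.

Definition usc_on (Omega : set Cn) (u : Cn -> \bar R) : Prop :=
  forall z, Omega z -> forall a : R, (u z < a%:E)%E ->
    \forall w \near z, (u w < a%:E)%E.

Definition subharmonic (Omega : set Cn) (u : Cn -> \bar R) : Prop :=
  [/\ forall z, Omega z -> (u z < +oo)%E,
      usc_on Omega u &
      forall a r, 0 < r -> closed_eball a r `<=` Omega ->
        (u a * vol (eball a r) <= integral_Cn (eball a r) u)%E].

Definition SHm (m : nat) (Omega : set Cn) (u : Cn -> \bar R) : Prop :=
  [/\ open Omega, L1loc Omega u, subharmonic Omega u &
      forall alpha : 'I_m.-1 -> form2, (forall j, m_positive m (alpha j)) ->
        ddc_wedge_nonneg Omega u alpha].

Definition holomorphic_near0 (F : Cn -> C R) : Prop :=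
  \forall z \near (0 : Cn), differentiable F z.

Definition germ0 (F : Cn -> C R) : set (Cn -> C R) :=
  [set G | \forall z \near (0 : Cn), G z = F z].

Definition mult_ideal (u : Cn -> \bar R) : set (set (Cn -> C R)) :=
  [set g | exists F, [/\ holomorphic_near0 F, g = germ0 F &
    exists V : set Cn, [/\ open V, V 0 & integrable_Cn V (fun z =>
      (Normc.normc (F z) ^+ 2)%:E * expeR (- u z))%E]]].

Definition mult_ideal_plus (u : Cn -> \bar R) : set (set (Cn -> C R)) :=
  \bigcup_(e in [set e : R | 0 < e]) mult_ideal (fun z => (1 + e)%:E * u z)%E.

Definition u_log (z : Cn) : \bar R :=
  if z == 0 then -oo%E
  else (n%:R * ln (sqnorm z) + 2 * ln (- ln (sqnorm z)))%:E.

End ComplexSpace.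

(* Main.v *)
Require Import Defs.
From HB Require Import structures.
From mathcomp Require Import all_boot all_order all_fingroup all_algebra complex.
From mathcomp Require Import all_classical all_reals all_analysis.
From mathcomp Require Import measurable_realfun.
From mathcomp Require Import ring lra zify.

(* With r = |z|^2 one has u = prof r, where prof r = n ln r + 2 ln (- ln r), and
   dd^c u = prof' (r) beta + prof'' (r) dr /\ d^c r.  The form
   a beta + b dr /\ d^c r is m-positive as soon as a >= 0 and n a + m b r >= 0, which
   holds for prof when m < n and r < e^-2, even with r + eps in place of r.

   The wedge product of n (1,1)-forms is the mixed discriminant of their
   Hermitian matrices, so that the nonnegativity of
   dd^c u /\ alpha_1 /\ ... /\ alpha_(m-1) /\ beta^(n-m) is Garding's inequality
   for the polynomial A |-> D (A, ..., A, I, ..., I), hyperbolic because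
   differentiating a hyperbolic polynomial in a direction of its cone preserves
   hyperbolicity.  The regularizations prof (|z|^2 + eps) are smooth; integration
   by parts gives the positivity of the current for them, and dominated
   convergence (by |u| <= e^-u) passes to u.  The sub-mean value inequality is
   obtained in the same way, the weighted means of the dilates
   z |-> a + t (z - a) being nondecreasing in t because the Laplacian is
   nonnegative.

   Finally e^-u = |z|^-2n (- ln |z|^2)^-2 has integral of order 1 / k^2 over the
   shell |z| ~ e^-k, whereas for p > 1 the integral of e^-pu over a cube of
   half-side c is at least of order c^(-2n(p-1)) (- ln c)^(-2p), which is
   unbounded as c goes to 0. *)

Set Implicit Arguments.
Unset Strict Implicit.
Unset Printing Implicit Defensive.

Import Order.TTheory GRing.Theory Num.Theory.
Import numFieldNormedType.Exports.

Local Open Scope classical_set_scope.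
Local Open Scope ring_scope.

(** * Hyperbolic polynomials and Garding's inequality *)

(** The hypothesis [m < n] enters through one inequality. With [t = 1 / ln r], nonnegativity of
    [n prof' + m r prof''] reads [(n - m) (n + 2 t) >= 2 m t^2], which fails for [m = n]. The radius
    [e^-1] gives [ln r < -2], that is [- 1 / 2 < t < 0], and then the inequality holds on the whole
    ball. The same bound makes [prof] nondecreasing and, for [n >= 2], nonpositive; therefore adding
    [eps] to [|z|^2] decreases [|u|], and [u] itself dominates its regularizations. Garding's
    theorem is strict and concerns an open cone, whereas m-positivity is a closed condition: the
    forms are first pushed into the cone by multiples of the identity, which are then sent to 0. For
    the sub-mean value inequality the weight must be, up to sign, the derivative of a compactly
    supported C^1 function of [|z - a|^2], for then the weighted radial field is a gradient and
    integration by parts yields the Laplacian. The indicator function of the ball is not of this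
    kind, whence the ramps. *)

Section PolynomialBounds.
Variable R : realType.
Local Notation K := (C R).
Local Notation Re := (@complex.Re R).
Local Notation Im := (@complex.Im R).
Implicit Types (p : {poly K}) (t : K).

Lemma horner_norm_le p d t : (size p <= d.+1)%N ->
  `|p.[t]| <= (\sum_(i < size p) `|p`_i|) * (1 + `|t|) ^+ d.
Proof.
move=> sp; rewrite horner_coef mulr_suml.
apply: (le_trans (ler_norm_sum _ _ _)); apply: ler_sum => i _.
rewrite normrM normrX ler_wpM2l//.
have h1 : 1 <= 1 + `|t| by rewrite lerDl.
apply: (@le_trans _ _ ((1 + `|t|) ^+ i)).
  by apply: lerXn2r; rewrite ?nnegrE ?addr_ge0// lerDr.
by apply: ler_weXn2l => //; rewrite -ltnS (leq_trans (ltn_ord i)).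
Qed.

Lemma normC_ge_Im (z : K) : `|Im z|%:C%C <= `|z|.
Proof.
have := normc_ge_Re (z * 'i%C); rewrite ReiNIm normrN => /le_trans; apply.
by rewrite normrM [`|'i%C|]normc_def /= expr0n expr1n add0r sqrtr1 mulr1.
Qed.

(** On the closed upper half plane [|t - z|] is at least [- Im z > 0]; this absorbs the constant in
    [1 + |t| <= |t - z| + (1 + |z|)]. *)
Lemma lower_root_factor (z : K) : Im z < 0 ->
  exists2 c : K, 0 < c & forall t, 0 <= Im t -> c * (1 + `|t|) <= `|t - z|.
Proof.
move=> z0; pose e : K := (- Im z)%:C%C.
have e0 : 0 < e by rewrite ltcR oppr_gt0.
have h t : 0 <= Im t -> e <= `|t - z|.
  move=> t0; apply: le_trans (normC_ge_Im _); rewrite lecR raddfB/=.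
  by apply: le_trans (ler_norm _); rewrite lerDr.
have D : 0 < 1 + (1 + `|z|) / e.
  by rewrite addr_gt0// divr_gt0// ltr_pwDl.
exists (1 + (1 + `|z|) / e)^-1; first by rewrite invr_gt0.
move=> t /h et; rewrite mulrC ler_pdivrMr// mulrDr mulr1.
have -> : 1 + `|t| = `|t - z + z| + 1 by rewrite subrK addrC.
apply: le_trans (_ : `|t - z| + (`|z| + 1) <= _).
  by rewrite addrA lerD2r ler_normD.
rewrite lerD2l mulrA [leRHS]mulrAC (addrC 1).
by rewrite ler_peMl ?addr_ge0// ler_pdivlMr// mul1r.
Qed.

(** The growth [(1 + |t|) ^+ d] matches that of [horner_norm_le], so that even on the unbounded half
    plane a small perturbation of the coefficients cannot create a zero. *)
Lemma lower_roots_lower_bound p d : size p = d.+1 ->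
  (forall t, 0 <= Im t -> p.[t] != 0) ->
  exists2 c : K, 0 < c & forall t, 0 <= Im t -> c * (1 + `|t|) ^+ d <= `|p.[t]|.
Proof.
move=> sp rp; have [s ps] := closed_field_poly_normal p.
have p0 : p != 0 by rewrite -size_poly_eq0 sp.
have l0 : lead_coef p != 0 by rewrite lead_coef_eq0.
have ss : size s = d.
  by move: sp; rewrite ps size_scale// size_prod_XsubC => -[].
have rs z : z \in s -> Im z < 0.
  move=> zs; rewrite ltNge; apply/negP => /rp; rewrite ps hornerZ.
  by have := root_prod_XsubC s z; rewrite zs /root => /eqP ->; rewrite mulr0 eqxx.
suff [c c0 hc] : exists2 c : K, 0 < c & forall t, 0 <= Im t ->
    c * (1 + `|t|) ^+ size s <= `|(\prod_(z <- s) ('X - z%:P)).[t]|.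
  exists (`|lead_coef p| * c); first by rewrite mulr_gt0// normr_gt0.
  by move=> t t0; rewrite {2}ps hornerZ normrM -mulrA ler_wpM2l// -ss hc.
elim: s rs {ps ss} => [|z s IH] rs.
  by exists 1 => // t _; rewrite big_nil hornerC normr1 mul1r expr0.
have [c c0 hc] := IH (fun w ws => rs w (mem_behead (s := z :: s) ws)).
have [c' c'0 hc'] := lower_root_factor (rs z (mem_head _ _)).
exists (c' * c); first by rewrite mulr_gt0.
move=> t t0; rewrite big_cons hornerM hornerXsubC normrM /= exprS.
have -> : c' * c * ((1 + `|t|) * (1 + `|t|) ^+ size s) =
          (c' * (1 + `|t|)) * (c * (1 + `|t|) ^+ size s) by ring.
have tp : 0 <= 1 + `|t| by rewrite addr_ge0.
apply: ler_pM; [| |exact: hc'|exact: hc].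
  by rewrite mulr_ge0// ltW.
by rewrite mulr_ge0 ?exprn_ge0// ltW.
Qed.

(** For a root [z] below the real axis, [|t - z| >= Im t - Im z >= Im t]. Unlike the preceding
    bound, this one sees only the degree and the leading coefficient of [p], so it is uniform along
    a homotopy fixing these. *)
Lemma lower_roots_norm_ge_Im p d t : size p = d.+1 ->
  (forall t, 0 <= Im t -> p.[t] != 0) -> 0 <= Im t ->
  `|lead_coef p| * (Im t)%:C%C ^+ d <= `|p.[t]|.
Proof.
move=> sp rp t0; have [s ps] := closed_field_poly_normal p.
have p0 : p != 0 by rewrite -size_poly_eq0 sp.
have l0 : lead_coef p != 0 by rewrite lead_coef_eq0.
have ss : size s = d.
  by move: sp; rewrite ps size_scale// size_prod_XsubC => -[].
have rs z : z \in s -> Im z < 0.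
  move=> zs; rewrite ltNge; apply/negP => /rp; rewrite ps hornerZ.
  by have := root_prod_XsubC s z; rewrite zs /root => /eqP ->; rewrite mulr0 eqxx.
rewrite [in leRHS]ps hornerZ normrM ler_wpM2l// -ss.
elim: s rs {ps ss} => [|z s IH] rs.
  by rewrite big_nil hornerC normr1 expr0.
rewrite big_cons hornerM hornerXsubC normrM /= exprS.
apply: ler_pM; rewrite ?exprn_ge0 ?ler0c//.
  apply: le_trans (normC_ge_Im _); rewrite lecR raddfB/=.
  apply: le_trans (ler_norm _); rewrite lerDl oppr_ge0 ltW//.
  by rewrite rs ?mem_head.
by apply: IH => w ws; rewrite rs// inE ?ws ?us orbT.
Qed.

(** Gauss-Lucas at the point 0: [p'(0) / p(0)] is the sum of [(- z)^-1] over the roots [z], and each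
    term has negative imaginary part. *)
Lemma lower_roots_deriv0 p : (1 < size p)%N ->
  (forall t, 0 <= Im t -> p.[t] != 0) -> p`_1 != 0.
Proof.
move=> sp rp; have [s ps] := closed_field_poly_normal p.
have p0 : p != 0 by rewrite -size_poly_eq0; case: size sp.
have l0 : lead_coef p != 0 by rewrite lead_coef_eq0.
have ss : (0 < size s)%N.
  by move: sp; rewrite ps size_scale// size_prod_XsubC.
have rs z : z \in s -> Im z < 0.
  move=> zs; rewrite ltNge; apply/negP => /rp; rewrite ps hornerZ.
  by have := root_prod_XsubC s z; rewrite zs /root => /eqP ->; rewrite mulr0 eqxx.
pose q := \prod_(z <- s) ('X - z%:P).
suff [q0 q1] : q`_0 != 0 /\ Im (q`_1 / q`_0) < 0.
  rewrite ps coefZ mulf_neq0// -/q; apply: contraTneq q1 => ->.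
  by rewrite mul0r ltxx.
rewrite /q {q ps}.
case: s ss rs => // z s _.
have inv_im (w : K) : Im w < 0 -> Im ((- w)^-1) < 0.
  case: w => x y /= y0.
  have D : 0 < (- x) ^+ 2 + (- y) ^+ 2 by rewrite ltr_wpDl ?sqr_ge0// exprn_even_gt0//= oppr_eq0 lt_eqF.
  by rewrite -mulNr opprK ltr_pdivrMr// mul0r.
have nz (w : K) : Im w < 0 -> - w != 0.
  by apply: contraTneq => /eqP; rewrite oppr_eq0 => /eqP ->; rewrite ltxx.
elim: s z => [|w s IH] z rs.
  have z0 := rs z (mem_head _ _).
  rewrite big_seq1 !coefB !coefX !coefC /= !subr0 sub0r div1r.
  by split; [exact: nz|exact: inv_im].
have z0 := rs z (mem_head _ _).
have [|q0 q1] := IH w; first by move=> u us; rewrite rs// inE ?ws ?us orbT.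
rewrite big_cons; set q := \prod_(_ <- _) _ in q0 q1 *.
rewrite mulrBl !coefB !coefXM/= !coefCM sub0r -mulNr.
split; first by rewrite mulf_neq0// nz.
have -> : (q`_0 - z * q`_1) / (- z * q`_0) = (- z)^-1 + q`_1 / q`_0.
  by field; rewrite q0 -oppr_eq0 nz.
by rewrite raddfD/= -oppr_gt0 opprD addr_gt0// oppr_gt0// inv_im.
Qed.

(** In the order of [C R], [t < 0] means real and negative, so [p] is a positive multiple of a
    product of factors [X + c] with [c > 0]. *)
Lemma negative_roots_coef p :
  0 < lead_coef p -> (forall t, root p t -> t < 0) ->
  forall i, (i < size p)%N -> 0 < p`_i.
Proof.
move=> l0 rp; have [s ps] := closed_field_poly_normal p.
have rs z : z \in s -> z < 0.
  by move=> zs; apply: rp; rewrite ps rootZ ?lt0r_neq0// root_prod_XsubC.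
rewrite ps size_scale ?lt0r_neq0// => i iz; rewrite coefZ mulr_gt0//.
elim: s rs i iz {ps} => [|z s IH] rs i.
  by rewrite big_nil size_polyC oner_eq0 /= ltnS leqn0 => /eqP ->; rewrite coefC.
rewrite !size_prod_XsubC /= big_cons mulrBl coefB coefXM coefCM => iz.
have z0 := rs z (mem_head _ _).
have h : forall i, (i < (size s).+1)%N -> 0 < (\prod_(x <- s) ('X - x%:P))`_i.
  by move=> j js; apply: IH; rewrite ?size_prod_XsubC// => u us; rewrite rs// inE ?ws ?us orbT.
case: i iz => [|i] /= iz.
  by rewrite sub0r -mulNr mulr_gt0 ?oppr_gt0// h.
move: iz; rewrite ltnS ltnS leq_eqVlt => /orP[/eqP ->|iz].
  rewrite [X in z * X]nth_default ?size_prod_XsubC// mulr0 subr0; exact: h.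
by rewrite -mulNr addr_gt0 ?h// ?mulr_gt0 ?oppr_gt0 ?h// ltnW.
Qed.

End PolynomialBounds.

(** * Roots of a polynomial family in the upper half plane *)

Section Homotopy.
Variable R : realType.
Local Notation K := (C R).
Local Notation Im := (@complex.Im R).

Lemma expr_dist_le (r s : R) j : 0 <= r <= 1 -> 0 <= s <= 1 ->
  `|r ^+ j - s ^+ j| <= j%:R * `|r - s|.
Proof.
move=> /andP[r0 r1] /andP[s0 s1]; elim: j => [|j IH].
  by rewrite !expr0 subrr normr0 mul0r.
have -> : r ^+ j.+1 - s ^+ j.+1 = r * (r ^+ j - s ^+ j) + (r - s) * s ^+ j.
  by rewrite !exprS; ring.
rewrite (le_trans (ler_normD _ _))// !normrM -natr1 mulrDl mul1r.
apply: lerD.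
  by rewrite (le_trans _ IH)// ler_piMl// ger0_norm.
by rewrite ler_piMr// ger0_norm ?exprn_ge0// exprn_ile1.
Qed.

(* Zeros of a polynomial family with constant leading coefficient cannot enter
   the closed upper half plane without crossing the real axis; the first
   parameter at which they would do so is an infimum, so no continuity of the
   roots is needed. *)
Lemma homotopy_lower_roots (d : nat) (p : nat -> {poly K}) :
  size (p 0%N) = d.+1 -> (forall j, (0 < j <= d)%N -> (size (p j) <= d)%N) ->
  (forall r : R, 0 <= r <= 1 -> forall x : R,
     (\sum_(j < d.+1) (r ^+ j)%:C%C *: p j).[x%:C%C] != 0) ->
  (forall t, 0 <= Im t -> (p 0%N).[t] != 0) ->
  forall t, 0 <= Im t -> (\sum_(j < d.+1) p j).[t] != 0.
Proof.
move=> sp0 spj real_nz p0_nz.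
pose f (r : R) := \sum_(j < d.+1) (r ^+ j)%:C%C *: p j.
have tail_size (r : R) : (size (\sum_(j < d) (r ^+ j.+1)%:C%C *: p j.+1)%R <= d)%N.
  apply: leq_trans (size_sum _ _ _) _; apply/bigmax_leqP => i _.
  by apply: leq_trans (size_scale_leq _ _) _; rewrite spj/=.
have fE r : f r = p 0%N + \sum_(j < d) (r ^+ j.+1)%:C%C *: p j.+1.
  by rewrite /f big_ord_recl expr0 scale1r.
have sf r : size (f r) = d.+1 by rewrite fE size_polyDl sp0// ltnS.
have lf r : lead_coef (f r) = lead_coef (p 0%N).
  by rewrite fE lead_coefDl// sp0 ltnS.
have l0 : 0 < `|lead_coef (p 0%N)|.
  by rewrite normr_gt0 lead_coef_eq0 -size_poly_eq0 sp0.
have spd (j : 'I_d.+1) : (size (p j) <= d.+1)%N.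
  by case: j => -[|j] /= jd; rewrite ?sp0// leqW// spj.
pose S j : K := \sum_(i < size (p j)) `|(p j)`_i|.
pose B : K := \sum_(j < d.+1) j%:R * S j.
have B0 : 0 <= B by apply: sumr_ge0 => j _; rewrite mulr_ge0// sumr_ge0.
have lip (r s : R) t : 0 <= r <= 1 -> 0 <= s <= 1 ->
    `|(f r).[t] - (f s).[t]| <= `|r - s|%:C%C * (B * (1 + `|t|) ^+ d).
  move=> r01 s01; rewrite -hornerN -hornerD /f -sumrB horner_sum.
  rewrite (le_trans (ler_norm_sum _ _ _))// /B !mulr_suml mulr_sumr.
  apply: ler_sum => j _; rewrite -scalerBl hornerZ normrM -mulrA [leRHS]mulrA.
  apply: ler_pM => //; last exact: (horner_norm_le _ (spd j)).
  rewrite -raddfB normc_def /= expr0n addr0 sqrtr_sqr.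
  by rewrite -(rmorph_nat (real_complex R)) -rmorphM lecR mulrC expr_dist_le.
pose E := [set r : R | 0 <= r <= 1 /\ exists2 t, 0 <= Im t & (f r).[t] = 0].
suff E0 : E = set0.
  move=> t t0; apply/negP => /eqP ft.
  suff : E 1 by rewrite E0.
  split; first by rewrite ler01 lexx.
  exists t => //; rewrite -[RHS]ft; congr (_.[t]); apply: eq_bigr => j _.
  by rewrite expr1n scale1r.
apply: contrapT => /eqP/set0P En.
have lbE : lbound E 0 by move=> r [/andP[]].
have hE : has_inf E by split => //; exists 0.
pose r0 := inf E.
have r00 : 0 <= r0 by apply: lb_le_inf.
have r01 : 0 <= r0 <= 1.
  rewrite r00/=; have [r Er] := En; have := Er.1 => /andP[_].
  by apply: le_trans; apply: ge_inf Er; exists 0.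
have small (c : K) : 0 < c -> exists2 e : R, 0 < e & forall x : R, 0 <= x -> x < e -> x%:C%C * B < c.
  move=> c0; have D : 0 < c / (B + 1) by rewrite divr_gt0// ltr_wpDl.
  exists (complex.Re (c / (B + 1))); first by move: D; rewrite ltcE => /andP[].
  have DR : (complex.Re (c / (B + 1)))%:C%C = c / (B + 1).
    by rewrite RRe_real// ger0_real// ltW.
  move=> x x0; rewrite -ltcR DR ltr_pdivlMr; last by rewrite ltr_wpDl.
  by apply: le_lt_trans; rewrite ler_wpM2l ?lerDl// lecR.
(* If the infimum is not attained, the lower bound for [f r0] has the same growth in [t] as the
   Lipschitz bound and excludes zeros for all nearby parameters, against the choice of [r0]. *)
have [Er0|nE] := pselect (E r0); last first.
  have rp t : 0 <= Im t -> (f r0).[t] != 0.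
    by move=> t0; apply/eqP => ft; apply: nE; split => //; exists t.
  have [c c0 hc] := lower_roots_lower_bound (sf r0) rp.
  have [e e0 he] := small _ c0.
  have [r Er] := inf_adherent e0 hE; rewrite -/r0 => re.
  have rr0 : r0 <= r by apply: ge_inf Er; exists 0.
  have [r1 [t t0 ft]] := Er.
  have := lip r r0 t r1 r01; rewrite ft sub0r normrN => /(le_trans (hc t t0)).
  have tp : 0 < (1 + `|t|) ^+ d by rewrite exprn_gt0// ltr_pwDl.
  rewrite mulrA ler_pM2r// => /le_lt_trans H.
  suff : c < c by rewrite ltxx.
  apply: H; apply: he => //.
  by rewrite ger0_norm ?subr_ge0// ltrBlDl.
(* If it is attained, the root [t] has [Im t > 0]. Just before [r0] all roots are in the lower half
   plane, so the value at [t] is at least [A], which does not depend on the parameter; this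
   contradicts continuity at [r0]. *)
have [_ [t t0 ft]] := Er0.
have tI : 0 < Im t.
  rewrite lt_neqAle t0 andbT; apply/eqP => tI.
  have := real_nz r0 r01 (complex.Re t); rewrite -/(f r0).
  have -> : (complex.Re t)%:C%C = t by case: t tI {t0 ft} => a b /= <-.
  by rewrite ft eqxx.
have r0p : 0 < r0.
  rewrite lt_neqAle r00 andbT; apply/eqP => r0E.
  have := p0_nz t t0; suff -> : p 0%N = f r0 by rewrite ft eqxx.
  rewrite fE -r0E big1 ?addr0// => j _; by rewrite expr0n/= scale0r.
pose A := `|lead_coef (p 0%N)| * (Im t)%:C%C ^+ d.
have A0 : 0 < A by rewrite mulr_gt0// exprn_gt0// ltcR.
have tp : 0 < (1 + `|t|) ^+ d by rewrite exprn_gt0// ltr_pwDl.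
have [e e0 he] : exists2 e : R, 0 < e & forall x : R, 0 <= x -> x < e -> x%:C%C * B < A / (1 + `|t|) ^+ d.
  by apply: small; rewrite divr_gt0.
pose h := Num.min r0 e / 2.
have m0 : 0 < Num.min r0 e by rewrite lt_min r0p.
have mr0 : Num.min r0 e <= r0 by rewrite ge_min lexx.
have me : Num.min r0 e <= e by rewrite ge_min lexx orbT.
have h0 : 0 < h by rewrite divr_gt0.
have hr0 : h < r0 by rewrite /h; lra.
have hE' : h < e by rewrite /h; lra.
have rE : 0 <= r0 - h <= 1 by move: r01 => /andP[]; lra.
have rp u : 0 <= Im u -> (f (r0 - h)).[u] != 0.
  move=> u0; apply/eqP => fu; have : E (r0 - h) by split => //; exists u.
  by move=> /(ge_inf (ex_intro _ 0 lbE)); rewrite -/r0 leNgt ltrBlDr ltrDl h0.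
have := lower_roots_norm_ge_Im (sf _) rp t0; rewrite lf -/A.
have := lip (r0 - h) r0 t rE r01; rewrite ft subr0 => h1 h2.
have := le_trans h2 h1; rewrite mulrA -ler_pdivrMr// => /le_lt_trans H.
set a := A / _ in H he; suff : a < a by rewrite ltxx.
apply: H; apply: he => //.
by rewrite addrAC subrr sub0r normrN ger0_norm// ltW.
Qed.

End Homotopy.

(** * Garding's inequality for symmetric multilinear forms *)

Section Garding.
Variable R : realType.
Local Notation K := (C R).
Local Notation Im := (@complex.Im R).
Local Notation Re := (@complex.Re R).

Lemma complex_real_eq (z : K) : Im z = 0 -> z = (Re z)%:C%C.
Proof. by case: z => a b /= ->. Qed.

(** Finitely many negative roots stay a positive distance below 0. This makes the Garding cone open
    in the direction [- e]. *)
Lemma negative_roots_shift (p : {poly K}) :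
  0 < lead_coef p -> (forall t, root p t -> t < 0) ->
  exists2 eps : R, 0 < eps & forall t : R, 0 <= t -> 0 < p.[(t - eps)%:C%C].
Proof.
move=> l0 rp; have [s ps] := closed_field_poly_normal p.
have rs z : z \in s -> z < 0.
  by move=> zs; apply: rp; rewrite ps rootZ ?lt0r_neq0// root_prod_XsubC.
have [eps eps0 he] : exists2 eps : R, 0 < eps & forall z, z \in s -> z < (- eps)%:C%C.
  elim: s rs {ps} => [|z s IH] rs; first by exists 1.
  have [|eps e0 he] := IH; first by move=> w ws; rewrite rs// inE ws orbT.
  have z0 := rs z (mem_head _ _).
  have zR : z = (Re z)%:C%C.
    by apply: complex_real_eq; move: z0; rewrite ltcE => /andP[/eqP].
  have rz0 : Re z < 0 by move: z0; rewrite ltcE => /andP[].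
  exists (Num.min eps (- Re z) / 2).
    by rewrite divr_gt0// lt_min e0 oppr_gt0.
  have m0 : 0 < Num.min eps (- Re z) by rewrite lt_min e0 oppr_gt0.
  have m1 : Num.min eps (- Re z) <= - Re z by rewrite ge_min lexx orbT.
  have m2 : Num.min eps (- Re z) <= eps by rewrite ge_min lexx.
  move=> w; rewrite inE => /orP[/eqP ->|/he h].
    by rewrite zR ltcR; lra.
  by apply: (lt_le_trans h); rewrite lecR; lra.
exists eps => // t t0; rewrite ps hornerZ mulr_gt0// horner_prod.
rewrite big_seq; apply: prodr_gt0 => z zs; rewrite hornerXsubC subr_gt0.
by apply: (lt_le_trans (he z zs)); rewrite lecR; lra.
Qed.

Variables (V : lmodType K) (M : seq V -> K) (N : nat) (herm : V -> Prop) (e : V).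
Hypothesis M_perm : forall s t, size s = N -> perm_eq s t -> M s = M t.
Hypothesis M_lin : forall c x y s, (size s).+1 = N ->
  M (c *: x + y :: s) = c * M (x :: s) + M (y :: s).
Hypothesis hermD : forall x y, herm x -> herm y -> herm (x + y).
Hypothesis hermZ : forall (r : R) x, herm x -> herm (r%:C%C *: x).
Hypothesis herm_e : herm e.

Let M0 s : (size s).+1 = N -> M (0 :: s) = 0.
Proof.
move=> sN; have := M_lin 1 0 0 sN; rewrite scaler0 addr0 mul1r => /eqP.
by rewrite -[X in X == _]addr0 (inj_eq (addrI _)) => /eqP.
Qed.

Let M_scale1 c x s : (size s).+1 = N -> M (c *: x :: s) = c * M (x :: s).
Proof. by move=> sN; rewrite -[c *: x]addr0 M_lin// M0// addr0. Qed.

Let nseqSE (x : V) d L : nseq d.+1 x ++ L = x :: nseq d x ++ L.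
Proof. by []. Qed.

Lemma multilinear_swap x s t : (size s + size t).+1 = N -> M (x :: s ++ t) = M (s ++ x :: t).
Proof.
move=> sN; apply: M_perm; first by rewrite /= size_cat.
by rewrite -cat1s perm_catCA.
Qed.

Lemma multilinear_scale d c x L : (d + size L)%N = N ->
  M (nseq d (c *: x) ++ L) = c ^+ d * M (nseq d x ++ L).
Proof.
elim: d L => [|d IH] L dN; first by rewrite expr0 mul1r.
rewrite !nseqSE M_scale1 ?size_cat ?size_nseq// !multilinear_swap ?size_nseq//.
by rewrite IH ?addnS// mulrA -exprS.
Qed.

Lemma multilinear_binomial d x y c L : (d + size L)%N = N ->
  M (nseq d (x + c *: y) ++ L) =
  \sum_(j < d.+1) c ^+ j * (M (nseq j y ++ nseq (d - j) x ++ L) *+ 'C(d, j)).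
Proof.
elim: d L => [|d IH] L dN.
  by rewrite big_ord1 expr0 mul1r bin0 mulr1n.
rewrite nseqSE addrC M_lin ?size_cat ?size_nseq// !multilinear_swap ?size_nseq//.
rewrite [LHS]addrC [c *: y + x]addrC !IH ?addnS//.
pose a j := M (nseq j y ++ nseq (d.+1 - j) x ++ L).
have a1 (j : 'I_d.+1) : M (nseq j y ++ nseq (d - j) x ++ x :: L) = a j.
  rewrite /a subSn; last by rewrite -ltnS.
  by congr M; congr cat; elim: (d - j)%N => //= k ->.
have a2 (j : 'I_d.+1) : M (nseq j y ++ nseq (d - j) x ++ y :: L) = a j.+1.
  rewrite /a subSS /= !catA multilinear_swap// size_cat !size_nseq -/addn.
  by have := ltn_ord j; rewrite ltnS => /subnKC ->.
under eq_bigr do rewrite a1.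
under [X in _ + c * X]eq_bigr do rewrite a2.
have -> : \sum_(j < d.+2) c ^+ j *
    (M (nseq j y ++ nseq (d.+1 - j) x ++ L) *+ 'C(d.+1, j)) =
    \sum_(j < d.+2) c ^+ j * (a j *+ 'C(d.+1, j)) by [].
rewrite [RHS]big_ord_recl bin0.
under [X in _ = _ + X]eq_bigr do rewrite lift0 binS mulrnDr mulrDr.
rewrite big_split /= addrA; congr (_ + _); last first.
  by rewrite mulr_sumr; apply: eq_bigr => j _; rewrite mulrA -exprS.
rewrite big_ord_recl /= !bin0; congr (_ + _).
by rewrite [RHS]big_ord_recr /= bin_small// mulr0n mulr0 addr0.
Qed.

(** The restriction of the form to a line. Its coefficient of degree 1 is [d] times the polar
    derivative [M (y, x, ..., x, L)], which is how facts about roots reach derivatives. *)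
Definition pencil d x y L : {poly K} :=
  \poly_(j < d.+1) (M (nseq j y ++ nseq (d - j) x ++ L) *+ 'C(d, j)).

Lemma horner_pencil d x y L c : (d + size L)%N = N ->
  (pencil d x y L).[c] = M (nseq d (x + c *: y) ++ L).
Proof.
move=> dN; rewrite multilinear_binomial// horner_poly.
by apply: eq_bigr => j _; rewrite mulrC.
Qed.

Lemma lead_coef_pencil d x y L : M (nseq d y ++ L) != 0 ->
  size (pencil d x y L) = d.+1 /\ lead_coef (pencil d x y L) = M (nseq d y ++ L).
Proof.
move=> h; have s : size (pencil d x y L) = d.+1.
  by rewrite size_poly_eq// subnn binn.
by split => //; rewrite lead_coefE s coef_poly /= ltnSn subnn binn.
Qed.

(* The polar form [A |-> M (A, ..., A, L)] of degree [d] is hyperbolic in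
   direction [e], and [cone d L] is its Garding cone, described by the half
   lines [A + t e]. *)
Definition hyperbolic d L :=
  (forall X z, herm X -> Im z != 0 -> M (nseq d (X + z *: e) ++ L) != 0) /\
  0 < M (nseq d e ++ L).

Definition cone d L A :=
  herm A /\ forall t : R, 0 <= t -> 0 < M (nseq d (A + t%:C%C *: e) ++ L).

Lemma cone_pos d L A : cone d L A -> 0 < M (nseq d A ++ L).
Proof. by move=> [_ /(_ 0 (lexx _))]; rewrite scale0r addr0. Qed.

Lemma cone_e d L : (d + size L)%N = N -> hyperbolic d L -> cone d L e.
Proof.
move=> dN [_ e0]; split => // t t0; rewrite -[X in X + _]scale1r -scalerDl multilinear_scale//.
by rewrite mulr_gt0// exprn_gt0// ltr_pwDl// ler0c.
Qed.

(** As a polynomial in [t] this has leading coefficient [M (b, ..., b, L)], independent of the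
    parameter [r] multiplying [Y]. At [r = 0] its roots are in the lower half plane, and the
    hypothesis on real [x] keeps them there. *)
Lemma cone_homotopy d L b Y z : (d + size L)%N = N ->
  hyperbolic d L -> cone d L b -> 0 < Im z ->
  (forall r : R, 0 <= r <= 1 -> forall x : R,
    M (nseq d (r%:C%C *: Y + (x%:C%C *: b + z *: e)) ++ L) != 0) ->
  forall t, 0 <= Im t -> M (nseq d (Y + (t *: b + z *: e)) ++ L) != 0.
Proof.
move=> dN [hL e0] cb z0 hr.
pose p j := pencil (d - j) (z *: e) b (nseq j Y ++ L) *+ 'C(d, j).
have pE (c t : K) : \sum_(j < d.+1) c ^+ j * (p j).[t] =
    M (nseq d (c *: Y + (t *: b + z *: e)) ++ L).
  rewrite addrC multilinear_binomial//; apply: eq_bigr => j _.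
  rewrite hornerMn horner_pencil; last first.
    by rewrite size_cat size_nseq addnA subnK// -ltnS.
  congr (_ * (_ *+ _)); rewrite [z *: e + _]addrC.
  apply: M_perm; last by rewrite perm_catCA.
  by rewrite !size_cat !size_nseq addnA subnK// -ltnS.
move=> t t0; rewrite -[Y]scale1r -pE.
under eq_bigr do rewrite expr1n mul1r.
rewrite -horner_sum; apply: homotopy_lower_roots t0.
- have [] := @lead_coef_pencil d (z *: e) b L _; last by rewrite /p subn0 bin0.
  exact/lt0r_neq0/cone_pos.
- move=> j /andP[j0 jd]; apply: leq_trans (_ : size (pencil (d - j) (z *: e) b (nseq j Y ++ L)) <= _)%N.
    by rewrite /p -scaler_nat size_scale_leq.
  by apply: leq_trans (size_poly _ _) _; rewrite -subSn// leq_subLR; lia.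
- move=> r r01 x; rewrite horner_sum.
  under eq_bigr do rewrite hornerZ rmorphXn.
  by rewrite pE hr.
- move=> {}t {}t0; rewrite /p subn0 bin0 mulr1n horner_pencil//.
  have [->|tn0] := eqVneq t 0.
    rewrite scale0r addr0 multilinear_scale//; apply: mulf_neq0; last exact: lt0r_neq0.
    by apply: expf_neq0; apply: contraTneq z0 => ->; rewrite ltxx.
  (* A non-real [z / t] is excluded by hyperbolicity, a nonnegative one by the cone, and a negative
     one by [0 <= Im t] and [0 < Im z]. *)
  have -> : z *: e + t *: b = t *: (b + (z / t) *: e).
    by rewrite scalerDr scalerA mulrCA divff// mulr1 addrC.
  rewrite multilinear_scale// mulf_neq0 ?expf_neq0//.
  have [w0|w0] := eqVneq (Im (z / t)) 0; last by apply: hL => //; exact: cb.1.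
  have wE := complex_real_eq w0.
  have [x0|x0] := leP 0 (Re (z / t)); first by rewrite wE lt0r_neq0// cb.2.
  have zE : z = (Re (z / t))%:C%C * t by rewrite -wE divfK.
  move: z0; rewrite zE; case: t t0 {tn0 zE w0 wE} x0 => a c /= c0.
  move: (Re _) => x x0; rewrite mul0r addr0.
  by rewrite ltNge mulr_le0_ge0// ltW.
Qed.

Lemma hyperbolic_stable d L a X s z : (d + size L)%N = N ->
  hyperbolic d L -> cone d L a -> herm X -> 0 <= Im s -> 0 < Im z ->
  M (nseq d (X + (s *: a + z *: e)) ++ L) != 0.
Proof.
move=> dN hL ca hX s0 z0; apply: cone_homotopy => // r _ x.
rewrite addrA; apply: hL.1; last by rewrite gt_eqF.
by apply: hermD; apply: hermZ => //; exact: ca.1.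
Qed.

(** The homotopy is run a second time, with [Y = s a]: on the real axis [x b] is Hermitian, so that
    [hyperbolic_stable] applies. *)
Lemma cone_stable d L a b s t z : (d + size L)%N = N ->
  hyperbolic d L -> cone d L a -> cone d L b ->
  0 <= Im s -> 0 <= Im t -> 0 < Im z ->
  M (nseq d (s *: a + (t *: b + z *: e)) ++ L) != 0.
Proof.
move=> dN hL ca cb s0 t0 z0; apply: cone_homotopy => // r /andP[r0 _] x.
rewrite scalerA addrCA; apply: hyperbolic_stable => //; first exact/hermZ/cb.1.
by case: s s0 => u v /= v0; rewrite mul0r addr0 mulr_ge0.
Qed.

Lemma cone_shrink d L b : (d + size L)%N = N -> hyperbolic d L -> cone d L b ->
  exists2 eps : R, 0 < eps & cone d L (b - eps%:C%C *: e).
Proof.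
move=> dN hL cb; have e0 := hL.2.
have [_ lp] := @lead_coef_pencil d b e L (lt0r_neq0 e0).
have := @negative_roots_shift (pencil d b e L); rewrite lp => /(_ e0)[].
  move=> t; rewrite /root horner_pencil// => /eqP Mt.
  have [t0|t0] := eqVneq (Im t) 0; last by have := hL.1 _ _ cb.1 t0; rewrite Mt eqxx.
  have tE := complex_real_eq t0; rewrite tE ltcR ltNge; apply/negP => /cb.2.
  by rewrite -tE Mt ltxx.
move=> eps eps0 he; exists eps => //; split.
  by rewrite -scaleNr -rmorphN; apply: hermD; [exact: cb.1|exact: hermZ].
move=> t /he; rewrite horner_pencil// rmorphB scalerBl.
by rewrite addrA addrAC.
Qed.

(** With [y = b + t e], all roots [s] of [M (y + s a, ..., y + s a, L)] are real and negative. Hence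
    all coefficients are positive, among them that of degree 1, a positive multiple of
    [M (a, y, ..., y, L)]. *)
Lemma derivative_pos d L a b : (d.+1 + size L)%N = N -> hyperbolic d.+1 L ->
  cone d.+1 L a -> cone d.+1 L b -> cone d (a :: L) b.
Proof.
move=> dN hL ca cb; split; first exact: cb.1.
have [eps eps0 cb'] := cone_shrink dN hL cb.
move=> t t0; set y := b + _.
(* Retreating from [b] by [eps e] inside the cone leaves a strictly positive coefficient on [e],
   even at [t = 0], as [cone_stable] requires. *)
have yE : y = (b - eps%:C%C *: e) + (t + eps)%:C%C *: e.
  by rewrite rmorphD scalerDl addrACA addNr addr0.
move: cb' yE; set b' := b - _ => cb' yE.
have te : 0 < t + eps by rewrite ltr_wpDl.
have [sp lp] := @lead_coef_pencil d.+1 y a L (lt0r_neq0 (cone_pos ca)).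
have h : 0 < (pencil d.+1 y a L)`_1.
  apply: negative_roots_coef; rewrite ?lp ?sp ?cone_pos// => s.
  rewrite /root horner_pencil// => /eqP Ms.
  (* By homogeneity the argument may be multiplied by any [zt]. Unless [s] is real and negative,
     some [zt] in the upper half plane keeps [zt * s] in the closed one. *)
  have nz (zt : K) : 0 < Im zt -> ~ 0 <= Im (zt * s).
    move=> zt0 zs0.
    have : M (nseq d.+1 (zt *: (y + s *: a)) ++ L) != 0.
      rewrite scalerDr yE scalerDr !scalerA [X in X ++ _](_ : _ =
        nseq d.+1 ((zt * s) *: a + (zt *: b' + (zt * (t + eps)%:C%C) *: e))); last first.
        by congr nseq; rewrite addrC.
      apply: cone_stable => //; first exact: ltW.
      by case: zt zt0 {zs0} => u v /= v0; rewrite mulr0 add0r mulr_gt0.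
    by rewrite multilinear_scale// Ms mulr0 eqxx.
  have [s0|s0] := eqVneq (Im s) 0.
    have sE := complex_real_eq s0; rewrite sE ltcR ltNge; apply/negP => rs0.
    by apply: (nz 'i%C) => //=; rewrite sE /= mul0r add0r mul1r.
  (* The real part is chosen so that [Im (zt * s) = 0]. *)
  exfalso; apply: (nz (- Re s / Im s +i* 1)%C) => //=.
  case: s s0 {Ms nz} => u v /= v0.
  by rewrite divfK// mul1r addNr.
move: h; rewrite coef_poly /= bin1 subSS subn0 multilinear_swap ?size_nseq//.
by rewrite -mulr_natr pmulr_lgt0// ltr0n.
Qed.

(** For [Im z > 0] the pencil through [X + z e] in the direction [a] has its roots in the lower half
    plane, so its derivative at 0 does not vanish. The case [Im z < 0] follows by changing the sign
    of the argument. *)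
Lemma hyperbolic_derivative d L a : (d.+1 + size L)%N = N ->
  hyperbolic d.+1 L -> cone d.+1 L a -> hyperbolic d (a :: L).
Proof.
move=> dN hL ca; split; last first.
  exact: cone_pos (derivative_pos dN hL ca (cone_e dN hL)).
have pos X z : herm X -> 0 < Im z -> M (nseq d (X + z *: e) ++ a :: L) != 0.
  move=> hX z0.
  have [sp lp] := @lead_coef_pencil d.+1 (X + z *: e) a L (lt0r_neq0 (cone_pos ca)).
  have : (pencil d.+1 (X + z *: e) a L)`_1 != 0.
    apply: lower_roots_deriv0; first by rewrite sp.
    by move=> t t0; rewrite horner_pencil// -addrA [z *: e + _]addrC hyperbolic_stable.
  rewrite coef_poly /= bin1 subSS subn0 multilinear_swap ?size_nseq//.
  by rewrite -mulr_natr mulf_eq0 negb_or => /andP[].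
move=> X z hX; rewrite neq_lt => /orP[z0|]; last exact: pos.
have : M (nseq d ((-1) *: (- X + (- z) *: e)) ++ a :: L) != 0.
  rewrite multilinear_scale /= ?addnS// mulf_neq0 ?signr_eq0// pos ?raddfN ?oppr_gt0//.
  by rewrite -scaleN1r -(rmorph1 (real_complex R)) -rmorphN; apply: hermZ.
by rewrite scaleN1r opprD opprK -scaleNr opprK.
Qed.

(** The entries of [s] move into [L] one at a time; each polarization keeps hyperbolicity and keeps
    the remaining entries in the cone. *)
Theorem garding_pos s L : (size s + size L)%N = N -> hyperbolic (size s) L ->
  (forall a, a \in s -> cone (size s) L a) -> 0 < M (s ++ L).
Proof.
elim: s L => [|a s IH] L sN hL cs; first exact: hL.2.
have ca := cs a (mem_head _ _).
rewrite /= multilinear_swap//; apply: IH; first by rewrite /= addnS.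
  exact: hyperbolic_derivative.
by move=> b bs; apply: derivative_pos => //; apply: cs; rewrite inE bs orbT.
Qed.

End Garding.

(** * Wedge products of (1,1)-forms as mixed discriminants *)

Section AlternatingSums.
Variables (R : realType) (T : finType).
Local Notation K := (C R).

(** The Leibniz determinant over a finite index type, so that it can be taken over the real basis
    ['I_n * bool]. *)
Definition dt (A : T -> T -> K) : K :=
  \sum_(s : {perm T}) (-1) ^+ s * \prod_x A x (s x).

Lemma eq_dt A B : (forall x y, A x y = B x y) -> dt A = dt B.
Proof. by move=> AB; apply: eq_bigr => s _; congr (_ * _); apply: eq_bigr. Qed.

Lemma dt_row_perm (A : T -> T -> K) (p : {perm T}) :
  dt (fun x => A (p x)) = (-1) ^+ p * dt A.
Proof.
rewrite /dt mulr_sumr (reindex_inj (mulgI p)); apply: eq_bigr => s _.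
rewrite odd_permM signr_addb -mulrA; congr (_ * (_ * _)).
by rewrite [RHS](reindex_inj (@perm_inj _ p)); apply: eq_bigr => x _; rewrite permM.
Qed.

Lemma dt_alternate (A : T -> T -> K) x y :
  x != y -> (forall z, A x z = A y z) -> dt A = 0.
Proof.
move=> xy Axy; have := dt_row_perm A (tperm x y).
rewrite odd_tperm xy expr1 mulN1r.
have -> : dt (fun z => A (tperm x y z)) = dt A.
  by apply: eq_dt => z w; case: tpermP => // ->.
by move=> /eqP; rewrite -addr_eq0 -mulr2n mulrn_eq0 /= => /eqP.
Qed.

End AlternatingSums.

(** * The alternation formula in complex coordinates *)

Section PairSums.
Variables (R : realType) (n : nat).
Local Notation K := (C R).
Local Notation T := ('I_n * bool)%type.
Implicit Types f g : 'I_n -> T -> T -> K.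

(** The alternation sum of [wedge_top], for complex and not necessarily antisymmetric forms given by
    their values on [real_basis]. *)
Definition pairsum f : K :=
  \sum_(s : {perm T}) (-1) ^+ s * \prod_j f j (s (j, false)) (s (j, true)).

Lemma eq_pairsum f g : (forall j p q, p != q -> f j p q = g j p q) ->
  pairsum f = pairsum g.
Proof.
move=> fg; apply: eq_bigr => s _; congr (_ * _); apply: eq_bigr => j _.
by rewrite fg// (inj_eq perm_inj) xpair_eqE andbF.
Qed.

Lemma pairsum_swap (k : 'I_n) f g :
  (forall j p q, j != k -> f j p q = g j p q) ->
  (forall p q, f k p q = g k q p) -> pairsum f = - pairsum g.
Proof.
move=> fg fgk; rewrite /pairsum (reindex_inj (mulgI (tperm (k, false) (k, true)))) -sumrN.
apply: eq_bigr => s _; rewrite odd_permM odd_tperm xpair_eqE andbF signr_addb expr1 !mulN1r mulNr.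
congr (- (_ * _)); apply: eq_bigr => j _; rewrite !permM.
have [->|jk] := eqVneq j k; first by rewrite tpermL tpermR fgk.
by rewrite !tpermD ?fg//; rewrite xpair_eqE eq_sym (negPf jk).
Qed.

(** The sum over permutations already antisymmetrizes each pair, so antisymmetrizing one factor
    doubles it. In [F k] this has been undone for the first [k] factors. *)
Lemma pairsum_antisym f :
  pairsum (fun j p q => f j p q - f j q p) = 2 ^+ n * pairsum f.
Proof.
pose F k (j : 'I_n) p q := if (j < k)%N then f j p q else f j p q - f j q p.
have step k : (k < n)%N -> pairsum (F k) = 2 * pairsum (F k.+1).
  move=> kn; pose k' := Ordinal kn.
  have Fk j p q : j != k' -> F k.+1 j p q = F k j p q.
    by rewrite -val_eqE /F ltnS [(j <= k)%N]leq_eqVlt /= => /negPf ->.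
  pose G j p q := if j == k' then f j q p else F k j p q.
  have FG : pairsum (F k.+1) = - pairsum G.
    apply: (@pairsum_swap k') => [j p q jk|p q].
      by rewrite Fk// /G (negPf jk).
    by rewrite /G eqxx /F /= ltnSn.
  rewrite mulrDl mul1r {2}FG -sumrN -big_split /=; apply: eq_bigr => s _.
  rewrite -mulrN -mulrDr; congr (_ * _); rewrite (bigD1 k')//=.
  rewrite [X in _ = X + _](bigD1 k')//= [X in _ = _ - X](bigD1 k')//=.
  rewrite {1 3}/F /= ltnn ltnSn {1}/G eqxx mulrBl; congr (_ * _ - _ * _).
    by apply: eq_bigr => j jk; rewrite Fk.
  by apply: eq_bigr => j jk; rewrite /G (negPf jk).
have all k : (k <= n)%N -> pairsum (F 0%N) = 2 ^+ k * pairsum (F k).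
  elim: k => [|k IH] kn; first by rewrite expr0 mul1r.
  by rewrite (IH (ltnW kn)) (step _ kn) mulrA -exprSr.
rewrite [LHS](_ : _ = pairsum (F 0%N)); last by apply: eq_pairsum.
by rewrite (all n)//; congr (_ * _); apply: eq_pairsum => j p q _; rewrite /F ltn_ord.
Qed.

(* [zeta p] is the value of [dz_k] on [real_basis p], where [k = p.1]. *)
Definition zeta (p : T) : K := if p.2 then 'i%C else 1.

(** This evaluates the product of the [dz_j /\ dzbar_j = - 2 i dx_j /\ dy_j]. In [h] only the
    ordered pair of [dx_j] and [dy_j] is kept, so that only the identity permutation survives. *)
Lemma pairsum_base :
  pairsum (fun j p q => ((p.1 == j)%:R * zeta p) * ((q.1 == j)%:R * (zeta q)^*%C)) =
  (- 2 * 'i%C) ^+ n.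
Proof.
pose h (j : 'I_n) (p q : T) : K := - 'i%C * ((p == (j, false)) && (q == (j, true)))%:R.
have -> : pairsum (fun j p q => ((p.1 == j)%:R * zeta p) * ((q.1 == j)%:R * (zeta q)^*%C)) =
    pairsum (fun j p q => h j p q - h j q p).
  apply: eq_pairsum => j [p b] [q c]; rewrite !xpair_eqE /h /zeta !xpair_eqE /=.
  have [->|] := eqVneq p j; last by rewrite /= ?andbF !mul0r ?mulr0 subrr.
  have [_|] := eqVneq q j; last by rewrite /= ?andbF !mul0r ?mulr0 subrr.
  rewrite ?eqxx /=; case: b c => -[]//= _; apply/eqP; rewrite eq_complex /=; apply/andP; split; apply/eqP; ring.
rewrite pairsum_antisym /pairsum (bigD1 (1%g : {perm T}))//= odd_perm1 expr0 mul1r [X in _ + X]big1 ?addr0; last first.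
  move=> s s1; have [x sx] : exists x, s x != x.
    apply/existsP; apply: contraR s1 => /existsPn s1; apply/eqP/permP => x.
    by rewrite perm1; have := s1 x; rewrite negbK => /eqP.
  apply/eqP; rewrite mulf_eq0; apply/orP; right.
  apply/prodf_eq0; exists x.1 => //; rewrite /h.
  case: x sx => x [] sx /=; first by rewrite (negPf sx) andbF mulr0.
  by rewrite (negPf sx) mulr0.
under eq_bigr do rewrite /h !perm1 !eqxx mulr1.
by rewrite prodr_const card_ord -exprMn mulrN mulNr.
Qed.

(** The permutation [s] acting on one of the two copies of ['I_n], that of the [dz] or that of the
    [dzbar]. *)
Definition block_perm_fun (b : bool) (s : 'S_n) (p : T) : T :=
  if p.2 == b then (s p.1, b) else p.

Lemma block_perm_inj b s : injective (block_perm_fun b s).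
Proof.
move=> [x c] [y d]; rewrite /block_perm_fun /=.
case: eqP => [->|cb]; case: eqP => [->|db] //.
- by move=> [/perm_inj ->].
- by move=> [_ bd]; case: db.
- by move=> [_ bd]; case: cb.
Qed.

Definition block_perm b s : {perm T} := perm (@block_perm_inj b s).

Lemma block_permM b s t : block_perm b (s * t)%g = (block_perm b s * block_perm b t)%g.
Proof.
apply/permP => -[x c]; rewrite permM !permE /block_perm_fun /=.
by case: (eqVneq c b) => [_|/negPf cb] /=; rewrite ?eqxx ?permM ?cb.
Qed.

Lemma odd_block_perm b s : odd_perm (block_perm b s) = odd_perm s.
Proof.
have [ts -> dts] := prod_tpermP s; elim: ts dts => [|[x y] ts IH] /=.
  rewrite !big_nil odd_perm1 => _; rewrite -[RHS](@odd_perm1 T); congr odd_perm.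
  apply/permP => -[x c]; rewrite permE perm1 /block_perm_fun /=.
  by case: eqP => [<-|//]; rewrite perm1.
move=> /andP[xy /IH]; rewrite !big_cons block_permM !odd_permM => ->; congr (_ (+) _).
rewrite -[LHS]/(odd_perm (block_perm b (tperm x y))) odd_tperm.
have -> : block_perm b (tperm x y) = tperm (x, b) (y, b).
  apply/permP => -[z c]; rewrite permE /block_perm_fun /=.
  case: (eqVneq c b) => [->|cb]; last by rewrite tpermD// xpair_eqE [b == c]eq_sym (negPf cb) andbF.
  have inj : injective (fun z : 'I_n => (z, b)) by move=> ? ? [].
  exact: (inj_tperm _ _ _ inj).
by rewrite odd_tperm xpair_eqE eqxx andbT.
Qed.

(** Each factor is expanded in the [dz_k /\ dzbar_l]. A choice repeating some [dz_k] or [dzbar_l]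
    gives a determinant with two equal rows; the others are pairs of permutations, and reordering
    them to the base case costs both signatures. *)
Lemma pairsum_mixed (H : 'I_n -> 'I_n -> 'I_n -> K) :
  pairsum (fun j p q => H j p.1 q.1 * (zeta p * (zeta q)^*%C)) =
  (- 2 * 'i%C) ^+ n * \sum_(s : 'S_n) \sum_(t : 'S_n)
    (-1) ^+ s * (-1) ^+ t * \prod_j H j (s j) (t j).
Proof.
pose A (k l : 'I_n -> 'I_n) (x p : T) : K :=
  if x.2 then (p.1 == l x.1)%:R * (zeta p)^*%C else (p.1 == k x.1)%:R * zeta p.
have pairE (k l : 'I_n -> 'I_n) : pairsum (fun j p q =>
    ((p.1 == k j)%:R * zeta p) * ((q.1 == l j)%:R * (zeta q)^*%C)) = dt (A k l).
  apply: eq_bigr => s _; congr (_ * _).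
  transitivity (\prod_j \prod_b A k l (j, b) (s (j, b))); last first.
    by rewrite pair_bigA; apply: eq_bigr => -[].
  by apply: eq_bigr => j _; rewrite big_bool /A /= mulrC.
transitivity (\sum_(f : {ffun 'I_n -> 'I_n * 'I_n})
   (\prod_j H j (f j).1 (f j).2) * dt (A (fun j => (f j).1) (fun j => (f j).2))).
  under [RHS]eq_bigr do rewrite -pairE mulr_sumr.
  rewrite exchange_big /=; apply: eq_bigr => s _.
  under [RHS]eq_bigr do rewrite mulrCA -big_split /=.
  rewrite -mulr_sumr; congr (_ * _).
  rewrite -(bigA_distr_bigA (fun j (kl : 'I_n * 'I_n) => H j kl.1 kl.2 *
    (((s (j, false)).1 == kl.1)%:R * zeta (s (j, false)) *
     (((s (j, true)).1 == kl.2)%:R * (zeta (s (j, true)))^*%C)))) /=.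
  apply: eq_bigr => j _; rewrite (bigD1 ((s (j, false)).1, (s (j, true)).1))//= !eqxx !mul1r.
  rewrite big1 ?addr0// => -[k l]; rewrite xpair_eqE negb_and => /orP[] /negPf.
    by rewrite eq_sym /= => ->; rewrite !mul0r mulr0.
  by rewrite eq_sym /= => ->; rewrite !mul0r !mulr0.
pose inj2 (f : {ffun 'I_n -> 'I_n * 'I_n}) :=
  injectiveb [ffun j => (f j).1] && injectiveb [ffun j => (f j).2].
rewrite (bigID inj2) /= addrC big1 ?add0r; last first.
  move=> f; rewrite negb_and => /orP[] /injectivePn[i [j ij]]; rewrite !ffunE => fij.
    rewrite (@dt_alternate _ _ _ (i, false) (j, false)) ?mulr0//.
      by rewrite xpair_eqE negb_and ij.
    by move=> z; rewrite /A /= fij.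
  rewrite (@dt_alternate _ _ _ (i, true) (j, true)) ?mulr0//.
    by rewrite xpair_eqE negb_and ij.
  by move=> z; rewrite /A /= fij.
(* The default value is never taken: both coordinate maps of [f] are injective wherever this inverse
   is used. *)
pose in_Sn := insubd (1%g : 'S_n).
have in_SnE (g : {ffun 'I_n -> 'I_n}) j : injectiveb g -> in_Sn g j = g j.
  by move=> ig; rewrite -pvalE; congr (fun_of_fin _ _); exact: insubdK.
rewrite (reindex (fun st : 'S_n * 'S_n => [ffun j => (st.1 j, st.2 j)])) /=; last first.
  exists (fun f : {ffun 'I_n -> 'I_n * 'I_n} =>
      (in_Sn [ffun j => (f j).1], in_Sn [ffun j => (f j).2])) => /=.
    move=> [s t] _ /=; congr pair; apply/permP => j.
      by rewrite in_SnE ?ffunE//; apply/injectiveP => x y; rewrite !ffunE => /perm_inj.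
    by rewrite in_SnE ?ffunE//; apply/injectiveP => x y; rewrite !ffunE => /perm_inj.
  move=> f /andP[f1 f2]; apply/ffunP => j; rewrite ffunE !in_SnE//= !ffunE.
  by case: (f j).
rewrite (eq_bigl xpredT); last first.
  move=> [s t]; apply/andP; split; apply/injectiveP => x y; rewrite !ffunE /= => /perm_inj//.
rewrite pair_big /= mulr_sumr; apply: eq_bigr => -[s t] _ /=.
have -> : dt (A (fun j => ([ffun j => (s j, t j)] j).1) (fun j => ([ffun j => (s j, t j)] j).2)) =
   (-1) ^+ s * (-1) ^+ t * (- 2 * 'i%C) ^+ n.
  rewrite -pairsum_base pairE -mulrA -(odd_block_perm false s) -(odd_block_perm true t).
  rewrite mulrA -signr_addb -odd_permM -dt_row_perm; apply: eq_dt => -[x b] y.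
  by rewrite permM !permE /block_perm_fun /A !ffunE /=; case: b.
rewrite [LHS]mulrC [X in X * _]mulrC -[LHS]mulrA; congr (_ * (_ * _)).
by apply: eq_bigr => j _; rewrite ffunE.
Qed.

End PairSums.

(** * Mixed discriminants and their hyperbolicity *)

Section MixedDiscriminant.
Variables (R : realType) (n' : nat).
Local Notation n := n'.+1.
Local Notation K := (C R).
Local Notation M := 'M[K]_n.
Local Notation Im := (@complex.Im R).
Local Notation Re := (@complex.Re R).

(** The polarization of [n! det]. Summing over both row and column permutations makes the symmetry
    in [L] a mere reindexing. *)
Definition mixdisc (L : seq M) : K :=
  \sum_(s : 'S_n) \sum_(t : 'S_n)
    (-1) ^+ s * (-1) ^+ t * \prod_(j < n) (nth 0 L j) (s j) (t j).

Lemma mixdisc_perm (L L' : seq M) : size L = n -> perm_eq L L' ->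
  mixdisc L = mixdisc L'.
Proof.
move=> sL LL'; have sL' : size L' == n by rewrite -(perm_size LL') sL.
have /tuple_permP[p Lp] : perm_eq L (Tuple sL') by [].
have Lj (j : 'I_n) : nth 0 L j = nth 0 L' (p j).
  by rewrite Lp -[in LHS](tnth_nth 0 _ j) tnth_mktuple (tnth_nth 0).
rewrite /mixdisc [LHS](reindex_inj (mulgI p)); apply: eq_bigr => s _.
rewrite [LHS](reindex_inj (mulgI p)); apply: eq_bigr => t _.
rewrite !odd_permM -signr_addb addbACA addbb addFb signr_addb; congr (_ * _).
rewrite [RHS](reindex_inj (@perm_inj _ p)); apply: eq_bigr => j _.
by rewrite Lj !permM.
Qed.

Lemma mixdisc_linear (c : K) (x y : M) L : (size L).+1 = n ->
  mixdisc (c *: x + y :: L) = c * mixdisc (x :: L) + mixdisc (y :: L).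
Proof.
move=> _; rewrite /mixdisc mulr_sumr -big_split; apply: eq_bigr => s _ /=.
rewrite mulr_sumr -big_split; apply: eq_bigr => t _ /=.
rewrite !big_ord_recl /= !mxE mulrDl mulrDr; congr (_ + _).
by rewrite -(mulrA c) mulrCA.
Qed.

Lemma mixdisc_nseq (X : M) : mixdisc (nseq n X) = n`!%:R * \det X.
Proof.
transitivity (\sum_(s : 'S_n) \det X); last first.
  by rewrite sumr_const card_Sn mulr_natl.
apply: eq_bigr => s _; rewrite (reindex_inj (mulgI s)); apply: eq_bigr => t _.
rewrite odd_permM signr_addb signrMK; congr (_ * _).
rewrite [RHS](reindex_inj (@perm_inj _ s)); apply: eq_bigr => j _.
by rewrite nth_nseq ltn_ord permM.
Qed.

(** Exchanging the columns chosen for the two equal rank-one entries changes only the sign. Hence an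
    expansion in a rank-one matrix stops after the first order. *)
Lemma mixdisc_rank1 (v w : 'I_n -> K) L : (1 < n)%N ->
  mixdisc (\matrix_(i, j) (v i * w j) :: \matrix_(i, j) (v i * w j) :: L) = 0.
Proof.
move=> n1; pose i1 : 'I_n := Ordinal n1.
rewrite /mixdisc big1// => s _; set S := (X in X = 0).
have i10 : i1 != ord0 by [].
suff : S = - S by move=> /eqP; rewrite -addr_eq0 -mulr2n mulrn_eq0 /= => /eqP.
rewrite {1}/S (reindex_inj (mulgI (tperm ord0 i1))) -sumrN; apply: eq_bigr => t _.
rewrite odd_permM odd_tperm eq_sym i10 signr_addb expr1 mulN1r mulrN mulNr.
congr (- (_ * _)); rewrite (bigD1 ord0)//= (bigD1 i1)//= [in RHS](bigD1 ord0)//= [in RHS](bigD1 i1)//=.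
rewrite !mxE !permM tpermL tpermR.
rewrite !mulrA.
congr (_ * _); first by ring.
apply: eq_bigr => j /andP[j0 j1]; rewrite permM tpermD//; by rewrite eq_sym.
Qed.

Lemma mixdisc_trace (X : M) c :
  mixdisc (X :: nseq n' c%:M) = c ^+ n' * n'`!%:R * \tr X.
Proof.
transitivity (c ^+ n' * \sum_(s : 'S_n) X (s ord0) (s ord0)).
  rewrite /mixdisc mulr_sumr; apply: eq_bigr => s _.
  rewrite (bigD1 s)//= [X in _ + X]big1 ?addr0; last first.
    (* Distinct permutations differ somewhere off [ord0], and there the product meets an
       off-diagonal entry of the scalar matrix. *)
    move=> t ts; have [j tj] : exists j : 'I_n', t (lift ord0 j) != s (lift ord0 j).
      apply/existsP; apply: contraR ts => /existsPn st; apply/eqP/permP => k.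
      have h j : j != ord0 -> t j = s j.
        rewrite eq_sym => /unlift_some[i -> _]; apply/eqP.
        by have := st i; rewrite negbK.
      have [->|k0] := eqVneq k ord0; last exact: h.
      pose l := (s^-1)%g (t ord0); have sl : s l = t ord0 by rewrite permKV.
      have [l0|l0] := eqVneq l ord0; first by rewrite -sl l0.
      by have := h _ l0; rewrite sl => /perm_inj l0'; rewrite l0' eqxx in l0.
    rewrite big_ord_recl /= (bigD1 j)//= nth_nseq ltn_ord mxE eq_sym (negPf tj).
    by rewrite mulr0n mul0r !mulr0.
  rewrite -signr_addb addbb expr0 mul1r big_ord_recl /= mulrC; congr (_ * _).
  rewrite (eq_bigr (fun _ => c)); first by rewrite prodr_const card_ord.
  by move=> j _; rewrite nth_nseq ltn_ord mxE eqxx mulr1n.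
rewrite -mulrA; congr (_ * _).
(* By symmetry [ord0] may be replaced by any index [k]; summing over [k] produces a full trace for
   each permutation. *)
apply: (@mulfI _ n%:R); first by rewrite pnatr_eq0.
rewrite mulrA -natrM -factS.
transitivity (\sum_(k < n) \sum_(s : 'S_n) X (s k) (s k)).
  rewrite -[n in n%:R]card_ord -sum1_card natr_sum mulr_suml; apply: eq_bigr => k _.
  rewrite mul1r (reindex_inj (mulgI (tperm ord0 k))); apply: eq_bigr => s _.
  by rewrite permM tpermL.
rewrite exchange_big -[n`!]card_Sn -sum1_card natr_sum mulr_suml; apply: eq_bigr => s _.
by rewrite mul1r /mxtrace [RHS](reindex_inj (@perm_inj _ s)).
Qed.

Definition hermitian (X : M) := forall i j, X i j = (X j i)^*%C.

(* [beta = dd^c |z|^2] has matrix [4 I] in the normalization of [form_mx]. *)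
Local Notation e := (4%:M : M).

(** A kernel vector [v] would give [v X v^* + 4 z |v|^2 = 0], where the first term is real and the
    second is not. *)
Lemma hermitian_det (X : M) z : hermitian X -> Im z != 0 -> \det (X + z *: e) != 0.
Proof.
move=> hX z0; apply/negP => /det0P[v v0]; rewrite mulmxDr => vX.
have := congr1 (fun A : 'rV[K]_n => (A *m (map_mx (@conjc R) v)^T) 0 0) vX.
rewrite mul0mx mulmxDl [LHS]mxE [RHS]mxE.
set q := (X in X + _ = _).
rewrite scale_scalar_mx mul_mx_scalar -scalemxAl mxE.
set N := (X in _ * X); have N0 : 0 < N.
  rewrite /N mxE; have [i vi] : exists i, v 0 i != 0.
    apply/existsP; apply: contraR v0 => /existsPn v0; apply/eqP/rowP => i.
    by have := v0 i; rewrite negbK mxE => /eqP.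
  rewrite (bigD1 i)//= ltr_pwDl//.
    by rewrite !mxE lt_neqAle mulcJ_ge0 andbT eq_sym mulf_neq0// conjc_eq0.
  by apply: sumr_ge0 => k _; rewrite !mxE mulcJ_ge0.
have q0 : Im q = 0.
  have : q^*%C = q.
    rewrite /q !mxE rmorph_sum /=.
    under eq_bigr do rewrite !mxE rmorphM /= conjcK rmorph_sum mulr_suml.
    under [RHS]eq_bigr do rewrite !mxE mulr_suml.
    rewrite exchange_big; apply: eq_bigr => i _; apply: eq_bigr => j _ /=.
    by rewrite rmorphM/= -hX mulrC mulrA mulrAC.
  by case: (q) => a b [] /eqP; rewrite -subr_eq0 -opprD oppr_eq0 -mulr2n mulrn_eq0 => /eqP.
move=> /(congr1 Im); rewrite raddfD/= q0 add0r.
have NE : N = (Re N)%:C%C by apply: complex_real_eq; move: N0; rewrite ltcE => /andP[/eqP].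
have rN : 0 < Re N by move: N0; rewrite ltcE => /andP[].
have -> : Im (z * 4 * N) = Im z * 4 * Re N.
  by rewrite NE -(rmorph_nat (real_complex R)); case: (z) => a b /=; ring.
by move/eqP; rewrite !mulf_eq0 (negPf z0) pnatr_eq0 (gt_eqF rN).
Qed.

Lemma hermitianD (X Y : M) : hermitian X -> hermitian Y -> hermitian (X + Y).
Proof. by move=> hX hY i j; rewrite !mxE rmorphD /= -hX -hY. Qed.

Lemma hermitianZ (r : R) (X : M) : hermitian X -> hermitian (r%:C%C *: X).
Proof.
move=> hX i j; rewrite !mxE hX; case: (X j i) => a b; apply/eqP.
by rewrite eq_complex /=; apply/andP; split; apply/eqP; ring.
Qed.

Lemma hermitian_e : hermitian e.
Proof.
move=> i j; rewrite !mxE eq_sym -(rmorph_nat (real_complex R)) -rmorphMn.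
by rewrite conjc_real.
Qed.

Lemma hyperbolic_e k : (k <= n)%N ->
  hyperbolic mixdisc hermitian e (n - k) (nseq k e).
Proof.
elim: k => [_|k IH kn].
  rewrite subn0; split; last rewrite cats0 mixdisc_nseq.
    by move=> X z hX z0; rewrite cats0 mixdisc_nseq mulf_neq0 ?hermitian_det// pnatr_eq0 -lt0n fact_gt0.
  by rewrite det_scalar mulr_gt0// ?exprn_gt0// ltr0n// fact_gt0.
have := IH (ltnW kn).
have nkE : (n - k = (n - k.+1).+1)%N by rewrite subnS prednK ?subn_gt0.
have nk : ((n - k.+1).+1 + size (nseq k e))%N = n by rewrite size_nseq -nkE subnK// ltnW.
rewrite nkE => hk.
apply: (@hyperbolic_derivative _ _ mixdisc n).
- exact: mixdisc_perm.
- exact: mixdisc_linear.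
- exact: hermitianD.
- exact: hermitianZ.
- exact: hermitian_e.
- by [].
- by [].
- apply: (@cone_e _ _ mixdisc n) => //.
  + exact: mixdisc_perm.
  + exact: mixdisc_linear.
  + exact: hermitian_e.
Qed.

Definition mpos m (X : M) := hermitian X /\
  forall k, (1 <= k <= m)%N -> 0 <= mixdisc (nseq k X ++ nseq (n - k) e).

(** The binomial expansion in powers of [eps + t] has nonnegative coefficients by m-positivity, and
    its top one is [mixdisc (e, ..., e) > 0]. So an m-positive matrix is a limit of points of the
    open cone. *)
Lemma mpos_cone m X (eps : R) : (m <= n)%N -> 0 < eps -> mpos m X ->
  cone mixdisc hermitian e m (nseq (n - m) e) (X + eps%:C%C *: e).
Proof.
move=> mn eps0 [hX pX]; split.
  by apply: hermitianD => //; apply: hermitianZ; exact: hermitian_e.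
move=> t t0; rewrite -addrA -scalerDl -rmorphD.
have c0 : 0 < (eps + t)%:C%C :> K by rewrite ltcR ltr_wpDr.
rewrite (@multilinear_binomial _ _ mixdisc n mixdisc_perm mixdisc_linear); last first.
  by rewrite size_nseq subnKC.
have catE j : (j <= m)%N -> mixdisc (nseq j e ++ nseq (m - j) X ++ nseq (n - m) e) =
    mixdisc (nseq (m - j) X ++ nseq (n - (m - j)) e).
  move=> jm; apply: mixdisc_perm; first by rewrite !size_cat !size_nseq; lia.
  rewrite perm_catCA -nseqD perm_cat2l; suff -> : (n - (m - j) = j + (n - m))%N by [].
  lia.
rewrite big_ord_recr /= ltr_wpDl//.
  apply: sumr_ge0 => j _; apply: mulr_ge0; first by rewrite exprn_ge0// ltW.
  have jm := ltnW (ltn_ord j); rewrite (catE _ jm); apply: mulrn_wge0.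
  by apply: pX; have := ltn_ord j; lia.
rewrite (catE _ (leqnn m)) subnn subn0 binn mulr1n; apply: mulr_gt0; first exact: exprn_gt0.
rewrite cat0s mixdisc_nseq.
by rewrite det_scalar mulr_gt0// ?exprn_gt0// ltr0n// fact_gt0.
Qed.

Lemma affine_pos_limit (a b : K) :
  (forall eps : R, 0 < eps -> 0 <= a + eps%:C%C * b) -> 0 <= a.
Proof.
move=> h; case: a b h => a a' [b b'] h.
(* Being nonnegative in [K] includes being real: two values of [eps] force the imaginary part of [a]
   to vanish. *)
have := h 1 ltr01; have := h 2 (ltr0n _ _); rewrite !lecE /=.
move=> /andP[/eqP h2 _] /andP[/eqP h1 _].
apply/andP; split; first by apply/eqP; move: h1 h2; rewrite !mul0r !addr0; lra.
rewrite leNgt; apply/negP => a0.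
have B0 : 0 < `|b| + 1 by rewrite ltr_wpDl.
(* For this [eps] one has [eps * b <= - a / 2], so [a < 0] would leave the sum negative. *)
have eps0 : 0 < - a / 2 / (`|b| + 1) by rewrite !divr_gt0// oppr_gt0.
have := h _ eps0; rewrite lecE /= => /andP[_].
rewrite mul0r subr0 leNgt => /negP; apply.
have : - a / 2 / (`|b| + 1) * b <= - a / 2.
  rewrite -mulrA ler_piMr//; first by rewrite divr_ge0// oppr_ge0 ltW.
  by rewrite mulrC ler_pdivrMr// mul1r (le_trans (ler_norm _))// lerDl.
lra.
Qed.

(** The entries are pushed into the open cone one at a time, [t] collecting those already moved.
    Each single perturbation is affine in [eps], so that its limit is given by
    [affine_pos_limit]. *)
Theorem garding_mpos (m : nat) (s : seq M) : (m <= n)%N -> size s = m ->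
  (forall X, X \in s -> mpos m X) -> 0 <= mixdisc (s ++ nseq (n - m) e).
Proof.
move=> mn sm sP; set L := nseq _ _.
suff : forall t, (size s + size t = m)%N ->
    (forall X, X \in t -> cone mixdisc hermitian e m L X) ->
    0 <= mixdisc (s ++ t ++ L).
  by move=> /(_ [::]); apply => //; rewrite addn0.
have : (size s <= m)%N by rewrite sm.
elim: s sP {sm} => [|X s IH] sP sm t st tP.
  rewrite /= ltW//; apply: (@garding_pos _ _ mixdisc n hermitian e) => //.
  - exact: mixdisc_perm.
  - exact: mixdisc_linear.
  - exact: hermitianD.
  - exact: hermitianZ.
  - exact: hermitian_e.
  - by rewrite -[size t]add0n st size_nseq subnKC.
  - by rewrite -[size t]add0n st -{1}(subKn mn); apply: hyperbolic_e; exact: leq_subr.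
  - by rewrite -[size t]add0n st.
apply: (@affine_pos_limit _ (mixdisc (e :: s ++ t ++ L))) => eps eps0.
rewrite addrC -mixdisc_linear; last first.
  by rewrite !size_cat size_nseq; move: st => /=; lia.
rewrite (@mixdisc_perm _ (s ++ (eps%:C%C *: e + X :: t) ++ L)); first last.
  - by rewrite -cat1s perm_catCA.
  - by rewrite /= !size_cat size_nseq; move: st => /=; lia.
apply: IH => //.
- by move=> Y Ys; apply: sP; rewrite inE Ys orbT.
- exact: ltnW.
- by rewrite /= addnS.
- move=> Y; rewrite inE => /orP[/eqP ->|]; last exact: tP.
  by rewrite addrC; apply: mpos_cone => //; apply: sP; rewrite mem_head.
Qed.

End MixedDiscriminant.

(** * Hermitian matrices of real (1,1)-forms *)

Section FormMatrices.
Variables (R : realType) (n' : nat).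
Local Notation n := n'.+1.
Local Notation K := (C R).
Local Notation Cn := (Cn R n).
Local Notation rb := (@real_basis R n).
Local Notation Re := (@complex.Re R).
Local Notation Im := (@complex.Im R).

(** The matrix [H] with [w = (i / 2) sum_kl H_kl dz_k /\ dzbar_l]. *)
Definition form_mx (w : form2 R n) : 'M[K]_n :=
  \matrix_(k, l) ((w (rb (k, false)) (rb (l, true)) -i* w (rb (k, false)) (rb (l, false)))%C : K).

Lemma mulI_mulI (v : Cn) : mulI (mulI v) = real_scale (-1) v.
Proof.
rewrite /mulI /real_scale scalerA; congr (_ *: _); apply/eqP.
by rewrite eq_complex /=; apply/andP; split; apply/eqP; ring.
Qed.

Lemma form11_sym w k l : is_form11 w ->
  w (rb (l, false)) (rb (k, true)) = w (rb (k, false)) (rb (l, true)).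
Proof.
move=> [_ wZ wN wI].
by rewrite /real_basis /= -[LHS]wI mulI_mulI wN wZ mulN1r opprK.
Qed.

Lemma form_mx_hermitian w : is_form11 w -> hermitian (form_mx w).
Proof.
move=> w11 k l; rewrite !mxE (form11_sym _ _ w11).
have [_ _ wN _] := w11; rewrite (wN (rb (k, false)) (rb (l, false))).
by apply/eqP; rewrite eq_complex /= !eqxx.
Qed.

Lemma form11E w p q : is_form11 w ->
  ((w (rb p) (rb q))%:C%C : K) =
  'i%C / 2 * form_mx w p.1 q.1 * (zeta R p * (zeta R q)^*%C) -
  'i%C / 2 * form_mx w q.1 p.1 * (zeta R q * (zeta R p)^*%C).
Proof.
move=> w11; have [_ _ wN wI] := w11; have sym k l := form11_sym k l w11.
have alt k l : w (rb (l, false)) (rb (k, false)) = - w (rb (k, false)) (rb (l, false)) by rewrite wN.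
have h2 : (2 : K)^-1 = (2^-1 : R)%:C%C by rewrite -(rmorph_nat (real_complex R)) fmorphV.
case: p q => [k b] [l c]; rewrite !mxE h2 /zeta /=.
rewrite (sym k l) (alt k l).
have E4 : w (rb (k, true)) (rb (l, true)) = w (rb (k, false)) (rb (l, false)) by rewrite /real_basis /= wI.
have E3 : w (rb (k, true)) (rb (l, false)) = - w (rb (k, false)) (rb (l, true)) by rewrite wN sym.
by case: b c => -[]; rewrite ?E3 ?E4; apply/eqP; rewrite eq_complex /=; apply/andP; split; apply/eqP; field.
Qed.

(** The factor [2 ^- n] cancels the antisymmetrization, and [(i / 2) ^+ n] cancels the constant
    [(- 2 i) ^+ n] of the base case. *)
Lemma wedge_top_mixdisc (ws : seq (form2 R n)) : size ws = n ->
  (forall j, (j < n)%N -> is_form11 (nth (fun _ _ => 0) ws j)) ->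
  (wedge_top ws)%:C%C = mixdisc (map form_mx ws).
Proof.
move=> sw wP; pose w j := nth (fun _ _ => 0 : R) ws j.
pose U (j : 'I_n) (p q : 'I_n * bool) : K :=
  'i%C / 2 * form_mx (w j) p.1 q.1 * (zeta R p * (zeta R q)^*%C).
have -> : (wedge_top ws)%:C%C = 2 ^- n * pairsum (fun j p q => U j p q - U j q p).
  rewrite /wedge_top rmorphM fmorphV rmorphXn rmorph_nat rmorph_sum /=; congr (_ * _).
  apply: eq_bigr => s _; rewrite rmorphM rmorph_sign rmorph_prod; congr (_ * _).
  by apply: eq_bigr => j _; rewrite -form11E//; exact: wP.
rewrite pairsum_antisym mulKf ?expf_neq0 ?pnatr_eq0//.
rewrite (pairsum_mixed (fun (j : 'I_n) k l => 'i%C / 2 * form_mx (w j) k l)).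
rewrite /mixdisc mulr_sumr; apply: eq_bigr => s _; rewrite mulr_sumr; apply: eq_bigr => t _.
rewrite big_split /= prodr_const card_ord [X in _ * X]mulrCA [LHS]mulrA -exprMn.
have -> : - 2 * 'i%C * ('i%C / 2) = 1 :> K.
  by rewrite mulrA -[X in X / _]mulrA -expr2 sqr_i mulrN1 opprK divff// pnatr_eq0.
rewrite expr1n mul1r; congr (_ * _); apply: eq_bigr => j _.
by rewrite (nth_map (fun _ _ => 0)) ?sw.
Qed.

Definition dotp (v w : Cn) : R :=
  \sum_j (Re (v ord0 j) * Re (w ord0 j) + Im (v ord0 j) * Im (w ord0 j)).

Lemma dotpC v w : dotp v w = dotp w v.
Proof. by apply: eq_bigr => j _; rewrite mulrC [X in _ + X]mulrC. Qed.

Lemma dotpDl u v w : dotp (u + v) w = dotp u w + dotp v w.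
Proof.
by rewrite /dotp -big_split; apply: eq_bigr => j _; rewrite !mxE !raddfD /=; ring.
Qed.

Lemma dotpDr u v w : dotp w (u + v) = dotp w u + dotp w v.
Proof. by rewrite ![dotp w _]dotpC dotpDl. Qed.

Lemma dotpZl t v w : dotp (real_scale t v) w = t * dotp v w.
Proof.
rewrite /dotp mulr_sumr; apply: eq_bigr => j _; rewrite !mxE.
by case: (v ord0 j) => a b /=; ring.
Qed.

Lemma dotpZr t v w : dotp v (real_scale t w) = t * dotp v w.
Proof. by rewrite dotpC dotpZl dotpC. Qed.

Lemma dotp_mulI v w : dotp (mulI v) (mulI w) = dotp v w.
Proof.
apply: eq_bigr => j _; rewrite !mxE.
by case: (v ord0 j) (w ord0 j) => a b [c d] /=; ring.
Qed.

Lemma dotp_mulIl v w : dotp (mulI v) w = - dotp v (mulI w).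
Proof.
rewrite -[RHS]mulN1r -dotpZl -mulI_mulI dotp_mulI//.
Qed.

Lemma sqnormE z : sqnorm z = dotp z z.
Proof.
apply: eq_bigr => j _; case: (z ord0 j) => a b /=.
by rewrite sqr_sqrtr ?addr_ge0 ?sqr_ge0.
Qed.

Lemma dotp_basis z p : dotp z (rb p) = if p.2 then Im (z ord0 p.1) else Re (z ord0 p.1).
Proof.
case: p => k b; rewrite /dotp (bigD1 k)//= big1 ?addr0.
  by case: b; rewrite /real_basis /= !mxE !eqxx /=; case: (z ord0 k) => x y /=; ring.
move=> j jk; case: b; rewrite /real_basis /= !mxE (negPf jk) /=; ring.
Qed.

Lemma mulI_basis k b : mulI (rb (k, b)) =
  if b then real_scale (-1) (rb (k, false)) else rb (k, true).
Proof. by case: b => //; rewrite /real_basis /= mulI_mulI. Qed.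

(* [dd^c (G (|z|^2))] with [a = G' (|z|^2)] and [b = G'' (|z|^2)]. *)
Definition hess_form (a b : R) (z : Cn) : form2 R n := fun v w =>
  4 * a * dotp (mulI v) w + 4 * b * (dotp z w * dotp z (mulI v) - dotp z v * dotp z (mulI w)).

Lemma mulID (v w : Cn) : mulI (v + w) = mulI v + mulI w.
Proof. exact: scalerDr. Qed.

Lemma mulI_real_scale t (v : Cn) : mulI (real_scale t v) = real_scale t (mulI v).
Proof. by rewrite /mulI /real_scale !scalerA mulrC. Qed.

Lemma hess_form11 a b z : is_form11 (hess_form a b z).
Proof.
rewrite /hess_form; split.
- by move=> v v1 v2 /=; rewrite mulID !dotpDl !dotpDr; ring.
- by move=> t v1 v2; rewrite mulI_real_scale !dotpZl !dotpZr; ring.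
- by move=> v1 v2; rewrite dotp_mulIl (dotpC v1); ring.
- by move=> v1 v2; rewrite dotp_mulI !mulI_mulI !dotpZr -(dotp_mulI (mulI v1)) mulI_mulI dotpZl; ring.
Qed.

Lemma form_mx_hess a b z : form_mx (hess_form a b z) =
  a%:C%C *: 4%:M + (4 * b)%:C%C *: \matrix_(k, l) ((z ord0 k)^*%C * z ord0 l).
Proof.
apply/matrixP => k l; rewrite !mxE /hess_form !mulI_basis !dotp_basis dotpZr !dotp_basis /=.
rewrite -(rmorph_nat (real_complex R)) !mxE eqxx /= eq_sym.
case: (z ord0 k) (z ord0 l) => x y [x' y'].
by have [_|_] := eqVneq k l; apply/eqP; rewrite eq_complex /=; apply/andP; split; apply/eqP; ring.
Qed.

(** The part in [b] has rank one, so with [k] copies the mixed discriminant is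
    [a^(k-1) 4^n (n-1)! (n a + k b |z|^2)]. *)
Lemma mpos_hess m a b z : (m <= n)%N -> 0 <= a ->
  0 <= n%:R * a + m%:R * (b * sqnorm z) -> mpos m (form_mx (hess_form a b z)).
Proof.
move=> mn a0 ab0; split.
  move=> k l; rewrite form_mx_hess !mxE -(rmorph_nat (real_complex R)) [l == k]eq_sym.
  case: (z ord0 k) (z ord0 l) => x y [x' y'].
  by have [_|_] := eqVneq k l; apply/eqP; rewrite eq_complex /=; apply/andP; split; apply/eqP; ring.
case=> [//|k] /andP[_ km]; rewrite form_mx_hess; set P := \matrix_(_, _) _.
set e := 4%:M; set c := (4 * b)%:C%C; set aa : K := a%:C%C.
have kn : (k < n)%N by exact: leq_trans km mn.
have kE : (k.+1 + size (nseq (n - k.+1) e))%N = n by rewrite size_nseq subnKC.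
rewrite (multilinear_binomial (@mixdisc_perm R n') (@mixdisc_linear R n'))//.
rewrite !big_ord_recl [X in _ + (_ + X)]big1 ?addr0; last first.
  by move=> j _; rewrite lift0 /= mixdisc_rank1 ?mul0rn ?mulr0//; have := ltn_ord j; lia.
rewrite lift0 /= bin0 bin1 subn1 /= !mulr1n expr0 mul1r expr1.
rewrite -[aa *: e :: _]/(nseq k.+1 (aa *: e) ++ _).
rewrite (multilinear_scale (@mixdisc_perm R n') (@mixdisc_linear R n'))//.
rewrite (multilinear_swap (@mixdisc_perm R n') P); last by rewrite !size_nseq; lia.
rewrite (multilinear_scale (@mixdisc_perm R n') (@mixdisc_linear R n'))/=; last by rewrite size_nseq; lia.
rewrite -(multilinear_swap (@mixdisc_perm R n') P); last by rewrite !size_nseq; lia.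
rewrite -[e :: _]/(nseq k.+1 e ++ _) -!nseqD subnKC// subSS subnKC//.
rewrite mixdisc_nseq mixdisc_trace det_scalar.
have -> : \tr P = (sqnorm z)%:C%C.
  rewrite rmorph_sum; apply: eq_bigr => j _; rewrite mxE; case: (z ord0 j) => x y.
  apply/eqP; rewrite eq_complex /= sqr_sqrtr ?addr_ge0 ?sqr_ge0//.
  by apply/andP; split; apply/eqP; ring.
rewrite -!(rmorph_nat (real_complex R)) -!(rmorphXn (real_complex R)) -!(rmorphM (real_complex R)).
rewrite -(rmorphMn (real_complex R)) -(rmorphM (real_complex R)) -(rmorphD (real_complex R)) ler0c.
have fE : n`!%:R = n%:R * n'`!%:R :> R by rewrite factS natrM.
rewrite fE; set f := n'`!%:R; set s := sqnorm z.
have f0 : 0 <= f by rewrite ler0n.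
have s0 : 0 <= s by rewrite /s sqnormE; apply: sumr_ge0 => j _; rewrite addr_ge0// -expr2 sqr_ge0.
rewrite -[_ *+ k.+1]mulr_natr.
have -> : a ^+ k.+1 * (n%:R * f * 4 ^+ n) + 4 * b * (a ^+ k * (4 ^+ n' * f * s) * k.+1%:R) =
   (a ^+ k * 4 ^+ n * f) * (n%:R * a + k.+1%:R * (b * s)).
  by rewrite !exprS; ring.
apply: mulr_ge0; first by rewrite !mulr_ge0 ?exprn_ge0.
have m0 : 0 < m%:R :> R by rewrite ltr0n (leq_trans _ km).
rewrite -(pmulr_rge0 _ m0).
(* The bracket is affine in the number of copies and nonnegative at 0 and at [m], hence in
   between. *)
have -> : m%:R * (n%:R * a + k.+1%:R * (b * s)) =
  (m%:R - k.+1%:R) * (n%:R * a) + k.+1%:R * (n%:R * a + m%:R * (b * s)) by ring.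
by rewrite addr_ge0 ?mulr_ge0 ?subr_ge0 ?ler_nat.
Qed.

Lemma dder_val (v : Cn) f z d :
  is_derive (0 : R) (1 : R) (fun t : R => f (z + real_scale t v)) d -> dder v f z = d.
Proof. by move=> h; rewrite /dder derive1E derive_val. Qed.

Lemma is_derive_quadratic (a b c : R) :
  is_derive (0 : R) (1 : R) (fun t : R => a + t * b + t ^+ 2 * c) b.
Proof.
pose p : {poly R} := a%:P + b *: 'X + c *: 'X^2.
have -> : (fun t : R => a + t * b + t ^+ 2 * c) = (fun t => p.[t]).
  by apply/funext => t; rewrite /p !(hornerD, hornerC, hornerZ, hornerXn, hornerX); ring.
have -> : b = p^`().[0].
  by rewrite /p !(derivD, derivZ, derivC, derivX, derivXn) !(hornerD, hornerC, hornerZ, hornerMn, hornerXn, hornerX); ring.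
exact: is_derive_poly.
Qed.

Lemma sqnorm_real_scale (z v : Cn) t :
  sqnorm (z + real_scale t v) = sqnorm z + t * (2 * dotp z v) + t ^+ 2 * sqnorm v.
Proof. by rewrite !sqnormE dotpDl !dotpDr !dotpZl !dotpZr (dotpC v z); ring. Qed.

Lemma is_derive_radial (G : R -> R) dG eps (z v : Cn) :
  is_derive (sqnorm z + eps) (1 : R) G dG ->
  is_derive (0 : R) (1 : R) (fun t : R => G (sqnorm (z + real_scale t v) + eps))
    (dG * (2 * dotp z v)).
Proof.
move=> hG.
have -> : (fun t : R => G (sqnorm (z + real_scale t v) + eps)) =
  G \o (fun t => (sqnorm z + eps) + t * (2 * dotp z v) + t ^+ 2 * sqnorm v).
  by apply/funext => t /=; rewrite sqnorm_real_scale; congr G; ring.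
have q := is_derive_quadratic (sqnorm z + eps) (2 * dotp z v) (sqnorm v).
apply: is_derive1_comp.
by rewrite mul0r expr0n mul0r !addr0.
Qed.

Lemma betaE : @beta R n = hess_form 1 0 0.
Proof.
have dsq v z : dder v (@sqnorm R n) z = 2 * dotp z v.
  apply: dder_val; rewrite -[2 * _]mul1r.
  have -> : (fun t : R => sqnorm (z + real_scale t v)) =
    (fun t : R => id (sqnorm (z + real_scale t v) + 0)).
    by apply/funext => t; rewrite addr0.
  exact: (@is_derive_radial id).
have ddsq v w : dder v (fun y => dc (@sqnorm R n) y w) 0 = 2 * dotp (mulI v) w.
  rewrite dotp_mulIl mulrN -mulNr; apply: dder_val.
  have -> : (fun t : R => dc (@sqnorm R n) (0 + real_scale t v) w) =
      (fun t => 0 + t * (- 2 * dotp v (mulI w)) + t ^+ 2 * 0).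
    by apply/funext => t; rewrite /dc dsq add0r dotpZl; ring.
  exact: is_derive_quadratic.
apply/funext => v; apply/funext => w; rewrite /beta /ddc !ddsq /hess_form.
by rewrite (dotp_mulIl w) (dotpC w); ring.
Qed.

Lemma form_mx_beta : form_mx (@beta R n) = 4%:M.
Proof. by rewrite betaE form_mx_hess mulr0 scale1r scale0r addr0. Qed.

Lemma m_positive_mpos m (alpha : form2 R n) : (m <= n)%N ->
  m_positive m alpha -> mpos m (form_mx alpha).
Proof.
move=> mn [a11 apos]; split; first exact: form_mx_hermitian.
move=> k km; have kn : (k <= n)%N by case/andP: km => _ /leq_trans; apply.
rewrite -form_mx_beta -!map_nseq -map_cat -wedge_top_mixdisc ?ler0c ?apos//.
  by rewrite size_cat !size_nseq subnKC.
move=> j jn; rewrite nth_cat size_nseq; case: ltnP => jk; rewrite nth_nseq.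
  by rewrite jk.
by rewrite ltn_subRL subnKC// jn betaE; exact: hess_form11.
Qed.

Theorem wedge_hess_ge0 m (a b : R) (z : Cn) (alpha : 'I_m.-1 -> form2 R n) :
  (1 <= m <= n)%N -> 0 <= a -> 0 <= n%:R * a + m%:R * (b * sqnorm z) ->
  (forall j, m_positive m (alpha j)) ->
  0 <= wedge_top (hess_form a b z :: [seq alpha j | j <- enum 'I_m.-1] ++
                  nseq (n - m) (@beta R n)).
Proof.
move=> /andP[m1 mn] a0 ab0 apos.
have sE : size (hess_form a b z :: [seq alpha j | j <- enum 'I_m.-1]) = m.
  by rewrite /= size_map -cardE card_ord prednK.
rewrite -cat_cons -ler0c wedge_top_mixdisc; first last.
- move=> j jn; rewrite nth_cat sE; case: ltnP => jm.
    case: j jm jn => [|j] jm jn /=; first exact: hess_form11.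
    have jm' : (j < m.-1)%N by rewrite -ltnS prednK.
    rewrite (nth_map (Ordinal jm')) ?size_enum_ord//.
    by have [] := apos (nth (Ordinal jm') (enum 'I_m.-1) j).
  rewrite nth_nseq ifT; first by rewrite betaE; exact: hess_form11.
  by rewrite ltn_subRL subnKC.
- by rewrite size_cat sE size_nseq subnKC.
rewrite map_cat map_nseq form_mx_beta; apply: garding_mpos => //.
  by rewrite size_map.
move=> X /=; rewrite inE => /orP[/eqP ->|]; first exact: mpos_hess.
by move=> /mapP[w /mapP[j _ ->] ->]; apply: m_positive_mpos.
Qed.

End FormMatrices.

(** * Lebesgue measure on C^n and integration by parts *)

Section TupleLebesgue.
Variable R : realType.
Local Notation mu := (@lebesgue_measure R).
Local Notation tup N := (N.-tuple (measurableTypeR R)).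
Local Notation tmu N := (tuple_measure (@lebesgue_measure R) N).

Lemma measurable_shift (c : R) :
  measurable_fun setT ((fun x => x + c) : measurableTypeR R -> measurableTypeR R).
Proof. by apply: measurable_funD => //; exact: measurable_cst. Qed.

Lemma lebesgue_measure_shift (c : R) (A : set (measurableTypeR R)) : measurable A ->
  mu ((fun x => x + c) @^-1` A) = mu A.
Proof.
pose phi : measurableTypeR R -> measurableTypeR R := fun x => x + c.
have mphi := measurable_shift c.
pose mphi_pack : {mfun measurableTypeR R >-> measurableTypeR R} :=
  HB.pack phi (isMeasurableFun.Build _ _ _ _ _ mphi).
move=> mA; apply/esym.
apply: (@lebesgue_measure_unique _ (pushforward mu mphi_pack)) => //= _ [[a b]] _ <-.
rewrite /pushforward.
have -> : mphi_pack @^-1` `]a, b] = `](a - c), (b - c)]%classic.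
  by apply/seteqP; split => x /=; rewrite /phi !in_itv /= ltrBlDr lerBrDr.
by rewrite !lebesgue_measure_itv /= !lte_fin ltrD2r -!EFinD opprB addrA subrK.
Qed.

Definition tuple_shift N (c t : tup N) : tup N :=
  [tuple tnth t i + tnth c i | i < N].

Lemma measurable_tuple_shift N c : measurable_fun setT (@tuple_shift N c).
Proof.
apply/measurable_fun_tnthP => i.
rewrite (_ : _ \o _ = (fun x => x + tnth c i) \o (@tnth N _ ^~ i)); last first.
  by apply/funext => t /=; rewrite tnth_mktuple.
by apply: measurableT_comp (measurable_shift _) (measurable_tnth _).
Qed.

Lemma tuple_shift_cons N (c : tup N.+1) x t :
  tuple_shift c (Defs.cons_tuple (x, t)) =
  Defs.cons_tuple (x + thead c, tuple_shift [tuple of behead c] t).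
Proof.
apply: eq_from_tnth => i; rewrite tnth_mktuple.
have [->|] := eqVneq i ord0; first by [].
rewrite eq_sym => /unlift_some[j -> _].
by rewrite /Defs.cons_tuple /= !tnthS tnth_mktuple tnth_behead; congr (_ + tnth _ _); apply/val_inj; rewrite /= inordK // ltnS.
Qed.

Lemma measurable_cons_preimage N (A : set (tup N.+1)) : measurable A ->
  measurable (@Defs.cons_tuple _ _ N @^-1` A).
Proof.
by move=> mA; rewrite -[X in measurable X]setTI; exact: measurable_cons_tuple.
Qed.

Lemma tuple_measureS N (A : set (tup N.+1)) :
  tmu N.+1 A = (\int[mu]_x tmu N (xsection (@Defs.cons_tuple _ _ N @^-1` A) x))%E.
Proof. by []. Qed.

Lemma tuple_measure_shift N c (A : set (tup N)) : measurable A ->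
  tmu N (tuple_shift c @^-1` A) = tmu N A.
Proof.
elim: N c A => [|N IH] c A mA.
  congr (tmu 0 _); apply/seteqP; split => t /=; by rewrite (tuple0 (tuple_shift c t)) (tuple0 t).
rewrite !tuple_measureS; have mB := measurable_cons_preimage mA.
set B := @Defs.cons_tuple _ _ N @^-1` A in mB *.
have -> : (fun x => tmu N (xsection (@Defs.cons_tuple _ _ N @^-1` (tuple_shift c @^-1` A)) x)) =
    (fun x => tmu N (xsection B x)) \o (fun x : measurableTypeR R => x + thead c).
  apply/funext => x /=; rewrite -[RHS](IH [tuple of behead c]); last exact: measurable_xsection.
  congr (tmu N _); apply/seteqP; split => t; rewrite /xsection /= !inE /B /preimage /=.
    by rewrite tuple_shift_cons.
  by rewrite tuple_shift_cons.
have mg : measurable_fun setT (fun x => tmu N (xsection B x)).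
  exact: measurable_fun_xsection.
have := @ge0_integral_pushforward _ _ _ _ _ _ (measurable_shift (thead c)) mu setT _ measurableT mg _.
rewrite preimage_setT => <-//.
apply: eq_measure_integral => [|mphi E mE _]; first exact: measurable_shift.
exact: (lebesgue_measure_shift (thead c) mE).
Qed.

(** Cubes stand in for balls in measure estimates, their measure being explicit. *)
Definition cube N (c : R) : set (tup N) := [set t | forall i, `|tnth t i| <= c].

Lemma measurable_tuple_forall N (P : 'I_N -> set (measurableTypeR R)) :
  (forall i, measurable (P i)) -> measurable [set t : tup N | forall i, P i (tnth t i)].
Proof.
move=> mP; rewrite (_ : [set t | _] = \bigcap_i ((@tnth N _ ^~ i) @^-1` P i)).
  apply: fin_bigcap_measurable => // i _.
  by rewrite -[X in measurable X]setTI; apply: measurable_tnth.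
by apply/seteqP; split => t /= h i; [move=> _; exact: h|exact: (h i I)].
Qed.

Lemma cubeE N (c : R) :
  @cube N c = [set t | forall i, `[(- c), c]%classic (tnth t i)].
Proof. by apply/seteqP; split => t h i; have := h i; rewrite /= in_itv /= ler_norml. Qed.

Lemma measurable_cube N c : measurable (@cube N c).
Proof.
rewrite cubeE; apply: (@measurable_tuple_forall _ (fun=> `[(- c), c]%classic)) => i.
exact: measurable_itv.
Qed.

Lemma tuple_measure_cube N (c : R) : 0 <= c -> tmu N (@cube N c) = ((2 * c) ^+ N)%:E.
Proof.
move=> c0; elim: N => [|N IH].
  by rewrite expr0 /= diracE mem_set// => i; case: i.
have -> : tmu N.+1 (@cube N.+1 c) = (mu \x tmu N)%E (`[(- c), c]%classic `*` @cube N c).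
  congr ((mu \x tmu N)%E _); apply/seteqP; split => -[x t] /=.
    move=> h; split; first by have := h ord0; rewrite in_itv /= ler_norml.
    by move=> i; have := h (lift ord0 i); rewrite /Defs.cons_tuple /= tnthS.
  move=> [xc tc] i; have [->|] := eqVneq i ord0; first by move: xc; rewrite in_itv /= -ler_norml.
  by rewrite eq_sym => /unlift_some[j -> _]; rewrite /Defs.cons_tuple /= tnthS; exact: tc.
rewrite product_measure1E//; last exact: measurable_cube.
rewrite IH exprS EFinM; congr (_ * _)%E.
transitivity (mu `[(- c), c]%classic) => //; rewrite lebesgue_measure_itv /= lte_fin.
case: ltP => cc; first by rewrite -EFinD opprK -mulr2n mulr_natl.
have -> : c = 0 by lra.
by rewrite mulr0.
Qed.

End TupleLebesgue.

(** * The topology of C^n through the Euclidean norm *)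

Section EuclideanTopology.
Variables (R : realType) (n' : nat).
Local Notation n := n'.+1.
Local Notation K := (C R).
Local Notation Cn := (Cn R n).
Local Notation Re := (@complex.Re R).
Local Notation Im := (@complex.Im R).
Implicit Types (z w v : Cn) (U : set Cn) (f g : Cn -> R).

Lemma dotp_ge0 z : 0 <= dotp z z.
Proof. by apply: sumr_ge0 => j _; rewrite -!expr2 addr_ge0 ?sqr_ge0. Qed.

Lemma sqnorm_ge0 z : 0 <= sqnorm z.
Proof. by rewrite sqnormE dotp_ge0. Qed.

Lemma dotpNl v w : dotp (- v) w = - dotp v w.
Proof.
rewrite -[RHS]mulN1r -dotpZl; congr dotp.
by rewrite /real_scale rmorphN rmorph1 scaleN1r.
Qed.

Lemma dotpBl u v w : dotp (u - v) w = dotp u w - dotp v w.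
Proof. by rewrite dotpDl dotpNl. Qed.

Lemma sqnormN z : sqnorm (- z) = sqnorm z.
Proof. by rewrite !sqnormE dotpNl dotpC dotpNl opprK. Qed.

Lemma sqnormB v w : sqnorm (v - w) = sqnorm (w - v).
Proof. by rewrite -sqnormN opprB. Qed.

Lemma sqnormD v w : sqnorm (v + w) = sqnorm v + 2 * dotp v w + sqnorm w.
Proof. by rewrite !sqnormE dotpDl !dotpDr (dotpC w v); ring. Qed.

Lemma sqnormZ t z : sqnorm (real_scale t z) = t ^+ 2 * sqnorm z.
Proof. by rewrite !sqnormE dotpZl dotpZr; ring. Qed.

Lemma dotp_cauchy v w : dotp v w ^+ 2 <= sqnorm v * sqnorm w.
Proof.
have h t : 0 <= sqnorm v + 2 * t * dotp v w + t ^+ 2 * sqnorm w.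
  have := sqnorm_ge0 (v + real_scale t w).
  by rewrite sqnormD sqnormZ dotpZr; congr (_ <= _); ring.
have [w0|w0] := eqVneq (sqnorm w) 0.
  have [->|d0] := eqVneq (dotp v w) 0; first by rewrite expr0n mulr_ge0 ?sqnorm_ge0.
  have := h (- (sqnorm v + 1) / dotp v w / 2); rewrite w0 mulr0 addr0.
  have -> : 2 * (- (sqnorm v + 1) / dotp v w / 2) * dotp v w = - (sqnorm v + 1) by field.
  lra.
have wp : 0 < sqnorm w by rewrite lt_neqAle eq_sym w0 sqnorm_ge0.
have := h (- dotp v w / sqnorm w); rewrite -(pmulr_rge0 _ wp).
have -> : sqnorm w * (sqnorm v + 2 * (- dotp v w / sqnorm w) * dotp v w +
    (- dotp v w / sqnorm w) ^+ 2 * sqnorm w) = sqnorm v * sqnorm w - dotp v w ^+ 2 by field.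
by rewrite subr_ge0.
Qed.

Lemma sqnormD_le v w : sqnorm (v + w) <= 2 * sqnorm v + 2 * sqnorm w.
Proof.
have := sqnorm_ge0 (v - w); rewrite !sqnormD sqnormN (dotpC v (- w)) dotpNl (dotpC w).
lra.
Qed.

Lemma Re_sqr_le_sqnorm z j : Re (z ord0 j) ^+ 2 + Im (z ord0 j) ^+ 2 <= sqnorm z.
Proof.
rewrite sqnormE /dotp (bigD1 j)//= -!expr2 lerDl.
by apply: sumr_ge0 => k _; rewrite -!expr2 addr_ge0 ?sqr_ge0.
Qed.

Lemma sqnorm_eq0 z : sqnorm z = 0 -> z = 0.
Proof.
move=> z0; apply/rowP => j; rewrite mxE; have := Re_sqr_le_sqnorm z j; rewrite z0.
case: (z ord0 j) => a b /= h.
have a2 := sqr_ge0 a; have b2 := sqr_ge0 b.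
have /eqP : a ^+ 2 = 0 by lra.
have /eqP : b ^+ 2 = 0 by lra.
by rewrite !sqrf_eq0 => /eqP -> /eqP ->.
Qed.

Lemma sqnorm0 : sqnorm (0 : Cn) = 0.
Proof. by rewrite sqnormE /dotp big1// => j _; rewrite mxE /= !mulr0 addr0. Qed.

Lemma normC_lt (x : K) (e : R) : 0 < e -> (`|x| < e%:C%C) = (Re x ^+ 2 + Im x ^+ 2 < e ^+ 2).
Proof.
move=> e0; rewrite normc_def ltcR -[X in _ < X](ger0_norm (ltW e0)) -sqrtr_sqr.
by rewrite ltr_sqrt// exprn_gt0.
Qed.

(** The topology of [Cn] comes from entrywise balls whose radii are positive elements of [C R],
    hence real. *)
Lemma nbhs_CnP z U :
  nbhs z U <-> exists2 e : R, 0 < e & forall w, sqnorm (w - z) < e -> U w.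
Proof.
split=> [/nbhs_ballP[e /= e0 eU]|[e e0 eU]].
  have eE : e = (Re e)%:C%C by apply: complex_real_eq; move: e0; rewrite ltcE => /andP[/eqP].
  have re0 : 0 < Re e by move: e0; rewrite eE ltcR.
  exists (Re e ^+ 2) => [|w wz]; first by rewrite exprn_gt0.
  apply: eU; split => // i j; rewrite /ball /= eE normC_lt// ord1.
  apply: le_lt_trans wz; rewrite sqnormB.
  by have := Re_sqr_le_sqnorm (z - w) j; rewrite !mxE.
(* From [d <= 1] follows [d * d <= d], and [n] such terms stay below [e] because [n < n.+1]. *)
apply/nbhs_ballP; pose d := Num.min 1 (e / (n.+1)%:R).
have D0 : 0 < e / n.+1%:R by rewrite divr_gt0.
have d0 : 0 < d by rewrite lt_min ltr01.
exists d%:C%C => /=; first by rewrite ltcR.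
move=> w wz; apply: eU; rewrite sqnormB sqnormE.
apply: (@le_lt_trans _ _ (\sum_(j < n) d)).
  apply: ler_sum => j _; rewrite -!expr2.
  have := wz.2 ord0 j; rewrite /ball /= normC_lt// !mxE => /ltW/le_trans; apply.
  by rewrite expr2 ler_piMr//; [exact: ltW|rewrite ge_min lexx].
rewrite sumr_const card_ord -mulr_natr.
have de : d <= e / n.+1%:R by rewrite ge_min lexx orbT.
apply: (@le_lt_trans _ _ (e / n.+1%:R * n%:R)); first by rewrite ler_wpM2r.
rewrite mulrAC ltr_pdivrMr ?ltr0n// ltr_pM2l// ltr_nat//.
Qed.

Lemma continuous_CnP f z : {for z, continuous f} <-> forall e : R, 0 < e ->
  exists2 d : R, 0 < d & forall w, sqnorm (w - z) < d -> `|f z - f w| < e.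
Proof.
split=> [/cvgrPdist_lt cf e /cf /nbhs_CnP//|h].
apply: (iffRL (@cvgrPdist_lt _ _ _ (nbhs z) (nbhs_filter z) f (f z))) => e /h [d d0 hd].
by apply/nbhs_CnP; exists d.
Qed.

Lemma continuous_dotp v : continuous (fun w : Cn => dotp w v).
Proof.
move=> z; apply/continuous_CnP => e e0.
have v1 : 0 < sqnorm v + 1 by rewrite ltr_wpDl ?sqnorm_ge0.
exists (e ^+ 2 / (sqnorm v + 1)); first by rewrite divr_gt0// exprn_gt0.
move=> w; rewrite ltr_pdivlMr// => wz; rewrite -dotpBl.
rewrite -[X in _ < X](ger0_norm (ltW e0)) -ltr_sqr ?nnegrE// !real_normK ?num_real//.
apply: (le_lt_trans (dotp_cauchy _ _)); rewrite sqnormB; apply: le_lt_trans wz.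
by rewrite ler_wpM2l ?sqnorm_ge0// lerDl.
Qed.

Lemma continuous_sqnorm : continuous (@sqnorm R n).
Proof.
move=> z; apply/continuous_CnP => e e0.
have [d d0 hd] := (continuous_CnP _ _).1 (@continuous_dotp z z) (e / 4) (divr_gt0 e0 (ltr0n _ 4)).
exists (Num.min d (e / 4)); first by rewrite lt_min d0 divr_gt0.
move=> w; rewrite lt_min => /andP[/hd h1 h2].
have -> : sqnorm z - sqnorm w = 2 * (dotp z z - dotp w z) - sqnorm (w - z).
  by rewrite sqnormD sqnormN (dotpC w (- z)) dotpNl (dotpC z w) -sqnormE; ring.
apply: (le_lt_trans (ler_normB _ _)); rewrite normrM (ger0_norm (sqnorm_ge0 _)) ger0_norm//.
lra.
Qed.

Lemma open_sqnorm_lt z (c : R) : open [set w | sqnorm (w - z) < c].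
Proof.
rewrite openE => w /= wz; apply/nbhs_CnP.
have [d d0 hd] := (continuous_CnP _ _).1 (@continuous_sqnorm (w - z)) (c - sqnorm (w - z)) (eq_ind_r is_true wz (subr_gt0 _ _)).
exists d => // w' ww' /=; have := hd (w' - z).
rewrite opprB addrA subrK => /(_ ww') /ltr_normlP[]; lra.
Qed.

Lemma closed_sqnorm_le z (c : R) : closed [set w | sqnorm (w - z) <= c].
Proof.
rewrite -openC [X in open X](_ : _ = [set w | c < sqnorm (w - z)]); last first.
  by apply/seteqP; split => w /=; rewrite ltNge => /negP.
rewrite openE => w /= wz; apply/nbhs_CnP.
have e0 : 0 < sqnorm (w - z) - c by rewrite subr_gt0.
have [d d0 hd] := (continuous_CnP _ _).1 (@continuous_sqnorm (w - z)) _ e0.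
exists d => // w' ww' /=; have := hd (w' - z).
rewrite opprB addrA subrK => /(_ ww') /ltr_normlP[]; lra.
Qed.

Lemma compact_disc (c : R) : compact [set x : K | `|Re x| <= c /\ `|Im x| <= c].
Proof.
have -> : [set x : K | `|Re x| <= c /\ `|Im x| <= c] =
    (fun p : R * R => (p.1 +i* p.2)%C : K) @` (`[- c, c] `*` `[- c, c]).
  apply/seteqP; split => [[a b]|x] /=.
    by rewrite !ler_norml => -[? ?]; exists (a, b) => //=; rewrite !in_itv.
  by move=> [[a b]] /=; rewrite !in_itv /= -!ler_norml => ? <-.
apply: continuous_compact; last by apply: compact_setX; exact: segment_compact.
apply: continuous_subspaceT => -[a b]; apply/cvgrPdist_lt => e e0.
have eE : e = (Re e)%:C%C by apply: complex_real_eq; move: e0; rewrite ltcE => /andP[/eqP].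
have re0 : 0 < Re e / 2 by move: e0; rewrite eE ltcR => h; rewrite divr_gt0.
have na : nbhs a [set x | `|a - x| < Re e / 2] := nbhsx_ballx a _ re0.
have nb : nbhs b [set x | `|b - x| < Re e / 2] := nbhsx_ballx b _ re0.
exists (([set x | `|a - x| < Re e / 2], [set y | `|b - y| < Re e / 2])) => //=.
move=> [x y] /= [ax bY]; rewrite eE normC_lt /=; last lra.
have h1 : (a - x) ^+ 2 < (Re e / 2) ^+ 2.
  by rewrite -(real_normK (num_real (a - x))) ltr_pXn2r ?nnegrE// ltW.
have h2 : (b - y) ^+ 2 < (Re e / 2) ^+ 2.
  by rewrite -(real_normK (num_real (b - y))) ltr_pXn2r ?nnegrE// ltW.
have : (Re e) ^+ 2 = 4 * (Re e / 2) ^+ 2 by field.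
have := sqr_ge0 (Re e / 2); lra.
Qed.

Lemma compact_box (c : R) :
  compact [set z : Cn | forall j, `|Re (z ord0 j)| <= c /\ `|Im (z ord0 j)| <= c].
Proof.
exact: (@rV_compact K n (fun=> [set x | `|Re x| <= c /\ `|Im x| <= c]) (fun=> @compact_disc c)).
Qed.

Lemma abs_coord_le (x y c : R) : 0 <= c -> x ^+ 2 + y ^+ 2 <= c -> `|x| <= c + 1.
Proof.
move=> c0 h; rewrite -(ger0_norm (_ : 0 <= c + 1)); last by lra.
by rewrite -ler_sqr ?nnegrE// !real_normK ?num_real//; have := sqr_ge0 y; have := sqr_ge0 c; rewrite sqrrD1; lra.
Qed.

Lemma compact_sqnorm_le z (c : R) : compact [set w : Cn | sqnorm (w - z) <= c].
Proof.
pose c' := 2 * Num.max c 0 + 2 * sqnorm z.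
apply: (@subclosed_compact _ _ [set w : Cn | forall j,
    `|Re (w ord0 j)| <= c' + 1 /\ `|Im (w ord0 j)| <= c' + 1]).
- exact: closed_sqnorm_le.
- exact: compact_box.
move=> w /= wz j; have m0 : 0 <= Num.max c 0 by rewrite le_max lexx orbT.
have c'0 : 0 <= c' by rewrite addr_ge0 ?mulr_ge0 ?sqnorm_ge0.
have h : Re (w ord0 j) ^+ 2 + Im (w ord0 j) ^+ 2 <= c'.
  apply: (le_trans (Re_sqr_le_sqnorm w j)); rewrite -{1}(subrK z w).
  apply: (le_trans (sqnormD_le _ _)); rewrite lerD2r ler_pM2l//.
  by rewrite le_max wz.
by split; [apply: abs_coord_le h|move: h; rewrite addrC => h; apply: abs_coord_le h].
Qed.

Lemma compact_sqnorm_bounded (A : set Cn) : compact A ->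
  exists2 c, 0 <= c & forall z, A z -> sqnorm z <= c.
Proof.
move=> cA; have : compact ((@sqnorm R n) @` A).
  by apply: continuous_compact => //; apply: continuous_subspaceT; exact: continuous_sqnorm.
move=> /compact_bounded [M [_ hM]]; exists (Num.max 0 (M + 1)); first by rewrite le_max lexx.
move=> z Az; rewrite le_max; apply/orP; right.
have /= := hM (M + 1); rewrite ltrDl ltr01 => /(_ isT _ (ex_intro2 _ _ z Az erefl)).
exact: le_trans (ler_norm _).
Qed.

Lemma Cn_hausdorff : hausdorff_space Cn.
Proof. exact: (@norm_hausdorff K Cn). Qed.

End EuclideanTopology.

Section LebesgueCn.
Variables (R : realType) (n' : nat).
Local Notation n := n'.+1.
Local Notation Cn := (Cn R n).
Local Notation Re := (@complex.Re R).
Local Notation Im := (@complex.Im R).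
Local Notation orc := (@of_real_coords R n).
Local Notation lam := (@lebesgue_Cn R n).
Local Notation tup := ((n + n).-tuple (measurableTypeR R)).
Implicit Types (z w v : Cn) (U : set Cn) (f g : Cn -> R) (t s : tup).

Lemma sqnorm_orcB s t : sqnorm (orc s - orc t) =
  \sum_(j < n) ((tnth s (lshift n j) - tnth t (lshift n j)) ^+ 2 +
                (tnth s (rshift n j) - tnth t (rshift n j)) ^+ 2).
Proof.
by rewrite sqnormE; apply: eq_bigr => j _; rewrite !mxE /= !expr2.
Qed.

(** Tuples carry the product sigma-algebra, so an open set is written as a countable union of boxes
    with rational centres. *)
Lemma measurable_orc_open U : open U -> measurable (orc @^-1` U).
Proof.
move=> oU.
pose box (q : (n + n).-tuple rat * nat) : set tup :=
  [set t | forall i, (ball (ratr (tnth q.1 i) : R) q.2.+1%:R^-1) (tnth t i)].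
pose F q := if `[< box q `<=` orc @^-1` U >] then box q else set0.
have -> : orc @^-1` U = \bigcup_q F q.
  apply/seteqP; split => [t /= Ut|t [q _]]; last first.
    by rewrite /F; case: asboolP => // h /h.
  move: oU; rewrite openE => /(_ _ Ut) /nbhs_CnP[e e0 eU].
  (* With [a = 1 / (k + 1)], points of one box differ by at most [2 a <= 1] in each coordinate, so
     that the [2 n] squares sum to at most [4 n a < e]. *)
  have [k hk] : exists k, 0 + k.+1%:R^-1 < Num.min (1 / 2) (e / (8 * n%:R)) :> R.
    by apply: ltr_add_invr; rewrite lt_min !divr_gt0// mulr_gt0// ltr0n.
  move: hk; rewrite add0r lt_min => /andP[k1 k2].
  pose a : R := k.+1%:R^-1; have a0 : 0 < a by rewrite invr_gt0 ltr0n.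
  have hq i : exists q : rat, `|ratr q - tnth t i| < a.
    have [q] := @rat_in_itvoo R (tnth t i - a) (tnth t i + a) (ltac:(lra)).
    by rewrite in_itv /= => /andP[h1 h2]; exists q; rewrite ltr_norml; apply/andP; split; lra.
  pose q := [tuple xchoose (hq i) | i < n + n].
  have qP i : `|ratr (tnth q i) - tnth t i| < a.
    by rewrite tnth_mktuple; exact: (xchooseP (hq i)).
  exists (q, k) => //; rewrite /F; case: asboolP => [_|[]].
    by move=> i; rewrite /ball /=; exact: qP.
  move=> s sb; apply: eU; rewrite sqnorm_orcB.
  have d i : (tnth s i - tnth t i) ^+ 2 <= 2 * a.
    have h1 := qP i; have h2 : `|ratr (tnth q i) - tnth s i| < a := sb i.
    have h3 : `|tnth s i - tnth t i| <= 2 * a.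
      have -> : tnth s i - tnth t i = (ratr (tnth q i) - tnth t i) - (ratr (tnth q i) - tnth s i) by ring.
      apply: (le_trans (ler_normB _ _)); move: h1 h2 => /ltW h1 /ltW h2; rewrite (le_trans (lerD h1 h2))//; lra.
    rewrite -real_normK ?num_real// expr2; apply: (@le_trans _ _ (2 * a * 1)); last by rewrite mulr1.
    apply: ler_pM => //; apply: (le_trans h3); move: k1; rewrite -/a; lra.
  apply: (@le_lt_trans _ _ (\sum_(j < n) (4 * a))).
    by apply: ler_sum => j _; have := d (lshift n j); have := d (rshift n j); lra.
  rewrite sumr_const card_ord -mulr_natr.
  move: k2; rewrite -/a ltr_pdivlMr; last by rewrite mulr_gt0// ltr0n.
  have : 0 < a * n%:R by rewrite mulr_gt0// ltr0n.
  lra.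
apply: countable_bigcupT_measurable; first exact: countableP.
move=> q; rewrite /F; case: asboolP => // _.
have h := @measurable_tuple_forall R (n + n) (fun i => ball (ratr (tnth q.1 i) : R) q.2.+1%:R^-1).
by apply: h => i; exact: measurable_ball.
Qed.

Lemma measurable_orc_closed U : closed U -> measurable (orc @^-1` U).
Proof.
move=> cU; rewrite -[U]setCK preimage_setC; apply: measurableC.
by have := @measurable_orc_open (~` U); apply; rewrite openC.
Qed.

Lemma measurable_orc_compact U : compact U -> measurable (orc @^-1` U).
Proof. by move=> /(compact_closed (@Cn_hausdorff R n')) /measurable_orc_closed. Qed.

Lemma measurable_orc_continuous f : continuous f -> measurable_fun setT (f \o orc).
Proof.
move=> cf; apply: (measurability _ (RGenOInfty.measurableE R)) => _ [_ [a ->] <-].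
rewrite setTI comp_preimage; apply: measurable_orc_open.
apply: open_comp; last exact: interval_open.
by move=> x _; exact: cf.
Qed.

Definition coords v : tup :=
  [tuple match fintype.split i with inl j => Re (v ord0 j) | inr j => Im (v ord0 j) end | i < n + n].

Lemma orc_shift v t : orc (tuple_shift (coords v) t) = orc t + v.
Proof.
apply/rowP => j; rewrite !mxE !tnth_mktuple.
rewrite -[lshift n j]/(unsplit (inl j)) -[rshift n j]/(unsplit (inr j)) !unsplitK.
by case: (v ord0 j).
Qed.

Lemma Rintegral_translate g v : measurable_fun setT (g \o orc) ->
  lam.-integrable setT (EFin \o (fun t => g (orc t + v))) ->
  (\int[lam]_t g (orc t + v) = \int[lam]_t g (orc t))%R.
Proof.
move=> mg ig; rewrite /Rintegral; congr fine.
have ms := @measurable_tuple_shift R (n + n) (coords v).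
have mg' : measurable_fun setT (EFin \o (g \o orc)) by exact/measurable_EFinP.
have gE : (EFin \o (g \o orc)) \o tuple_shift (coords v) = EFin \o (fun t => g (orc t + v)).
  by apply/funext => t /=; rewrite orc_shift.
have := @integral_pushforward _ _ _ _ _ _ ms lam setT (EFin \o (g \o orc)) mg'.
rewrite preimage_setT gE => /(_ ig measurableT) /= <-.
by apply: eq_measure_integral => E mE _; exact: (tuple_measure_shift (coords v) mE).
Qed.

Lemma sqnorm_cube c t : 0 <= c -> sqnorm (orc t) <= c -> cube (c + 1) t.
Proof.
move=> c0 tc i; rewrite -(splitK i).
case: (fintype.split i) => j /=; have := le_trans (Re_sqr_le_sqnorm (orc t) j) tc; rewrite !mxE /=.
  exact: abs_coord_le.
by rewrite addrC; exact: abs_coord_le.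
Qed.

Lemma integrable_cube (c M : R) : 0 <= c ->
  lam.-integrable setT (EFin \o (fun t => M * \1_(@cube R (n + n) c) t)).
Proof.
move=> c0; rewrite (_ : EFin \o _ = (fun t => M%:E * (\1_(@cube R (n + n) c) t)%:E)%E)//.
apply: integrableZl => //; apply/integrableP; split.
  by apply/measurable_EFinP; apply: measurable_indic; exact: measurable_cube.
under eq_integral do rewrite /= ger0_norm//.
rewrite integral_indic ?setIT//; last exact: measurable_cube.
by rewrite [X in (X < _)%E]tuple_measure_cube// ltry.
Qed.

Lemma integrable_bounded g A M : measurable_fun setT (g \o orc) -> compact A ->
  (forall z, `|g z| <= M) -> (forall z, ~ A z -> g z = 0) ->
  lam.-integrable setT (EFin \o (fun t => g (orc t))).
Proof.
move=> mg cA gM gA; have [c c0 Ac] := compact_sqnorm_bounded cA.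
apply: (le_integrable _ _ _ (integrable_cube M (addr_ge0 c0 ler01))) => //.
  exact/measurable_EFinP.
move=> t _; rewrite /= lee_fin.
have [At|At] := pselect (A (orc t)); last by rewrite gA// normr0.
rewrite indicE mem_set; first by rewrite mulr1 (le_trans (gM _))// ler_norm.
exact/sqnorm_cube/Ac.
Qed.

(** Integrability is carried along because additivity of the integral needs it. *)
Definition same_integral (p q : tup -> R) :=
  [/\ lam.-integrable setT (EFin \o p), lam.-integrable setT (EFin \o q) &
      (\int[lam]_x p x = \int[lam]_x q x)%R].

Lemma same_integralD p1 q1 p2 q2 : same_integral p1 q1 -> same_integral p2 q2 ->
  same_integral (p1 \+ p2) (q1 \+ q2).
Proof.
move=> [a1 b1 e1] [a2 b2 e2]; split.
- by have := integrableD measurableT a1 a2.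
- by have := integrableD measurableT b1 b2.
- by rewrite !RintegralD// e1 e2.
Qed.

Lemma same_integralZ (c : R) p q : same_integral p q ->
  same_integral (fun x => c * p x) (fun x => c * q x).
Proof.
move=> [a b e]; split.
- by have := integrableZl measurableT c a.
- by have := integrableZl measurableT c b.
- by rewrite !RintegralZl// e.
Qed.

Lemma same_integral_sum (I : Type) (r : seq I) (p q : I -> tup -> R) :
  (forall i, same_integral (p i) (q i)) ->
  same_integral (fun x => \sum_(i <- r) p i x) (fun x => \sum_(i <- r) q i x).
Proof.
move=> pq; elim: r => [|i r IH].
  have z0 : same_integral (fun=> 0) (fun=> 0) by split=> //; exact: integrable0.
  by congr same_integral : z0; apply/funext => x; rewrite big_nil.
have := same_integralD (pq i) IH.
by congr same_integral; apply/funext => x; rewrite /= big_cons.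
Qed.

End LebesgueCn.

(** * Integration by parts on C^n *)

Section IntegrationByParts.
Variables (R : realType) (n' : nat).
Local Notation n := n'.+1.
Local Notation Cn := (Cn R n).
Local Notation orc := (@of_real_coords R n).
Local Notation lam := (@lebesgue_Cn R n).
Implicit Types (z w v : Cn) (A U : set Cn) (f g h : Cn -> R).

Definition deriv_along v f f' z :=
  is_derive (0 : R) (1 : R) (fun s : R => f (z + real_scale s v)) (f' z).

Lemma real_scale0 v : real_scale 0 v = 0.
Proof. by rewrite /real_scale rmorph0 scale0r. Qed.

Lemma real_scaleD s t v : real_scale (s + t) v = real_scale s v + real_scale t v.
Proof. by rewrite /real_scale rmorphD scalerDl. Qed.

Lemma is_derive_line v f f' (s : R) z : deriv_along v f f' (z + real_scale s v) ->
  is_derive s (1 : R) (fun s : R => f (z + real_scale s v)) (f' (z + real_scale s v)).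
Proof.
move=> h; rewrite -[f' _]mulr1.
rewrite (_ : (fun s => _) = (fun x => f (z + real_scale s v + real_scale x v)) \o shift (- s)).
  have h' : is_derive (shift (- s) s) (1 : R)
      (fun x => f (z + real_scale s v + real_scale x v)) (f' (z + real_scale s v)).
    by rewrite /shift /= subrr.
  exact: (is_derive1_comp h' (is_derive_shift s 1 (- s))).
by apply/funext => x /=; rewrite -addrA -real_scaleD addrCA subrr addr0.
Qed.

Lemma near0_line z v (U : set Cn) : nbhs z U -> \forall s \near (0 : R), U (z + real_scale s v).
Proof.
move=> /nbhs_CnP[e e0 eU].
have d0 : 0 < Num.min 1 (e / (sqnorm v + 1)).
  by rewrite lt_min ltr01 divr_gt0// ltr_wpDl ?sqnorm_ge0.
near=> s; apply: eU; rewrite addrAC subrr add0r sqnormZ.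
have : `|s| < Num.min 1 (e / (sqnorm v + 1)).
  by near: s; have := nbhsx_ballx (0 : R) _ d0; apply: filterS => x /=; rewrite /ball /= sub0r normrN.
rewrite lt_min ltr_pdivlMr ?ltr_wpDl ?sqnorm_ge0// => /andP[s1 se].
apply: le_lt_trans se; rewrite -real_normK ?num_real// expr2.
apply: ler_pM; rewrite ?mulr_ge0 ?sqnorm_ge0//; last by rewrite lerDl.
by rewrite ler_piMr// ltW.
Unshelve. all: by end_near.
Qed.

Lemma closed_nbhsC A z : closed A -> ~ A z -> nbhs z (~` A).
Proof. by move=> cA Az; have : open (~` A); [rewrite openC|rewrite openE; apply]. Qed.

Lemma deriv_along_off A v f f' : closed A ->
  (forall z, deriv_along v f f' z) -> (forall z, ~ A z -> f z = 0) ->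
  forall z, ~ A z -> f' z = 0.
Proof.
move=> cA df f0 z Az.
have nz := closed_nbhsC cA Az.
have h := near0_line v nz.
have dz : is_derive (0 : R) (1 : R) (fun s : R => f (z + real_scale s v)) 0.
  apply: (near_eq_is_derive _ (is_derive_cst (0 : R) (0 : R) (1 : R))).
  by apply: filterS h => s /= /f0 ->.
have -> : f' z = 'D_1 (fun s : R => f (z + real_scale s v)) (0 : R).
  by have := df z; rewrite /deriv_along => d; rewrite derive_val.
by rewrite derive_val.
Qed.

Lemma compact_bound f A : compact A -> (forall z, A z -> {for z, continuous f}) ->
  exists2 M : R, 0 <= M & forall z, A z -> `|f z| <= M.
Proof.
move=> cA cf; have : compact (f @` A).
  by apply: continuous_compact => //; apply: continuous_in_subspaceT => z /set_mem; exact: cf.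
move=> /compact_bounded [M [_ hM]]; exists (Num.max 0 (M + 1)); first by rewrite le_max lexx.
move=> z Az; rewrite le_max; apply/orP; right.
by have /= := hM (M + 1); rewrite ltrDl ltr01 => /(_ isT _ (ex_intro2 _ _ z Az erefl)).
Qed.

Lemma compact_bound_off f A : compact A -> continuous f -> (forall z, ~ A z -> f z = 0) ->
  exists2 M : R, 0 <= M & forall z, `|f z| <= M.
Proof.
move=> cA cf f0; have [M M0 hM] := compact_bound cA (fun z _ => cf z).
exists M => // z; have [/hM//|/f0 ->] := pselect (A z).
by rewrite normr0.
Qed.

Lemma integrable_cutoff f A : compact A -> continuous f -> (forall z, ~ A z -> f z = 0) ->
  lam.-integrable setT (EFin \o (fun t => f (orc t))).
Proof.
move=> cA cf f0; have [M M0 hM] := compact_bound_off cA cf f0.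
exact: (integrable_bounded (measurable_orc_continuous cf) cA hM f0).
Qed.

Lemma continuous_translate f w : continuous f -> continuous (fun z => f (z + w)).
Proof.
move=> cf z; apply/continuous_CnP => e e0.
have [d d0 hd] := (continuous_CnP _ _).1 (cf (z + w)) e e0.
by exists d => // u uz; apply: hd; rewrite opprD addrACA subrr addr0.
Qed.

(** By translation invariance the integral of [h (z + s v)] does not depend on [s]; its derivative
    at [s = 0], taken under the integral sign, is the integral of [h']. *)
Lemma integral_deriv_eq0 A v h h' : compact A -> continuous h -> continuous h' ->
  (forall z, deriv_along v h h' z) -> (forall z, ~ A z -> h z = 0) ->
  (\int[lam]_t h' (orc t) = 0)%R.
Proof.
move=> cA ch ch' dh h0.
have clA := compact_closed (@Cn_hausdorff R n') cA.
have h'0 := deriv_along_off clA dh h0.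
have [M M0 hM] := compact_bound_off cA ch h0.
have [M' M'0 hM'] := compact_bound_off cA ch' h'0.
have [c c0 Ac] := compact_sqnorm_bounded cA.
pose f (s : R) t := h (orc t + real_scale s v).
have intf s : lam.-integrable setT (EFin \o f s).
  have cs := @continuous_translate h (real_scale s v) ch.
  pose c2 := 2 * c + 2 * sqnorm (real_scale s v).
  apply: (integrable_cutoff (@compact_sqnorm_le R n' 0 c2) cs _) => z /= /negP.
  rewrite subr0 -ltNge => zc; apply: h0 => /Ac hA.
  have := sqnormD_le (z + real_scale s v) (- real_scale s v); rewrite addrK sqnormN.
  by move: zc; rewrite /c2; lra.
have Fc s : (\int[lam]_t f s t = \int[lam]_t h (orc t))%R.
  exact: (Rintegral_translate (measurable_orc_continuous ch) (intf s)).
(* For [|x| < 1] the translates of [A] by [- x v] all lie in one cube, whose indicator function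
   dominates. *)
pose c1 := 2 * c + 2 * sqnorm v.
have c10 : 0 <= c1 by rewrite addr_ge0 ?mulr_ge0 ?sqnorm_ge0.
have I0 : `](-1), 1[%classic (0 : R) by rewrite /= in_itv /= ltrN10 ltr01.
have df x t : is_derive x (1 : R) (f ^~ t) (h' (orc t + real_scale x v)).
  exact: is_derive_line.
have p1 x t : partial1of2 f x t = h' (orc t + real_scale x v).
  by rewrite partial1of2E; have d := df x t; rewrite derive_val.
have := @differentiation_under_integral _ _ _ lam f setT measurableT 0 (-1) 1 I0
  (fun s _ => intf s) (fun x t _ _ => ex_derive (is_derive := df x t))
  (fun t => M' * \1_(@cube R (n + n) (c1 + 1)) t).
rewrite (_ : (fun x' : R => _) = cst (\int[lam]_t h (orc t))%R); last by apply/funext => s; exact: Fc.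
rewrite derive1_cst => -> //.
- by apply: eq_Rintegral => t _; rewrite p1 real_scale0 addr0.
- by move=> t; rewrite mulr_ge0.
- exact: integrable_cube (addr_ge0 c10 ler01).
move=> x t; rewrite /= in_itv /= => /andP[x1 x2] _; rewrite p1.
have [At|At] := pselect (A (orc t + real_scale x v)); last first.
  by rewrite h'0// normr0 mulr_ge0.
rewrite indicE mem_set ?mulr1//; apply: sqnorm_cube => //.
have := sqnormD_le (orc t + real_scale x v) (- real_scale x v); rewrite addrK sqnormN sqnormZ.
have := Ac _ At; have : x ^+ 2 * sqnorm v <= sqnorm v.
  rewrite ler_piMl ?sqnorm_ge0// -real_normK ?num_real// expr_le1// ler_norml; apply/andP; split; exact: ltW.
rewrite /c1; lra.
Qed.

Lemma continuous_mul_cutoff (a f : Cn -> R) U A : open U -> closed A -> A `<=` U ->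
  (forall z, U z -> {for z, continuous a}) -> continuous f ->
  (forall z, ~ A z -> f z = 0) -> continuous (fun z => a z * f z).
Proof.
move=> oU cA AU ca cf f0 z.
have [Uz|Uz] := pselect (U z); first exact: (continuousM (ca z Uz) (cf z)).
have zA : ~ A z by move/AU.
apply/continuous_CnP => e e0; have /nbhs_CnP[d d0 hd] := closed_nbhsC cA zA.
exists d => // w wz.
by rewrite (f0 _ zA) (f0 _ (hd w wz)) !mulr0 subrr normr0.
Qed.

(** The derivative of [a f] has integral 0. The factor [a] is controlled only on [U], but off [A]
    the product is locally zero. *)
Lemma integration_by_parts_Cn U A v (a a' f f' : Cn -> R) :
  open U -> compact A -> A `<=` U ->
  (forall z, U z -> {for z, continuous a}) -> (forall z, U z -> {for z, continuous a'}) ->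
  (forall z, U z -> deriv_along v a a' z) ->
  continuous f -> continuous f' -> (forall z, deriv_along v f f' z) ->
  (forall z, ~ A z -> f z = 0) ->
  [/\ lam.-integrable setT (EFin \o (fun t => a (orc t) * f' (orc t))),
      lam.-integrable setT (EFin \o (fun t => a' (orc t) * f (orc t))) &
      (\int[lam]_t (a (orc t) * f' (orc t)) = - \int[lam]_t (a' (orc t) * f (orc t)))%R].
Proof.
move=> oU cA AU ca ca' da cf cf' df f0.
have clA := compact_closed (@Cn_hausdorff R n') cA.
have f'0 := deriv_along_off clA df f0.
have c1 := continuous_mul_cutoff oU clA AU ca cf f0.
have c2 := continuous_mul_cutoff oU clA AU ca cf' f'0.
have c3 := continuous_mul_cutoff oU clA AU ca' cf f0.
have a2 z : ~ A z -> a z * f' z = 0 by move=> /f'0 ->; rewrite mulr0.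
have a3 z : ~ A z -> a' z * f z = 0 by move=> /f0 ->; rewrite mulr0.
have i2 := integrable_cutoff cA c2 a2.
have i3 := integrable_cutoff cA c3 a3.
split => //; apply/eqP; rewrite -addr_eq0 -RintegralD//; apply/eqP.
apply: (@integral_deriv_eq0 A v (fun z => a z * f z) (fun z => a z * f' z + a' z * f z)) => //.
- by move=> z; exact: (cvgD (c2 z) (c3 z)).
- move=> z; have [Uz|Uz] := pselect (U z).
    have d1 := da z Uz; have d2 := df z.
    have := is_deriveM (f := fun s : R => a (z + real_scale s v)) d1 d2.
    rewrite /deriv_along real_scale0 addr0 /GRing.scale /=.
    by rewrite [f z * _]mulrC.
  have zA : ~ A z by move/AU.
  have nz := closed_nbhsC clA zA.
  rewrite /deriv_along (f0 z zA) (f'0 z zA) !mulr0 addr0.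
  apply: (near_eq_is_derive _ (is_derive_cst (0 : R) (0 : R) (1 : R))).
  by have := near0_line v nz; apply: filterS => s /= /f0 ->; rewrite mulr0.
- by move=> z /f0 ->; rewrite mulr0.
Qed.

End IntegrationByParts.

(** * The regularized potential *)

Section Profile.
Variables (R : realType) (n' : nat).
Local Notation n := n'.+1.
Local Notation Cn := (Cn R n).
Implicit Types (r s : R) (z v w : Cn).

Definition prof r : R := n%:R * ln r + 2 * ln (- ln r).
Definition dprof r : R := (n%:R + 2 * (ln r)^-1) * r^-1.
Definition ddprof r : R := - (n%:R + 2 * (ln r)^-1 + 2 * ((ln r)^-1 * (ln r)^-1)) * (r^-1 * r^-1).

Lemma is_derive_prof r : 0 < r < 1 -> is_derive r (1 : R) prof (dprof r).
Proof.
move=> /andP[r0 r1]; have L0 : ln r < 0 by apply: ln_lt0; rewrite r0 r1.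
have nL : 0 < - ln r by rewrite oppr_gt0.
have dl := is_derive1_ln r0.
have d2 : is_derive r (1 : R) ((@ln R) \o (fun x => - ln x)) ((- ln r)^-1 * - r^-1).
  have d1 : is_derive r (1 : R) (fun x => - ln x) (- r^-1) by exact: is_deriveN.
  exact: (@is_derive1_comp R (@ln R) (fun x => - ln x) r _ _ (is_derive1_ln nL) d1).
have -> : prof = n%:R \*: (@ln R) \+ 2 \*: ((@ln R) \o (fun x => - ln x)) by [].
have -> : dprof r = n%:R *: r^-1 + 2 *: ((- ln r)^-1 * - r^-1).
  by rewrite /dprof /GRing.scale /=; field; rewrite (gt_eqF r0) (lt_eqF L0).
by apply: is_deriveD.
Qed.

Lemma is_derive_inv_ln r : 0 < r < 1 ->
  is_derive r (1 : R) (fun x => (ln x)^-1) (- ((ln r)^-1 * (ln r)^-1) * r^-1).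
Proof.
move=> /andP[r0 r1]; have L0 : ln r < 0 by apply: ln_lt0; rewrite r0 r1.
have dl := is_derive1_ln r0.
have -> : - ((ln r)^-1 * (ln r)^-1) * r^-1 = (- (ln r) ^- 2) *: r^-1.
  by rewrite /GRing.scale /= expr2 invfM.
by apply: is_deriveV => //; rewrite lt_eqF.
Qed.

Lemma is_derive_dprof r : 0 < r < 1 -> is_derive r (1 : R) dprof (ddprof r).
Proof.
move=> r01; have /andP[r0 r1] := r01; have L0 : ln r < 0 by apply: ln_lt0; rewrite r0 r1.
have d1 := is_derive_inv_ln r01.
have d2 : is_derive r (1 : R) (fun x : R => x^-1) (- r ^- 2 *: (1 : R)).
  by apply: is_deriveV => //; rewrite gt_eqF.
have d3 : is_derive r (1 : R) (cst n%:R \+ 2 \*: (fun x : R => (ln x)^-1))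
    (0 + 2 *: (- ((ln r)^-1 * (ln r)^-1) * r^-1)) by apply: is_deriveD.
have d3' : is_derive r (1 : R) (fun x : R => n%:R + 2 * (ln x)^-1) _ := d3.
have := is_deriveM d3' d2.
rewrite /GRing.scale /= => d4; apply: is_derive_eq d4 _.
by rewrite /ddprof /=; field; rewrite (gt_eqF r0) (lt_eqF L0).
Qed.

Lemma prof_domain r : 0 < r < expR (- 2) -> [/\ 0 < r < 1, ln r < - 2 & - 1 / 2 < (ln r)^-1 < 0].
Proof.
move=> /andP[r0 re]; have L : ln r < - 2.
  by rewrite -[X in _ < X]expRK ltr_ln ?posrE ?expR_gt0.
split=> //.
  by rewrite r0 (lt_trans re)// -expR0 ltr_expR; lra.
have L0 : ln r < 0 by lra.
rewrite invr_lt0 L0 andbT.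
have y0 : (ln r)^-1 < 0 by rewrite invr_lt0.
have yL : (ln r)^-1 * ln r = 1 by rewrite mulVf// lt_eqF.
nra.
Qed.

Lemma dprof_ge0 r : 0 < r < expR (- 2) -> 0 <= dprof r.
Proof.
move=> re; have /andP[r0 _] := re; have [_ _ /andP[t1 t2]] := prof_domain re.
rewrite mulr_ge0//; last by rewrite invr_ge0 ltW.
by have : 1 <= n%:R :> R by [rewrite ler1n|]; lra.
Qed.

(** Here [s] stands for [|z|^2] and [r] for [|z|^2 + eps]. As [ddprof r <= 0], the worst case is
    [s = r], where [(n - m) (n + 2 t) >= n - 1 >= m] is set against [2 m t^2 <= m / 2]. *)
Lemma prof_hess_ge0 m r s : (m < n)%N -> 0 < r < expR (- 2) -> 0 <= s <= r ->
  0 <= n%:R * dprof r + m%:R * (ddprof r * s).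
Proof.
move=> mn re /andP[s0 sr]; have /andP[r0 _] := re; have [_ _ /andP[]] := prof_domain re.
rewrite /dprof /ddprof; set t := (ln r)^-1 => t1 t2.
have n1 : 1 <= n%:R :> R by rewrite ler1n.
have nm : m%:R + 1 <= n%:R :> R by rewrite natr1 ler_nat.
have m0 : 0 <= m%:R :> R by [].
have r2 : 0 < r^-1 * r^-1 by rewrite mulr_gt0 ?invr_gt0.
have -> : n%:R * ((n%:R + 2 * t) * r^-1) + m%:R * (- (n%:R + 2 * t + 2 * (t * t)) * (r^-1 * r^-1) * s) =
  (n%:R * (n%:R + 2 * t) * r - m%:R * (n%:R + 2 * t + 2 * (t * t)) * s) * (r^-1 * r^-1).
  by field; rewrite gt_eqF.
rewrite pmulr_lge0// subr_ge0.
have q0 : 0 <= n%:R + 2 * t + 2 * (t * t) by nra.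
apply: (@le_trans _ _ (m%:R * (n%:R + 2 * t + 2 * (t * t)) * r)).
  by rewrite ler_wpM2l// mulr_ge0.
rewrite ler_wpM2r ?ltW//.
have tt : t * t <= 1 / 4 by nra.
nra.
Qed.

Lemma ln_le_sub1 (a : R) : 0 < a -> ln a <= a - 1.
Proof. by move=> a0; have := @le_ln1Dx _ (a - 1); rewrite addrCA subrr addr0; apply; lra. Qed.

(** With [L = - ln r > 2], the bound [ln L <= L - 1] gives [prof r <= (2 - n) L - 2]. *)
Lemma prof_le0 r : (1 < n)%N -> 0 < r < expR (- 2) -> prof r <= 0.
Proof.
move=> n1 re; have /andP[r0 _] := re; have [_ L _] := prof_domain re.
have n2 : 2 <= n%:R :> R by rewrite ler_nat.
have h : ln (- ln r) <= - ln r - 1 by apply: ln_le_sub1; lra.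
by rewrite /prof; nra.
Qed.

(** By [ln x <= x - 1] and [- ln s > 2], the iterated logarithm drops by at most
    [(ln s - ln r) / 2]; twice this is compensated by the term [n ln]. *)
Lemma prof_nondecreasing r s : 0 < r -> r <= s -> s < expR (- 2) -> prof r <= prof s.
Proof.
move=> r0 rs se; have s0 := lt_le_trans r0 rs.
have [_ Ls _] := prof_domain (introT andP (conj s0 se)).
have [_ Lr _] := prof_domain (introT andP (conj r0 (le_lt_trans rs se))).
have L : ln r <= ln s by rewrite ler_ln.
have a0 : 0 < - ln s by lra.
have h : ln (- ln r) - ln (- ln s) <= (- ln r) / (- ln s) - 1.
  rewrite -ln_div ?posrE//; last lra.
  by apply: ln_le_sub1; rewrite divr_gt0//; lra.
have h2 : (- ln r) / (- ln s) - 1 <= (ln s - ln r) / 2.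
  have -> : (- ln r) / (- ln s) - 1 = (ln s - ln r) / (- ln s) by field; rewrite lt_eqF//; lra.
  by rewrite ler_pdivrMr//; nra.
have n1 : 1 <= n%:R :> R by rewrite ler1n.
by rewrite /prof; nra.
Qed.

Lemma is_derive_continuous (f : R -> R) x d : is_derive x (1 : R) f d -> {for x, continuous f}.
Proof.
by move=> [df _]; apply: differentiable_continuous; exact/derivable1_diffP.
Qed.

Lemma continuous_ddprof r : 0 < r < 1 -> {for r, continuous ddprof}.
Proof.
move=> r01; have /andP[r0 _] := r01.
have c1 := is_derive_continuous (is_derive_inv_ln r01).
have c2 : {for r, continuous (fun x : R => x^-1)} by apply: inv_continuous; rewrite gt_eqF.
apply: continuousM; last exact: (continuousM c2 c2).
apply: continuousN; apply: continuousD; last first.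
  by apply: continuousM; [exact: cst_continuous|exact: (continuousM c1 c1)].
apply: continuousD; first exact: cst_continuous.
by apply: continuousM; [exact: cst_continuous|exact: c1].
Qed.

End Profile.

(** * Smooth regularizations tested against second derivatives *)

Section RegularizedPotential.
Variables (R : realType) (n' : nat).
Local Notation n := n'.+1.
Local Notation Cn := (Cn R n).
Local Notation orc := (@of_real_coords R n).
Local Notation lam := (@lebesgue_Cn R n).
Local Notation rb := (@real_basis R n).
Local Notation prof := (@prof R n').
Local Notation dprof := (@dprof R n').
Local Notation ddprof := (@ddprof R n').
Implicit Types (z w v : Cn) (A U : set Cn).

Variable eps : R.
Hypothesis eps0 : 0 < eps.

Definition ureg z : R := prof (sqnorm z + eps).
Definition dureg v z : R := dprof (sqnorm z + eps) * (2 * dotp z v).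
Definition ddureg v w z : R :=
  ddprof (sqnorm z + eps) * (2 * dotp z v) * (2 * dotp z w) +
  dprof (sqnorm z + eps) * (2 * dotp v w).

(** Here the inner logarithm is negative, so that [ureg] is differentiable. *)
Definition udom : set Cn := [set z | sqnorm z + eps < 1].

Lemma open_udom : open udom.
Proof.
have := @open_sqnorm_lt R n' 0 (1 - eps); congr open.
by apply/seteqP; split => z /=; rewrite subr0 ltrBrDr.
Qed.

Lemma udomP z : udom z -> 0 < sqnorm z + eps < 1.
Proof. by move=> ->; rewrite andbT ltr_wpDl ?sqnorm_ge0. Qed.

Lemma continuous_radial (F : R -> R) z : {for sqnorm z + eps, continuous F} ->
  {for z, continuous (fun z => F (sqnorm z + eps))}.
Proof.
move=> cF; apply: (@continuous_comp _ _ _ (fun z : Cn => sqnorm z + eps) F) => //.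
exact: (cvgD (@continuous_sqnorm R n' z) (@cvg_cst _ _ _ _ _)).
Qed.

Lemma continuous_ureg z : udom z -> {for z, continuous ureg}.
Proof. by move=> /udomP h; apply/continuous_radial/(is_derive_continuous (is_derive_prof _ h)). Qed.

Lemma continuous_dprof_sqnorm z : udom z ->
  {for z, continuous (fun z => dprof (sqnorm z + eps))}.
Proof. by move=> /udomP h; apply/continuous_radial/(is_derive_continuous (is_derive_dprof _ h)). Qed.

Lemma continuous_2dotp v : continuous (fun z : Cn => 2 * dotp z v).
Proof. by move=> z; exact: (cvgM (@cvg_cst _ _ _ _ _) (@continuous_dotp R n' v z)). Qed.

Lemma continuous_dureg v z : udom z -> {for z, continuous (dureg v)}.
Proof.
by move=> h; exact: (cvgM (continuous_dprof_sqnorm h) (@continuous_2dotp v z)).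
Qed.

Lemma continuous_ddureg v w z : udom z -> {for z, continuous (ddureg v w)}.
Proof.
move=> h; have c := continuous_radial (@continuous_ddprof R n' _ (udomP h)).
exact: (cvgD (cvgM (cvgM c (@continuous_2dotp v z)) (@continuous_2dotp w z))
  (cvgM (continuous_dprof_sqnorm h) (@cvg_cst _ _ _ _ _))).
Qed.

Lemma deriv_ureg v z : udom z -> deriv_along v ureg (dureg v) z.
Proof. by move=> /udomP h; apply: is_derive_radial; exact: is_derive_prof. Qed.

Lemma deriv_dureg v w z : udom z -> deriv_along v (dureg w) (ddureg v w) z.
Proof.
move=> /udomP h; have d1 := is_derive_radial v (@is_derive_dprof R n' _ h).
have d2 : is_derive (0 : R) (1 : R) (fun t : R => 2 * dotp (z + real_scale t v) w) (2 * dotp v w).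
  have -> : (fun t : R => 2 * dotp (z + real_scale t v) w) =
    (fun t => 2 * dotp z w + t * (2 * dotp v w) + t ^+ 2 * 0).
    by apply/funext => t; rewrite dotpDl dotpZl; ring.
  exact: is_derive_quadratic.
have := is_deriveM d1 d2; rewrite /deriv_along /GRing.scale /= real_scale0 addr0 => d.
by apply: is_derive_eq d _; rewrite /ddureg; ring.
Qed.

Lemma ddureg_sym v w z : ddureg v w z = ddureg w v z.
Proof. by rewrite /ddureg (dotpC v w) mulrAC. Qed.

Variables (f : Cn -> R) (A : set Cn).
Hypotheses (sf : smooth f) (cA : compact A) (fA : forall z, ~ A z -> f z = 0).
Hypothesis (AU : A `<=` udom).

Let clA : closed A := compact_closed (@Cn_hausdorff R n') cA.

Lemma Ck_deriv k (g : Cn -> R) v z : Ck k.+1 g -> deriv_along v g (dder v g) z.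
Proof.
move=> [_ /(_ v)[/(_ z) dg _]]; rewrite /deriv_along /dder derive1E.
exact: derivableP.
Qed.

Lemma Ck_continuous k (g : Cn -> R) : Ck k g -> continuous g.
Proof. by case: k => [[]|k []]. Qed.

Lemma Ck_dder k (g : Cn -> R) v : Ck k.+1 g -> Ck k (dder v g).
Proof. by move=> [_ /(_ v)[]]. Qed.

Let f0 := sf 2%N.
Let f1 v := Ck_dder v f0.
Let f2 v w := Ck_dder w (f1 v).

Let dfA v : forall z, ~ A z -> dder v f z = 0.
Proof. exact: (deriv_along_off clA (fun z => Ck_deriv v z f0) fA). Qed.

(* [psi] is what remains of [phi], a second-order expression in [f], once the
   derivatives have been moved onto [ureg]. *)
Definition wdual (phi psi : Cn -> R) :=
  same_integral (fun t => ureg (orc t) * phi (orc t)) (fun t => psi (orc t) * f (orc t)).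

(** Two integrations by parts; they hand the derivatives over to [ureg] in the opposite order. *)
Lemma wdual_second v w : wdual (dder v (dder w f)) (ddureg v w).
Proof.
have [i1 i2 e1] := integration_by_parts_Cn open_udom cA AU continuous_ureg
  (@continuous_dureg v) (@deriv_ureg v) (Ck_continuous (f1 w)) (Ck_continuous (f2 w v))
  (fun z => Ck_deriv v z (f1 w)) (@dfA w).
have [i3 i4 e2] := integration_by_parts_Cn open_udom cA AU (@continuous_dureg v)
  (@continuous_ddureg w v) (@deriv_dureg w v) (Ck_continuous f0) (Ck_continuous (f1 w))
  (fun z => Ck_deriv w z f0) fA.
have E : ddureg v w = ddureg w v by apply/funext => z; exact: ddureg_sym.
by split; rewrite ?E// e1 e2 opprK.
Qed.

Lemma wdualD p1 q1 p2 q2 : wdual p1 q1 -> wdual p2 q2 ->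
  wdual (fun z => p1 z + p2 z) (fun z => q1 z + q2 z).
Proof.
move=> h1 h2; have := same_integralD h1 h2; congr same_integral; apply/funext => t /=.
  by rewrite mulrDr.
by rewrite mulrDl.
Qed.

Lemma wdualZ (c : R) p q : wdual p q -> wdual (fun z => c * p z) (fun z => c * q z).
Proof.
move=> h; have := same_integralZ c h; congr same_integral; apply/funext => t.
  by rewrite mulrCA.
by rewrite mulrA.
Qed.

Lemma wdual_sum (I : finType) (p q : I -> Cn -> R) : (forall i, wdual (p i) (q i)) ->
  wdual (fun z => \sum_i p i z) (fun z => \sum_i q i z).
Proof.
move=> pq; have := same_integral_sum (index_enum I) pq.
congr same_integral; apply/funext => t; first by rewrite mulr_sumr.
by rewrite mulr_suml.
Qed.

Lemma ddcE z v w :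
  ddc f z v w = -1 * dder v (dder (mulI w) f) z + dder w (dder (mulI v) f) z.
Proof.
have h a b : dder a (fun y => dc f y b) z = - dder a (dder (mulI b) f) z.
  by apply: dder_val; have := Ck_deriv a z (f1 (mulI b)) => d; exact: is_deriveN.
by rewrite /ddc !h opprK mulN1r.
Qed.

Lemma wdual_ddc v w : wdual (fun z => ddc f z v w)
  (fun z => hess_form (dprof (sqnorm z + eps)) (ddprof (sqnorm z + eps)) z v w).
Proof.
have -> : (fun z => ddc f z v w) =
    (fun z => -1 * dder v (dder (mulI w) f) z + dder w (dder (mulI v) f) z).
  by apply/funext => z; rewrite ddcE.
have -> : (fun z => hess_form (dprof (sqnorm z + eps)) (ddprof (sqnorm z + eps)) z v w) =
    (fun z => -1 * ddureg v (mulI w) z + ddureg w (mulI v) z).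
  apply/funext => z; rewrite /hess_form /ddureg (dotpC w) (dotp_mulIl v w); ring.
by apply: wdualD; [apply: wdualZ|]; exact: wdual_second.
Qed.

(** Expansion along the first factor, with coefficients independent of it: what holds for every
    [ddc f z v w] passes to the wedge product by linearity. *)
Lemma wedge_top_linear (rest : seq (form2 R n)) :
  exists c : {perm 'I_n * bool} -> R, forall w : form2 R n,
    wedge_top (w :: rest) =
    \sum_(s : {perm 'I_n * bool}) c s * w (rb (s (ord0, false))) (rb (s (ord0, true))).
Proof.
exists (fun s : {perm 'I_n * bool} => 2 ^- n * ((-1) ^+ s * \prod_(j < n') nth (fun _ _ : Cn => 0 : R) rest j
  (rb (s (lift ord0 j, false))) (rb (s (lift ord0 j, true))))) => w.
rewrite /wedge_top mulr_sumr; apply: eq_bigr => s _.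
rewrite big_ord_recl /= -!mulrA; congr (_ * (_ * _)); exact: mulrC.
Qed.

Lemma wdual_wedge (rest : seq (form2 R n)) : wdual (fun z => wedge_top (ddc f z :: rest))
  (fun z => wedge_top (hess_form (dprof (sqnorm z + eps)) (ddprof (sqnorm z + eps)) z :: rest)).
Proof.
have [c cE] := wedge_top_linear rest.
have -> : (fun z => wedge_top (ddc f z :: rest)) =
  (fun z => \sum_s c s * ddc f z (rb (s (ord0, false))) (rb (s (ord0, true)))).
  by apply/funext => z; rewrite cE.
have -> : (fun z => wedge_top (hess_form (dprof (sqnorm z + eps)) (ddprof (sqnorm z + eps)) z :: rest)) =
  (fun z => \sum_s c s * hess_form (dprof (sqnorm z + eps)) (ddprof (sqnorm z + eps)) z
    (rb (s (ord0, false))) (rb (s (ord0, true)))).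
  by apply/funext => z; rewrite cE.
by apply: wdual_sum => s; apply: wdualZ; exact: wdual_ddc.
Qed.

Lemma wedge_ddc_off (rest : seq (form2 R n)) z : ~ A z -> wedge_top (ddc f z :: rest) = 0.
Proof.
move=> Az; have [c ->] := wedge_top_linear rest; apply: big1 => s _.
have d2 v w : dder v (dder w f) z = 0.
  exact: (deriv_along_off clA (fun z => Ck_deriv v z (f1 w)) (@dfA w)).
by rewrite ddcE !d2 mulr0 addr0 mulr0.
Qed.

Lemma continuous_wedge_ddc (rest : seq (form2 R n)) :
  continuous (fun z => wedge_top (ddc f z :: rest)).
Proof.
have [c cE] := wedge_top_linear rest.
have -> : (fun z => wedge_top (ddc f z :: rest)) = (fun z => \sum_s c s *
    (-1 * dder (rb (s (ord0, false))) (dder (mulI (rb (s (ord0, true)))) f) z +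
     dder (rb (s (ord0, true))) (dder (mulI (rb (s (ord0, false)))) f) z)).
  by apply/funext => z; rewrite cE; apply: eq_bigr => s _; rewrite ddcE.
apply: (@continuous_big R _ +%R 0 _ _) => [|s _ z]; first exact: add_continuous.
exact: (cvgM (@cvg_cst _ _ _ _ _) (cvgD (cvgM (@cvg_cst _ _ _ _ _) (@Ck_continuous _ _ (f2 _ _) z))
  (@Ck_continuous _ _ (f2 _ _) z))).
Qed.

Lemma integral_ureg_wedge_ge0 m (alpha : 'I_m.-1 -> form2 R n) :
  (1 <= m < n)%N -> (forall j, m_positive m (alpha j)) ->
  (forall z, A z -> sqnorm z + eps < expR (- 2)) -> (forall z, 0 <= f z) ->
  (0 <= \int[lam]_t (ureg (orc t) * wedge_top (ddc f (orc t) ::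
     [seq alpha j | j <- enum 'I_m.-1] ++ nseq (n - m) (@beta R n))))%R.
Proof.
move=> /andP[m1 mn] apos Ae fpos; set rest := _ ++ _.
have [_ _ ->] := wdual_wedge rest.
apply: Rintegral_ge0 => t _; have [At|/fA ->] := pselect (A (orc t)); last by rewrite mulr0.
have re : 0 < sqnorm (orc t) + eps < expR (- 2) by rewrite Ae// andbT ltr_wpDl ?sqnorm_ge0.
apply: mulr_ge0 => //; apply: wedge_hess_ge0 => //.
- by rewrite m1 ltnW.
- exact: dprof_ge0.
- by apply: prof_hess_ge0 => //; rewrite sqnorm_ge0 lerDl ltW.
Qed.

End RegularizedPotential.

(** * Integrability *)

Section Integrability.
Variables (R : realType) (n' : nat).
Local Notation n := n'.+1.
Local Notation Cn := (Cn R n).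
Local Notation orc := (@of_real_coords R n).
Local Notation lam := (@lebesgue_Cn R n).
Local Notation prof := (@prof R n').
Local Notation u := (@u_log R n).
Local Notation tup := ((n + n).-tuple (measurableTypeR R)).
Local Notation Q := (@cube R (n + n)).
Implicit Types (z w v : Cn) (A U : set Cn) (t : tup).

Lemma normr_le_sqr (x c : R) : 0 <= c -> (`|x| <= c) = (x ^+ 2 <= c ^+ 2).
Proof. by move=> c0; rewrite -[x ^+ 2]real_normK ?num_real// ler_sqr ?nnegrE. Qed.

Lemma coord_sqr_le t i : tnth t i ^+ 2 <= sqnorm (orc t).
Proof.
rewrite -(splitK i).
case: (fintype.split i) => j /=; have := Re_sqr_le_sqnorm (orc t) j; rewrite !mxE /=; apply: le_trans.
  by rewrite lerDl sqr_ge0.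
by rewrite lerDr sqr_ge0.
Qed.

Lemma sqnorm_cube_le c t : Q c t -> sqnorm (orc t) <= (n + n)%:R * c ^+ 2.
Proof.
move=> tc; rewrite sqnormE /dotp natrD mulrDl.
have -> : n%:R * c ^+ 2 + n%:R * c ^+ 2 = \sum_(j < n) (c ^+ 2 + c ^+ 2).
  by rewrite big_split /= !sumr_const card_ord !mulr_natl.
apply: ler_sum => j _; rewrite !mxE /= -!expr2.
have h i : tnth t i ^+ 2 <= c ^+ 2 by rewrite -normr_le_sqr ?(le_trans _ (tc i))//; exact: tc.
exact: lerD.
Qed.

Lemma u_logE z : z != 0 -> u z = (prof (sqnorm z))%:E.
Proof. by rewrite /u_log => /negbTE ->. Qed.

Lemma sqnorm_gt0 z : z != 0 -> 0 < sqnorm z.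
Proof. by move=> z0; rewrite lt_neqAle sqnorm_ge0 andbT eq_sym; apply: contra z0 => /eqP/sqnorm_eq0 ->. Qed.

Lemma measurable_sqnorm_orc : measurable_fun setT (fun t => sqnorm (orc t)).
Proof. exact: (measurable_orc_continuous (@continuous_sqnorm R n')). Qed.

Lemma measurable_prof : measurable_fun setT prof.
Proof.
apply: measurable_funD; first by apply: measurable_funM => //; exact: measurable_ln.
apply: measurable_funM => //; apply: measurableT_comp; first exact: measurable_ln.
by apply: measurableT_comp => //; exact: measurable_ln.
Qed.

Lemma measurable_u_log : measurable_fun setT (u \o orc).
Proof.
have -> : u \o orc = (fun t => if sqnorm (orc t) == 0 then -oo%E else (prof (sqnorm (orc t)))%:E).
  apply/funext => t /=; case: ifPn => [/eqP/sqnorm_eq0 ->|h]; first by rewrite /u_log eqxx.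
  by rewrite u_logE//; apply: contra h => /eqP ->; rewrite sqnorm0.
apply: measurable_fun_ifT => //; first by apply: measurable_fun_eqr => //; exact: measurable_sqnorm_orc.
apply/measurable_EFinP; exact: (measurableT_comp measurable_prof measurable_sqnorm_orc).
Qed.

Lemma measurable_fun_expeR : measurable_fun setT (@expeR R).
Proof.
have -> : @expeR R = (fun x => if x == +oo then +oo else if x == -oo then 0 else (expR (fine x))%:E)%E.
  by apply/funext; case.
apply: measurable_fun_ifT => //; first exact: measurable_fun_eqe.
apply: measurable_fun_ifT => //; first exact: measurable_fun_eqe.
apply/measurable_EFinP; apply: measurableT_comp; first exact: measurable_expR.
exact: fine_measurable.
Qed.

Definition expu (p : R) z : \bar R := expeR (- (p%:E * u z))%E.

Lemma measurable_expu p : measurable_fun setT (expu p \o orc).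
Proof.
apply: (@measurableT_comp _ _ _ _ _ _ (@expeR R)) => //; first exact: measurable_fun_expeR.
apply: measurableT_comp => //; apply: emeasurable_funM => //; exact: measurable_u_log.
Qed.

Lemma expu0 p : 0 < p -> expu p 0 = +oo%E.
Proof. by move=> p0; rewrite /expu /u_log eqxx gt0_muleNy// lte_fin. Qed.

Lemma expuE p z : z != 0 -> expu p z = (expR (- (p * prof (sqnorm z))))%:E.
Proof. by move=> z0; rewrite /expu u_logE. Qed.

Lemma prof_expRN x : prof (expR (- x)) = - (n%:R * x) + 2 * ln x.
Proof. by rewrite /prof expRK opprK mulrN. Qed.

(* The shell between the cubes of half-sides [e^-(k+1)] and [e^-(k+2)] has
   measure at most [4^n e^-(2n(k+1))], and there [|z|^2 > e^-(2(k+2))], so that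
   [e^-u <= shell_bound (k+2)], which is of order [e^(2n(k+2)) / (k+2)^2]. *)
Definition radius k : R := expR (- k%:R).
Definition shell_bound k : R := expR (- prof (expR (- (2 * k%:R)))).

Lemma radius_ge0 k : 0 <= radius k.
Proof. exact: expR_ge0. Qed.

Lemma radius_sqr k : radius k ^+ 2 = expR (- (2 * k%:R)).
Proof. by rewrite /radius -expRM_natl mulrN. Qed.

Lemma shell_exists t : orc t != 0 -> sqnorm (orc t) < expR (- 2) ->
  exists k, [/\ Q (radius k.+1) t & expR (- (2 * k.+2%:R)) < sqnorm (orc t)].
Proof.
move=> t0 tB; have r0 := sqnorm_gt0 t0.
have ex : exists k, ~~ `[< Q (radius k.+2) t >].
  have [k hk] : exists k, 0 + k.+1%:R^-1 < sqnorm (orc t) / (n + n)%:R.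
    by apply: ltr_add_invr; rewrite divr_gt0// ltr0n.
  exists k; apply/asboolP => /sqnorm_cube_le; rewrite radius_sqr; apply/negP; rewrite -ltNge.
  rewrite -ltr_pdivlMl ?ltr0n// [_^-1 * _]mulrC; apply: le_lt_trans hk; rewrite add0r expRN lef_pV2 ?posrE ?expR_gt0//.
  apply: le_trans (expR_ge1Dx _); rewrite -natrM -[X in X + _]/(1%:R) -natrD ler_nat; lia.
(* The first [k] for which [Q (radius k.+2)] misses [t]. Minimality puts [t] in the preceding cube;
   for [k = 0] the ball does so, coordinates being at most [|z| < e^-1]. *)
case: (ex_minnP ex) => k /asboolP hk mink; exists k; split.
  case: k => [|k] in hk mink *.
    move=> i; rewrite normr_le_sqr ?radius_ge0// radius_sqr mulr1; apply: le_trans (ltW tB); exact: coord_sqr_le.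
  by apply/asboolP; apply/negPn/negP => /mink; rewrite ltnn.
rewrite -radius_sqr ltNge; apply/negP => h; apply: hk => i.
rewrite normr_le_sqr ?radius_ge0//.
exact: le_trans (coord_sqr_le t i) h.
Qed.

(** The exponentials cancel up to [e^(2n)], and [(2 (k + 2))^-2 <= 1 / ((k + 1) (k + 2))], which
    telescopes. *)
Lemma shell_bound_measure k :
  shell_bound k.+2 * (2 * radius k.+1) ^+ (n + n) <= (4 * expR 2) ^+ n * (k.+1%:R^-1 - k.+2%:R^-1).
Proof.
have -> : shell_bound k.+2 = expR (2 * k.+2%:R) ^+ n * (2 * k.+2%:R) ^- 2.
  rewrite /shell_bound prof_expRN opprD opprK expRD (expRM_natl n) expRN (expRM_natl 2) lnK//.
  by rewrite posrE mulr_gt0// ltr0n.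
have -> : (2 * radius k.+1) ^+ (n + n) = (4 * expR (- (2 * k.+1%:R))) ^+ n.
  by rewrite addnn -mul2n exprM (exprMn 2) radius_sqr -natrX.
have e : expR (2 * k.+2%:R) * (4 * expR (- (2 * k.+1%:R))) = 4 * expR 2 :> R.
  by rewrite mulrCA -expRD; congr (_ * expR _); rewrite -(@natr1 R k.+1); ring.
rewrite mulrAC -exprMn e.
rewrite ler_wpM2l ?exprn_ge0 ?mulr_ge0 ?expR_ge0//.
have k1 : 1 <= k.+1%:R :> R by rewrite ler1n.
rewrite -(@natr1 R k.+1); set a := k.+1%:R in k1 *.
have a0 : 0 < a by lra.
have -> : a^-1 - (a + 1)^-1 = (a * (a + 1))^-1 by field; rewrite !gt_eqF//; lra.
rewrite lef_pV2 ?posrE ?exprn_gt0 ?mulr_gt0//; try lra.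
nra.
Qed.

Lemma sum_shell_le N :
  \sum_(0 <= k < N) shell_bound k.+2 * (2 * radius k.+1) ^+ (n + n) <= (4 * expR 2) ^+ n.
Proof.
apply: (@le_trans _ _ (\sum_(0 <= k < N) ((4 * expR 2) ^+ n * (k.+1%:R^-1 - k.+2%:R^-1)))).
  by apply: ler_sum => k _; exact: shell_bound_measure.
rewrite -mulr_sumr ler_piMr ?exprn_ge0 ?mulr_ge0 ?expR_ge0//.
under eq_bigr do rewrite -opprB.
rewrite sumrN telescope_sumr// invr1 opprB lerBlDr lerDl invr_ge0//.
Qed.

Definition ballt : set tup := [set t | sqnorm (orc t) < expR (- 2)].

Lemma measurable_ballt : measurable ballt.
Proof.
have := @measurable_orc_open R n' _ (@open_sqnorm_lt R n' 0 (expR (- 2))).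
by congr measurable; apply/seteqP; split => t /=; rewrite subr0.
Qed.

(** The point where [u] is [-oo] is presented as a cube, so that it is seen to have measure 0. *)
Lemma cube0E : Q 0 = [set t | orc t = 0].
Proof.
apply/seteqP; split => t /=.
  by move=> /sqnorm_cube_le; rewrite expr0n mulr0 => h; apply/sqnorm_eq0/le_anti; rewrite h sqnorm_ge0.
move=> t0 i; rewrite normr_le0 -sqrf_eq0; apply/eqP/le_anti; rewrite sqr_ge0 andbT.
by have := coord_sqr_le t i; rewrite t0 sqnorm0.
Qed.

Lemma lebesgue_cube c : 0 <= c -> lam (Q c) = ((2 * c) ^+ (n + n))%:E.
Proof. exact: tuple_measure_cube. Qed.

Lemma integrable_expu1 : lam.-integrable ballt (expu 1 \o orc).
Proof.
apply/(@negligible_integrable _ _ _ lam ballt (Q 0)).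
- exact: measurable_cube.
- exact: measurable_ballt.
- exact: measurable_funTS (measurable_expu 1).
- by apply: etrans (lebesgue_cube (lexx 0)) _; rewrite mulr0 expr0n.
have mD : measurable (ballt `\` Q 0) by apply: measurableD; [exact: measurable_ballt|exact: measurable_cube].
apply/integrableP; split; first exact: measurable_funTS (measurable_expu 1).
(* Whole cubes replace the shells: for [t] in the shell of index [k] the single term [G k] already
   dominates, and the other terms are nonnegative. *)
pose G k t := (shell_bound k.+2 * \1_(Q (radius k.+1)) t)%:E.
have mG k : measurable_fun setT (G k).
  by apply/measurable_EFinP; apply: measurable_funM => //; apply: measurable_indic; exact: measurable_cube.
have G0 k t : (0 <= G k t)%E by rewrite lee_fin mulr_ge0 ?expR_ge0.
apply: (@le_lt_trans _ _ (\int[lam]_(t in ballt `\` Q 0) \sum_(k <oo) G k t)%E).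
  apply: ge0_le_integral => //.
  - by apply: measurableT_comp => //; exact: measurable_funTS (measurable_expu 1).
  - by apply: ge0_emeasurable_sum => // k _; exact: measurable_funTS.
  move=> t [tB]; rewrite cube0E => /= /eqP t0.
  rewrite expuE//= ger0_norm ?expR_ge0// mul1r.
  have [k [tk hk]] := shell_exists t0 tB.
  apply: (@le_trans _ _ (\sum_(0 <= i < k.+1) G i t)%E); last exact: nneseries_lim_ge.
  rewrite big_nat_recr//=; apply: (@le_trans _ _ (G k t)); last by apply: leeDr; exact: sume_ge0.
  rewrite lee_fin indicE mem_set// mulr1 ler_expR lerN2.
  by apply: prof_nondecreasing; rewrite ?expR_gt0// ltW.
apply: (@le_lt_trans _ _ (\int[lam]_t \sum_(k <oo) G k t)%E).
  apply: ge0_subset_integral => //; first by apply: ge0_emeasurable_sum.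
  by move=> t _; exact: nneseries_ge0.
rewrite integral_nneseries//.
apply: (@le_lt_trans _ _ ((4 * expR 2) ^+ n)%:E); last exact: ltry.
apply: lime_le; first by apply: is_cvg_nneseries => k _ _; exact: integral_ge0.
near=> N.
rewrite (eq_bigr (fun k => (shell_bound k.+2 * (2 * radius k.+1) ^+ (n + n))%:E)).
  by rewrite sumEFin lee_fin; exact: sum_shell_le.
move=> k _; rewrite EFinM -lebesgue_cube ?expR_ge0//.
rewrite /G; under eq_integral do rewrite EFinM.
rewrite ge0_integralZl//; first last.
- by rewrite lee_fin expR_ge0.
- by apply/measurable_EFinP; apply: measurable_indic; exact: measurable_cube.
by rewrite integral_indic ?setIT//; exact: measurable_cube.
Unshelve. all: by end_near.
Qed.

Lemma u_log_le0 z : (1 < n)%N -> sqnorm z < expR (- 2) -> (u z <= 0)%E.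
Proof.
move=> n1 zB; have [->|z0] := eqVneq z 0; first by rewrite /u_log eqxx.
by rewrite u_logE// lee_fin; apply: prof_le0 => //; rewrite sqnorm_gt0.
Qed.

Lemma integrable_expu p : (1 < n)%N -> 0 < p <= 1 -> lam.-integrable ballt (expu p \o orc).
Proof.
move=> n1 /andP[p0 p1]; apply: (le_integrable _ _ _ integrable_expu1).
- exact: measurable_ballt.
- exact: measurable_funTS (measurable_expu p).
move=> t tB /=; rewrite !gee0_abs ?expeR_ge0// lee_expeR leeN2.
have := u_log_le0 n1 tB; case: (u _) => [x||] // x0; last by rewrite !gt0_muleNy.
by rewrite lee_fin ler_wnM2r.
Qed.

Lemma integrable_u_log : (1 < n)%N -> lam.-integrable ballt (u \o orc).
Proof.
move=> n1; apply: (le_integrable _ _ _ integrable_expu1).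
- exact: measurable_ballt.
- exact: measurable_funTS measurable_u_log.
move=> t tB /=; have := u_log_le0 n1 tB; rewrite (gee0_abs (expeR_ge0 _)) /expu mul1e => x0.
by rewrite lee0_abs//; apply: le_trans (expeR_ge1Dx _); rewrite leeDr.
Qed.

Lemma not_integrable_expu p e (W : set tup) : 1 < p -> 0 < e -> measurable W ->
  [set t | sqnorm (orc t) < e] `<=` W -> ~ lam.-integrable W (expu p \o orc).
Proof.
move=> p1 e0 mW eW iW.
have p0 : 0 < p by lra.
have fI : (\int[lam]_(t in W) expu p (orc t))%E \is a fin_num.
  exact: (integrable_fin_num mW iW).
set I := (\int[lam]_(t in W) expu p (orc t))%E in fI.
have hI L : 2 < L -> expR (- L) < e ->
    (4 / (n + n)%:R) ^+ n * expR ((p - 1) * (n%:R * L) - 2 * p * ln L) <= fine I.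
  (* On the cube of half-side [c] one has [|z|^2 <= e^-L], so by monotonicity of [prof] the
     integrand is at least its value at [|z|^2 = e^-L]. *)
  move=> L2 Le; pose c := Num.sqrt (expR (- L) / (n + n)%:R).
  have c2 : c ^+ 2 = expR (- L) / (n + n)%:R by rewrite sqr_sqrtr// divr_ge0 ?expR_ge0.
  have c0 : 0 <= c by exact: sqrtr_ge0.
  have Qe t : Q c t -> sqnorm (orc t) <= expR (- L).
    by move=> /sqnorm_cube_le; rewrite c2 mulrCA mulfV ?mulr1// pnatr_eq0.
  rewrite -lee_fin fineK//.
  apply: (@le_trans _ _ (\int[lam]_(t in Q c) expu p (orc t))%E); last first.
    apply: ge0_subset_integral => //.
    - exact: measurable_cube.
    - exact: measurable_funTS (measurable_expu p).
    - by move=> t _; exact: expeR_ge0.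
    - by move=> t /Qe h; apply: eW; exact: le_lt_trans h Le.
  apply: (@le_trans _ _ (\int[lam]_(t in Q c) cst (expR (- (p * prof (expR (- L)))))%:E t)%E); last first.
    apply: ge0_le_integral => //.
    - exact: measurable_cube.
    - by move=> t _; rewrite lee_fin expR_ge0.
    - exact: measurable_funTS (measurable_expu p).
    move=> t /Qe h; have [->|t0] := eqVneq (orc t) 0; first by rewrite expu0// leey.
    rewrite expuE// lee_fin ler_expR lerN2 ler_pM2l//; apply: prof_nondecreasing => //.
      exact: sqnorm_gt0.
    by rewrite ltr_expR; lra.
  rewrite integral_cst; last exact: measurable_cube.
  apply: (@le_trans _ _ ((expR (- (p * prof (expR (- L)))))%:E * ((2 * c) ^+ (n + n))%:E)%E); last first.
    by rewrite [leRHS](congr1 (fun x => _ * x)%E (lebesgue_cube c0)).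
  rewrite -EFinM lee_fin.
  have -> : (2 * c) ^+ (n + n) = (4 / (n + n)%:R) ^+ n * expR (- (n%:R * L)).
    rewrite [LHS](_ : _ = ((2 * c) ^+ 2) ^+ n); last by rewrite -exprM mul2n addnn.
    rewrite -mulrN expRM_natl -exprMn (exprMn 2) c2; congr (_ ^+ _).
    by rewrite -natrX mulrCA; exact: mulrC.
  rewrite [leRHS]mulrCA -expRD ler_wpM2l ?exprn_ge0 ?divr_ge0// ler_expR prof_expRN; lra.
pose K : R := (4 / (n + n)%:R) ^+ n.
have K0 : 0 < K by rewrite exprn_gt0// divr_gt0// ltr0n.
pose q := p - 1; have q0 : 0 < q by rewrite subr_gt0.
(* The tangent of [ln] at [a] has slope [q / (4 p)], so [2 p ln L] costs at most half of [q L] plus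
   the constant [c']. The last term of [L] makes the other half at least [|c'| + |I| / K]. *)
pose a := 4 * p / q; have a0 : 0 < a by rewrite divr_gt0// mulr_gt0.
pose c' := 2 * p * ln a - 2 * p.
pose L := 3 + Num.max 0 (- ln e) + 2 * (`|c'| + `|fine I| / K) / q.
have L3 : 3 + Num.max 0 (- ln e) <= L.
  rewrite lerDl; apply: divr_ge0; last exact: ltW.
  by apply: mulr_ge0 => //; apply: addr_ge0 => //; apply: divr_ge0 => //; exact: ltW.
have m0 : 0 <= Num.max 0 (- ln e) by rewrite le_max lexx.
have m1 : - ln e <= Num.max 0 (- ln e) by rewrite le_max lexx orbT.
have := hI L ltac:(lra).
have -> : (expR (- L) < e) = true by rewrite -[e]lnK ?posrE// ltr_expR; lra.
move=> /(_ isT); apply/negP; rewrite -ltNge -/K.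
have hl : ln L <= L / a - 1 + ln a.
  have La : 0 < L / a by rewrite divr_gt0//; lra.
  have -> : ln L = ln (L / a) + ln a by rewrite -lnM ?posrE// divfK// gt_eqF.
  by rewrite lerD2r ln_le_sub1.
have hp : 2 * p * ln L <= q * L / 2 + c'.
  have -> : q * L / 2 + c' = 2 * p * (L / a - 1 + ln a).
    by rewrite /c' /a; field; rewrite !gt_eqF.
  by rewrite ler_pM2l// mulr_gt0.
have hn : q * L <= q * (n%:R * L).
  by rewrite ler_pM2l// ler_peMl ?ler1n//; lra.
have hL : `|c'| + `|fine I| / K <= q * L / 2.
  have -> : `|c'| + `|fine I| / K = q * (2 * (`|c'| + `|fine I| / K) / q) / 2.
    by field; rewrite !gt_eqF.
  by rewrite ler_pM2r// ler_pM2l// lerDr; lra.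
have hE : `|fine I| / K < expR (q * (n%:R * L) - 2 * p * ln L).
  apply: (@lt_le_trans _ _ (1 + (q * (n%:R * L) - 2 * p * ln L))); last exact: expR_ge1Dx.
  have := ler_norm c'; lra.
move: hE; rewrite ltr_pdivrMr// mulrC => /(le_lt_trans _) -> //.
exact: ler_norm.
Qed.

End Integrability.

(** * Positivity of the current *)

Section Approximation.
Variables (R : realType) (n' : nat).
Local Notation n := n'.+1.
Local Notation Cn := (Cn R n).
Local Notation orc := (@of_real_coords R n).
Local Notation lam := (@lebesgue_Cn R n).
Local Notation prof := (@prof R n').
Local Notation u := (@u_log R n).
Local Notation tup := ((n + n).-tuple (measurableTypeR R)).
Local Notation B := (@eball R n 0 (expR (- 1))).
Implicit Types (z w v : Cn) (A U : set Cn) (t : tup).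
Hypothesis n1 : (1 < n)%N.

Lemma eballE (a : Cn) (r : R) : 0 <= r -> eball a r = [set z | sqnorm (z - a) < r ^+ 2].
Proof.
move=> r0; apply/seteqP; split => z; rewrite /eball /=;
  by rewrite -[in Num.sqrt _ < r](ger0_norm r0) -sqrtr_sqr !ltNge ler_sqrt ?sqnorm_ge0.
Qed.

Lemma closed_eballE (a : Cn) (r : R) : 0 <= r -> closed_eball a r = [set z | sqnorm (z - a) <= r ^+ 2].
Proof.
move=> r0; apply/seteqP; split => z; rewrite /closed_eball /=;
  by rewrite -[in Num.sqrt _ <= r](ger0_norm r0) -sqrtr_sqr ler_sqrt ?sqr_ge0.
Qed.

Lemma ballE : B = [set z | sqnorm z < expR (- 2)].
Proof.
rewrite eballE ?expR_ge0// -expRM_natl mulrN mulr1.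
by apply/seteqP; split => z /=; rewrite subr0.
Qed.

Lemma ball_ballt : orc @^-1` B = @ballt R n'.
Proof. by rewrite ballE. Qed.

(** The reciprocal of the gap is continuous on [K], hence bounded. *)
Lemma compact_margin (K : set Cn) : compact K -> K `<=` B ->
  exists2 d : R, 0 < d & forall z, K z -> sqnorm z + d < expR (- 2).
Proof.
rewrite ballE => cK KB.
have [|M M0 hM] := @compact_bound R n' (fun z => (expR (- 2) - sqnorm z)^-1) _ cK.
  move=> z Kz; have z0 : expR (- 2) - sqnorm z != 0 by rewrite subr_eq0 gt_eqF//; exact: KB.
  exact: (cvgV z0 (cvgB (@cvg_cst _ _ _ _ _) (@continuous_sqnorm R n' z))).
exists (M + 1)^-1; first by rewrite invr_gt0 ltr_wpDl.
move=> z Kz; have h0 : 0 < expR (- 2) - sqnorm z by rewrite subr_gt0; exact: KB.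
have := hM z Kz; rewrite gtr0_norm ?invr_gt0// => h.
rewrite -ltrBrDl -[ltRHS]invrK ltf_pV2 ?posrE ?invr_gt0//; last by rewrite ltr_wpDl.
by rewrite (le_lt_trans h)// ltrDl.
Qed.

Definition epsn (d : R) k : R := d / k.+1%:R.

Lemma epsn_gt0 d k : 0 < d -> 0 < epsn d k.
Proof. by move=> d0; rewrite divr_gt0// ltr0n. Qed.

Lemma epsn_le d k : 0 < d -> epsn d k <= d.
Proof. by move=> d0; rewrite ler_pdivrMr ?ltr0n// ler_peMr ?ler1n// ltW. Qed.

Lemma cvg_epsn d : epsn d k @[k --> \oo] --> 0.
Proof.
rewrite -[X in _ --> X](mulr0 d).
by apply: cvgM; [exact: cvg_cst|exact: cvg_harmonic].
Qed.

Lemma cvg_ureg d z : z != 0 -> sqnorm z < 1 ->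
  ureg (epsn d k) z @[k --> \oo] --> prof (sqnorm z).
Proof.
move=> z0 z1; have r01 : 0 < sqnorm z < 1 by rewrite z1 sqnorm_gt0.
apply: (@cvg_comp _ _ _ (fun k => sqnorm z + epsn d k) prof _ (nbhs (sqnorm z))).
  rewrite -[X in _ `=>` nbhs X]addr0.
  exact: (cvgD (@cvg_cst _ _ _ _ _) (@cvg_epsn d)).
exact: (is_derive_continuous (is_derive_prof _ r01)).
Qed.

(** As [prof] is nondecreasing and nonpositive, adding [eps] brings its value closer to 0. *)
Lemma ureg_abs_le eps z : 0 < eps -> sqnorm z + eps < expR (- 2) ->
  (`|(ureg eps z)%:E| <= `|u z|)%E.
Proof.
move=> e0 ze; have [->|z0] := eqVneq z 0; first by rewrite /u_log eqxx leey.
have r0 := sqnorm_gt0 z0.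
rewrite u_logE// lee_fin.
have h : prof (sqnorm z) <= ureg eps z by apply: prof_nondecreasing => //; rewrite lerDl ltW.
have h0 : ureg eps z <= 0 by apply: prof_le0 => //; rewrite ze addr_gt0.
by rewrite !ler0_norm ?lerN2// (le_trans h).
Qed.

Lemma measurable_ureg eps : measurable_fun setT (fun t => ureg eps (orc t)).
Proof.
apply: (measurableT_comp (@measurable_prof R n')).
by apply: measurable_funD => //; exact: measurable_sqnorm_orc.
Qed.

(** The factors [G_ k] may vary with [k]: they are constant in [k] for the current, and are the
    ramps for the sub-mean value inequality. *)
Lemma integral_ureg_cvg d (D : set tup) (G_ : nat -> tup -> R) (G : tup -> R) (M : R) :
  0 < d -> measurable D -> (forall t, D t -> sqnorm (orc t) + d < expR (- 2)) ->
  (forall k, measurable_fun setT (G_ k)) -> measurable_fun setT G ->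
  (forall k t, `|G_ k t| <= M) -> (forall t, D t -> G_ k t @[k --> \oo] --> G t) ->
  (\int[lam]_(t in D) (ureg (epsn d k) (orc t) * G_ k t)%:E)%E @[k --> \oo] -->
  (\int[lam]_(t in D) (u (orc t) * (G t)%:E))%E.
Proof.
move=> d0 mD Dd mG_ mG GM GG.
have M0 : 0 <= M by apply: le_trans (GM 0%N (nseq_tuple _ 0)).
have DB : D `<=` @ballt R n' by move=> t /Dd; apply: le_lt_trans; rewrite lerDl ltW.
have iu := @integrable_u_log R n' n1.
have mu := @measurable_u_log R n'.
have [] // := @dominated_convergence _ _ _ lam D mD
  (fun k t => (ureg (epsn d k) (orc t) * G_ k t)%:E) (fun t => u (orc t) * (G t)%:E)%E
  (fun t => (M + 1)%:E * `|u (orc t)|)%E.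
- move=> k; apply: measurable_funTS; apply/measurable_EFinP.
  by apply: measurable_funM => //; exact: measurable_ureg.
- apply: measurable_funTS; apply: emeasurable_funM => //.
  exact/measurable_EFinP.
- exists (@cube R (n + n) 0); split.
  + exact: measurable_cube.
  + by apply: etrans (lebesgue_cube _ (lexx 0)) _; rewrite mulr0 expr0n.
  + move=> t /=; apply: contra_notP; rewrite cube0E => /= /eqP t0 Dt.
    rewrite u_logE// -EFinM; apply: cvg_EFin; first by near=> k.
    apply: cvgM; last exact: GG.
    by apply: cvg_ureg => //; apply: lt_trans (DB _ Dt) _; rewrite expR_lt1 oppr_lt0.
- apply: integrableZl => //; apply: integrable_abse.
  exact: (integrableS (@measurable_ballt R n') mD DB iu).
- apply/aeW => t k Dt; rewrite EFinM abseM muleC.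
  apply: lee_pmul => //; first by rewrite lee_fin (le_trans (GM _ _))// lerDl.
  apply: ureg_abs_le; first exact: epsn_gt0.
  by apply: le_lt_trans (Dd _ Dt); rewrite lerD2l epsn_le.
Unshelve. all: by end_near.
Qed.

Lemma u_log_ddc_wedge_nonneg m (alpha : 'I_m.-1 -> form2 R n) : (1 <= m < n)%N ->
  (forall j, m_positive m (alpha j)) -> ddc_wedge_nonneg B u alpha.
Proof.
move=> mn apos f [sf [K [cK KB fK]]] f0.
have [d d0 dK] := compact_margin cK KB.
rewrite /integral_Cn ball_ballt; set rest := _ ++ _.
pose H z := wedge_top (ddc f z :: rest).
have cH : continuous H := continuous_wedge_ddc sf (rest := rest).
have HK z : ~ K z -> H z = 0 by exact: wedge_ddc_off.
have [M M0 HM] := compact_bound_off cK cH HK.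
have mH := measurable_orc_continuous cH.
have mK : measurable (orc @^-1` K) := measurable_orc_compact cK.
(* The integrand lives on [K], where the margin [d] keeps every regularization within the range of
   the estimates. *)
have -> : (\int[lam]_(t in @ballt R n') (u (orc t) * (H (orc t))%:E) =
    \int[lam]_(t in orc @^-1` K) (u (orc t) * (H (orc t))%:E))%E.
  rewrite integral_mkcond [RHS]integral_mkcond; apply: eq_integral => t _.
  rewrite /patch; case: ifPn => [_|/negP tB].
    by case: ifPn => // /negP tK; rewrite HK ?mule0// => /mem_set.
  case: ifPn => // /set_mem tK; exfalso; apply: tB; apply: mem_set; rewrite -ball_ballt; exact: KB.
have dKt t : (orc @^-1` K) t -> sqnorm (orc t) + d < expR (- 2) by move=> /dK.
apply: (@cvge_ge _ _ _ _ _ _ _ _ (@integral_ureg_cvg d _ (fun _ t => H (orc t))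
  (fun t => H (orc t)) M d0 mK dKt (fun=> mH) mH (fun _ t => HM (orc t)) (fun t _ => @cvg_cst _ _ _ _ _))).
near=> k.
have e0 := epsn_gt0 k d0.
have ek z : K z -> sqnorm z + epsn d k < expR (- 2).
  by move=> /dK; apply: le_lt_trans; rewrite lerD2l epsn_le.
have KU : K `<=` udom (epsn d k).
  by move=> z /ek h'; apply: lt_trans h' _; rewrite expR_lt1 oppr_lt0.
have [iw _ _] := wdual_wedge e0 sf cK fK KU rest.
have := integral_ureg_wedge_ge0 e0 sf cK fK KU mn apos ek f0.
rewrite -/rest -lee_fin /Rintegral fineK; last exact: integrable_fin_num iw.
rewrite [X in (_ <= X -> _)%E](_ : _ = \int[lam]_(t in orc @^-1` K) (ureg (epsn d k) (orc t) * H (orc t))%:E)%E//.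
rewrite [RHS]integral_mkcond; apply: eq_integral => t _.
by rewrite /patch; case: ifPn => // /negP tK; rewrite -/(H (orc t)) HK ?mulr0// => /mem_set.
Unshelve. all: by end_near.
Qed.

End Approximation.

(** * The sub-mean value inequality *)

Section Dilation.
Variables (R : realType) (n' : nat).
Local Notation n := n'.+1.
Local Notation Cn := (Cn R n).
Local Notation orc := (@of_real_coords R n).
Local Notation lam := (@lebesgue_Cn R n).
Local Notation rb := (@real_basis R n).
Local Notation prof := (@prof R n').
Local Notation dprof := (@dprof R n').
Local Notation ddprof := (@ddprof R n').
Local Notation tup := ((n + n).-tuple (measurableTypeR R)).
Implicit Types (z w v y : Cn) (t s : R).

Lemma abs_dotp_le v w : `|2 * dotp v w| <= sqnorm v + sqnorm w.
Proof.
have := sqnorm_ge0 (v - w); have := sqnorm_ge0 (v + w).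
rewrite !sqnormD sqnormN (dotpC v (- w)) dotpNl (dotpC w) => h1 h2.
by rewrite ler_norml; apply/andP; split; lra.
Qed.

Lemma sum_real_basis (F : 'I_n * bool -> R) : \sum_p F p = \sum_(j < n) (F (j, false) + F (j, true)).
Proof.
rewrite (eq_bigr (fun p => F (p.1, p.2))); last by case.
rewrite -(pair_bigA _ (fun j b => F (j, b))) /=.
by apply: eq_bigr => j _; rewrite big_bool addrC.
Qed.

Lemma dotp_real_basis v w : dotp v w = \sum_p dotp v (rb p) * dotp w (rb p).
Proof. by rewrite sum_real_basis; apply: eq_bigr => j _; rewrite !dotp_basis. Qed.

Lemma dotp_real_basis1 p : dotp (rb p) (rb p) = 1.
Proof.
rewrite dotp_basis; case: p => j b; case: b; rewrite /real_basis /= !mxE !eqxx //=.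
by rewrite !(mul0r, mul1r, mulr1, addr0, add0r, subr0).
Qed.

(** The real Laplacian of [ureg], which is 4 times the quantity of [prof_hess_ge0] for [m = 1]. *)
Lemma sum_ddureg eps y : \sum_p ddureg eps (rb p) (rb p) y =
  4 * (n%:R * dprof (sqnorm y + eps) + ddprof (sqnorm y + eps) * sqnorm y).
Proof.
rewrite (eq_bigr (fun p => 4 * ddprof (sqnorm y + eps) * (dotp y (rb p) * dotp y (rb p)) +
    2 * dprof (sqnorm y + eps))); last by move=> p _; rewrite /ddureg dotp_real_basis1; ring.
rewrite big_split /= -mulr_sumr -dotp_real_basis -sqnormE.
rewrite sumr_const card_prod card_ord card_bool -[X in _ + X]mulr_natr natrM; ring.
Qed.

Variables (a : Cn) (eps c T : R) (psi Phi : R -> R).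
Hypotheses (eps0 : 0 < eps) (c0 : 0 < c) (T1 : 1 < T) (n1 : (1 < n)%N).
Hypotheses (dPhi : forall r, is_derive r (1 : R) Phi (- psi r)) (cpsi : continuous psi).
Hypotheses (Phi0 : forall r, 0 <= Phi r) (psi1 : forall r, `|psi r| <= 1).
Hypotheses (Phi_off : forall r, c < r -> Phi r = 0) (psi_off : forall r, c < r -> psi r = 0).

Definition dilate t z : Cn := a + real_scale t (z - a).

(** An open interval around [[0, 1]] is required for differentiating under the integral at the end
    points. *)
Hypothesis dom : forall t z, - T < t < T -> sqnorm (z - a) <= c ->
  sqnorm (dilate t z) + eps < expR (- 2).

Let A : set Cn := [set z | sqnorm (z - a) <= c].
Let cA : compact A. Proof. exact: compact_sqnorm_le. Qed.

Lemma dilateB t z w : sqnorm (dilate t w - dilate t z) = t ^+ 2 * sqnorm (w - z).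
Proof.
rewrite -sqnormZ; congr sqnorm; rewrite /dilate opprD addrACA subrr add0r.
by rewrite /real_scale -scalerBr opprB addrA subrK.
Qed.

Lemma dilateD t s z v : dilate t (z + real_scale s v) = dilate t z + real_scale (t * s) v.
Proof.
by rewrite /dilate -[RHS]addrA addrAC /real_scale scalerDr scalerA -rmorphM.
Qed.

Lemma continuous_dilate (g : Cn -> R) t z : {for dilate t z, continuous g} ->
  {for z, continuous (g \o dilate t)}.
Proof.
move=> /continuous_CnP cg; apply/continuous_CnP => e /cg [d d0 hd].
exists (d / (t ^+ 2 + 1)); first by rewrite divr_gt0// ltr_wpDl ?sqr_ge0.
move=> w; rewrite ltr_pdivlMr ?ltr_wpDl ?sqr_ge0// => wz; apply: hd.
rewrite dilateB; apply: le_lt_trans wz; rewrite mulrC ler_wpM2l ?sqnorm_ge0// lerDl//.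
Qed.

Let U t : set Cn := dilate t @^-1` (udom eps).

Let oU t : @open Cn (U t).
Proof.
have cc : continuous ((fun z => sqnorm z + eps) \o dilate t).
  move=> z; apply: continuous_dilate.
  exact: (cvgD (@continuous_sqnorm R n' _) (@cvg_cst _ _ _ _ _)).
have := @open_comp _ _ _ [set x : R | x < 1] (fun z _ => cc z).
by apply; exact: open_lt.
Qed.

Let AU t : - T < t < T -> A `<=` U t.
Proof. by move=> tT z /(dom tT) h; apply: lt_trans h _; rewrite expR_lt1 oppr_lt0. Qed.

Let wgt z : R := psi (sqnorm (z - a)).
(** As [Phi' = - psi], the gradient of [pot] is [- 2 wgt (z - a)]: the weighted radial field is the
    gradient of a compactly supported function. *)
Let pot z : R := Phi (sqnorm (z - a)).

Let cont_radial (F : R -> R) : continuous F -> continuous (fun z => F (sqnorm (z - a))).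
Proof.
move=> cF z.
have c1 := @continuous_translate R n' _ (- a) (@continuous_sqnorm R n') z.
exact: (@continuous_comp _ _ _ (fun z : Cn => sqnorm (z - a)) F z c1 (cF _)).
Qed.

Let cwgt : continuous wgt := cont_radial cpsi.

Let cpot : continuous pot.
Proof. by apply: cont_radial => r; exact: (is_derive_continuous (dPhi r)). Qed.

Let wgt_off z : ~ A z -> wgt z = 0.
Proof. by move=> /negP; rewrite -ltNge; exact: psi_off. Qed.

Let pot_off z : ~ A z -> pot z = 0.
Proof. by move=> /negP; rewrite -ltNge; exact: Phi_off. Qed.

Let dpot v z := - wgt z * (2 * dotp (z - a) v).

Let cdpot v : continuous (dpot v).
Proof.
have -> : dpot v = (fun z => wgt z * (- 2 * dotp (z - a) v)) by apply/funext => z; rewrite /dpot; ring.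
move=> z; have c1 := @continuous_translate R n' _ (- a) (@continuous_dotp R n' v) z.
exact: (cvgM (@cwgt z) (cvgM (@cvg_cst _ _ _ _ _) c1)).
Qed.

Let deriv_pot v z : deriv_along v pot (dpot v) z.
Proof.
have h := @is_derive_radial R n' Phi _ 0 (z - a) v (dPhi _).
rewrite /deriv_along /dpot /wgt /pot; rewrite addr0 in h.
apply: (near_eq_is_derive _ h); near=> s.
by rewrite addr0 addrAC.
Unshelve. all: by end_near.
Qed.

Let F t (x : tup) : R := ureg eps (dilate t (orc x)) * wgt (orc x).
(* Integrating by parts in every real direction turns the integral of [dF t],
   the derivative of that of [F t], into a multiple of that of the Laplacian of
   [ureg] at [dilate t z] against [pot]. *)
Let dF t (x : tup) : R := dureg eps (orc x - a) (dilate t (orc x)) * wgt (orc x).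

Let integrable_F t : - T < t < T -> lam.-integrable setT (EFin \o F t).
Proof.
move=> tT; have clA := compact_closed (@Cn_hausdorff R n') cA.
have ch : forall z, U t z -> {for z, continuous (ureg eps \o dilate t)}.
  by move=> z h; apply: continuous_dilate; exact: continuous_ureg.
have cc := continuous_mul_cutoff (@oU t) clA (AU tT) ch cwgt wgt_off.
by apply: (integrable_cutoff cA cc) => z /wgt_off ->; rewrite mulr0.
Qed.

Let is_derive_F t x : - T < t < T -> is_derive t (1 : R) (F ^~ x) (dF t x).
Proof.
move=> tT; have [Ax|/wgt_off w0] := pselect (A (orc x)); last first.
  rewrite /dF w0 mulr0 (_ : F^~ x = cst 0); first exact: is_derive_cst.
  by apply/funext => s; rewrite /F w0 mulr0.
have d1 := is_derive_line (deriv_ureg eps0 (orc x - a) (AU tT Ax)).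
have := is_deriveM d1 (is_derive_cst (wgt (orc x)) t (1 : R)).
rewrite scaler0 add0r /GRing.scale /= => d2.
by apply: is_derive_eq d2 _; rewrite /dF /= mulrC.
Qed.

(** Uniformly in [t], [dprof r <= n / r <= n / eps], and
    [|2 dotp y w| <= |y|^2 + |w|^2 <= 1 + c]. *)
Let dF_bound t x : - T < t < T ->
  `|dF t x| <= (n%:R / eps * (1 + c)) * \1_(@cube R (n + n) (2 * c + 2 * sqnorm a + 1)) x.
Proof.
move=> tT; have M0 : 0 <= n%:R / eps * (1 + c) by rewrite mulr_ge0 ?divr_ge0 ?addr_ge0// ltW.
have [Ax|/wgt_off w0] := pselect (A (orc x)); last by rewrite /dF w0 mulr0 normr0 mulr_ge0.
have xc : sqnorm (orc x) <= 2 * c + 2 * sqnorm a.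
  have := sqnormD_le (orc x - a) a; rewrite subrK => /le_trans; apply.
  by rewrite lerD2r ler_pM2l.
rewrite indicE mem_set; last by apply: sqnorm_cube => //; apply: le_trans xc; exact: sqnorm_ge0.
rewrite mulr1 /dF normrM -[leRHS]mulr1; apply: ler_pM => //; last exact: psi1.
rewrite /dureg normrM.
have dm := dom tT Ax; set y := dilate t (orc x) in dm *.
have re : 0 < sqnorm y + eps < expR (- 2) by rewrite dm ltr_wpDl ?sqnorm_ge0.
have [_ _ /andP[_ L0]] := prof_domain re.
have y1 : sqnorm y <= 1.
  apply: ltW; apply: lt_trans (_ : expR (- 2) < 1 :> R); last by rewrite expR_lt1 oppr_lt0.
  by apply: lt_trans dm; rewrite ltrDl.
rewrite ler_pM//.
  rewrite ger0_norm ?dprof_ge0// /dprof ler_pM ?invr_ge0//.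
  - by have : 1 <= n%:R :> R by [rewrite ler1n|]; have [_ _ /andP[]] := prof_domain re; lra.
  - by rewrite addr_ge0 ?sqnorm_ge0// ltW.
  - by lra.
  - by rewrite lef_pV2 ?posrE ?lerDr ?sqnorm_ge0// ltr_wpDl ?sqnorm_ge0.
exact: le_trans (abs_dotp_le _ _) (lerD y1 Ax).
Qed.

Let same_dF t : - T < t < T ->
  same_integral (dF t) (fun x => t / 2 * (\sum_p ddureg eps (rb p) (rb p) (dilate t (orc x))) * pot (orc x)).
Proof.
move=> tT.
pose ap v : Cn -> R := dureg eps v \o dilate t.
pose dap v z := t * ddureg eps v v (dilate t z).
have cap v z : U t z -> {for z, continuous (ap v)}.
  by move=> h; apply: continuous_dilate; exact: continuous_dureg.
have cdap v z : U t z -> {for z, continuous (dap v)}.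
  move=> h; have := @continuous_dilate (ddureg eps v v) t z (@continuous_ddureg _ _ _ eps0 v v _ h).
  by move=> c1; exact: (cvgM (@cvg_cst _ _ _ _ _) c1).
have derap v z : U t z -> deriv_along v (ap v) (dap v) z.
  move=> h; have d1 := deriv_dureg eps0 v v h.
  rewrite /deriv_along in d1 *.
  have d2 : is_derive (0 : R) (1 : R) ( *%R t) t.
    by have := is_deriveZ t (is_derive_id (0 : R) (1 : R)); rewrite /GRing.scale /= mulr1.
  have d1' : is_derive (t * 0) (1 : R) (fun s => dureg eps v (dilate t z + real_scale s v)) (ddureg eps v v (dilate t z)).
    by rewrite mulr0.
  have d3 := @is_derive1_comp R (fun s => dureg eps v (dilate t z + real_scale s v)) ( *%R t) 0 _ _ d1' d2.
  rewrite /dap mulrC; apply: (near_eq_is_derive _ d3); near=> s => /=.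
  by rewrite /ap /= dilateD.
pose r := index_enum ('I_n * bool)%type.
(* [dF] is [- 1 / 2] times the pairing of the gradient of [ureg], at the dilated point, with that of
   [pot]; the factor [t] in [dap] is the chain rule for [dilate]. *)
have : same_integral
    (fun x => \sum_(p <- r) - (1 / 2) * (ap (rb p) (orc x) * dpot (rb p) (orc x)))
    (fun x => \sum_(p <- r) - (1 / 2) * (- 1 * (dap (rb p) (orc x) * pot (orc x)))).
  apply: same_integral_sum => p; apply: same_integralZ.
  have [i1 i2 e] := integration_by_parts_Cn (@oU t) cA (AU tT) (cap (rb p)) (cdap (rb p))
    (derap (rb p)) cpot (@cdpot (rb p)) (deriv_pot (rb p)) pot_off.
  split=> //; first by have := integrableZl measurableT (- 1) i2.
  by rewrite RintegralZl// e mulN1r.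
congr same_integral; apply/funext => x.
  rewrite /ap /dpot /dF /dureg /= (dotpC _ (orc x - a)) dotp_real_basis.
  rewrite -mulr_sumr !mulr_sumr mulr_suml; apply: eq_bigr => p _.
  by field.
rewrite /dap !mulr_sumr mulr_suml; apply: eq_bigr => p _; by field.
Unshelve. all: by end_near.
Qed.

Let int_dF_ge0 t : 0 <= t < T -> (0 <= \int[lam]_x dF t x)%R.
Proof.
move=> /andP[t0 tT]; have tTT : - T < t < T by apply/andP; split; lra.
have [_ _ ->] := same_dF tTT; apply: Rintegral_ge0 => x _.
have [Ax|/pot_off ->] := pselect (A (orc x)); last by rewrite mulr0.
apply: mulr_ge0; last exact: Phi0.
rewrite mulr_ge0 ?divr_ge0// sum_ddureg mulr_ge0//.
have dm := dom tTT Ax; set y := dilate t (orc x) in dm *.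
have re : 0 < sqnorm y + eps < expR (- 2) by rewrite dm ltr_wpDl ?sqnorm_ge0.
have := prof_hess_ge0 n1 re (_ : 0 <= sqnorm y <= _); rewrite mul1r; apply.
by rewrite sqnorm_ge0 lerDl ltW.
Qed.

Lemma ureg_weighted_submean :
  ureg eps a * (\int[lam]_x psi (sqnorm (orc x - a)))%R <=
  (\int[lam]_x (ureg eps (orc x) * psi (sqnorm (orc x - a))))%R.
Proof.
have I01 t : 0 <= t <= 1 -> - T < t < T.
  move=> /andP[t0 t1]; rewrite (le_lt_trans t1 T1) andbT; apply: lt_le_trans t0.
  by rewrite oppr_lt0 (lt_trans ltr01 T1).
have iw : lam.-integrable setT (EFin \o (fun x => wgt (orc x))) := integrable_cutoff cA cwgt wgt_off.
have cc : 0 <= 2 * c + 2 * sqnorm a + 1 by rewrite !addr_ge0 ?mulr_ge0 ?sqnorm_ge0// ltW.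
have M0 : 0 <= n%:R / eps * (1 + c) by rewrite mulr_ge0 ?divr_ge0 ?addr_ge0// ltW.
have p1 t x : - T < t < T -> partial1of2 F t x = dF t x.
  by move=> tT; rewrite partial1of2E; have d := is_derive_F x tT; rewrite derive_val.
have itvT t : `]- T, T[%classic t -> - T < t < T by rewrite /= in_itv.
have hD t : - T < t < T -> derivable (fun t => \int[lam]_x F t x)%R t 1.
  move=> tT; apply: (@derivable_under_integral _ _ _ lam F setT measurableT t (- T) T _ _ _
    (fun x => n%:R / eps * (1 + c) * \1_(@cube R (n + n) (2 * c + 2 * sqnorm a + 1)) x)) => //.
  - by move=> s x /itvT sT _; have d := is_derive_F x sT; exact: ex_derive.
  - by move=> x; rewrite mulr_ge0.
  - exact: integrable_cube.
  - by move=> s x /itvT sT _; rewrite p1//; exact: dF_bound.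
have hV t : 0 <= t <= 1 -> 0 <= derive1 (fun t => \int[lam]_x F t x)%R t.
  move=> t01; have tT := I01 _ t01.
  rewrite (@differentiation_under_integral _ _ _ lam F setT measurableT t (- T) T _ _ _
    (fun x => n%:R / eps * (1 + c) * \1_(@cube R (n + n) (2 * c + 2 * sqnorm a + 1)) x)) //.
  - rewrite [X in 0 <= X](_ : _ = \int[lam]_x dF t x)%R; last by apply: eq_Rintegral => x _; exact: p1.
    by apply: int_dF_ge0; have /andP[-> t1] := t01; exact: le_lt_trans T1.
  - by move=> s x /itvT sT _; have d := is_derive_F x sT; exact: ex_derive.
  - by move=> x; rewrite mulr_ge0.
  - exact: integrable_cube.
  - by move=> s x /itvT sT _; rewrite p1//; exact: dF_bound.
pose G t := (\int[lam]_x F t x)%R.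
have G1 : G 1 = (\int[lam]_x (ureg eps (orc x) * psi (sqnorm (orc x - a))))%R.
  apply: eq_Rintegral => x _; congr (ureg eps _ * _).
  by rewrite /dilate /real_scale rmorph1 scale1r addrC subrK.
have G0 : G 0 = ureg eps a * (\int[lam]_x psi (sqnorm (orc x - a)))%R.
  transitivity (\int[lam]_x (ureg eps a * wgt (orc x)))%R; last by apply: RintegralZl.
  apply: eq_Rintegral => x _; congr (ureg eps _ * _).
  by rewrite /dilate real_scale0 addr0.
have h1 t : t \in `]0, 1[ -> derivable G t 1.
  by rewrite in_itv /= => /andP[t0 t1]; apply/hD/I01; rewrite !ltW.
have h2 t : t \in `]0, 1[ -> 0 <= derive1 G t.
  by rewrite in_itv /= => /andP[t0 t1]; apply: hV; rewrite !ltW.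
have h3 : {within `[0, 1], continuous G}.
  by apply: derivable_within_continuous => t; rewrite in_itv /= => /I01; exact: hD.
have := ger0_derive1_ndecr h1 h2 h3 (lexx 0) ler01 (lexx 1).
by rewrite {1}G0 {1}G1.
Qed.

End Dilation.

Section Subharmonicity.
Variables (R : realType) (n' : nat).
Local Notation n := n'.+1.
Local Notation Cn := (Cn R n).
Local Notation orc := (@of_real_coords R n).
Local Notation lam := (@lebesgue_Cn R n).
Local Notation prof := (@prof R n').
Local Notation u := (@u_log R n).
Local Notation B := (@eball R n 0 (expR (- 1))).
Local Notation Q := (@cube R (n + n)).
Implicit Types (z w v a : Cn) (r s x : R).
Hypothesis n1 : (1 < n)%N.

(** Convexity gives the lower bound; the upper one holds because the derivative [2 max (0, x)] is
    Lipschitz with constant 2. *)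
Lemma sqr_pos_taylor x h :
  0 <= Num.max 0 (x + h) ^+ 2 - Num.max 0 x ^+ 2 - h * (2 * Num.max 0 x) <= h ^+ 2.
Proof.
rewrite !maxEle; case: (leP 0 (x + h)) => xh; case: (leP 0 x) => x0; apply/andP; split; nra.
Qed.

Lemma is_derive_sqr_pos x :
  is_derive x (1 : R) (fun y => Num.max 0 y ^+ 2) (2 * Num.max 0 x).
Proof.
set f := fun y : R => _.
have c : h^-1 *: ((f \o shift x) (h *: 1) - f x) @[h --> 0^'] --> 2 * Num.max 0 x.
  apply/cvgrPdist_lt => e e0; near=> h.
  have h0 : h != 0 by near: h; exact: nbhs_dnbhs_neq.
  rewrite /= /GRing.scale /= mulr1 /f [h + x]addrC.
  have -> : 2 * Num.max 0 x - h^-1 * (Num.max 0 (x + h) ^+ 2 - Num.max 0 x ^+ 2) =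
    - h^-1 * (Num.max 0 (x + h) ^+ 2 - Num.max 0 x ^+ 2 - h * (2 * Num.max 0 x)) by field.
  have /andP[t1 t2] := sqr_pos_taylor x h.
  rewrite normrM normrN normfV (ger0_norm t1).
  apply: (@le_lt_trans _ _ `|h|).
    rewrite ler_pdivrMl ?normr_gt0//; apply: le_trans t2 _.
    by rewrite -normrM -expr2 ler_norm.
  near: h; apply: nbhs_dnbhs.
  by have := nbhsx_ballx (0 : R) _ e0; apply: filterS => y /=; rewrite /ball /= sub0r normrN.
split; first by apply/cvg_ex; exists (2 * Num.max 0 x).
exact: (cvg_lim _ c).
Unshelve. all: by end_near.
Qed.

(* As [d] goes to 0 the ramps of height 1 approximate the indicator function of
   [r < c]; being continuous, they have a C^1 compactly supported primitive. *)
Definition ramp (c d r : R) : R := d^-1 * (Num.max 0 (c - r) - Num.max 0 (c - d - r)).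
Definition ramp_int (c d r : R) : R :=
  (2 * d)^-1 * (Num.max 0 (c - r) ^+ 2 - Num.max 0 (c - d - r) ^+ 2).

Lemma ramp_ge0_le1 c d r : 0 < d -> 0 <= ramp c d r <= 1.
Proof.
move=> d0; rewrite /ramp pmulr_rge0 ?invr_gt0// ler_pdivrMl// mulr1 !maxEle.
by case: (leP 0 (c - r)) => h1; case: (leP 0 (c - d - r)) => h2; apply/andP; split; lra.
Qed.

Lemma ramp_off c d r : 0 < d -> c < r -> ramp c d r = 0.
Proof.
by move=> d0 cr; rewrite /ramp !max_l ?subrr ?mulr0//; lra.
Qed.

Lemma ramp_in c d r : 0 < d -> r <= c - d -> ramp c d r = 1.
Proof.
move=> d0 cr; rewrite /ramp !max_r; [|lra|lra].
by rewrite (_ : _ - _ = d) ?mulVf ?gt_eqF//; ring.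
Qed.

Lemma ramp_int_ge0 c d r : 0 < d -> 0 <= ramp_int c d r.
Proof.
move=> d0; rewrite /ramp_int pmulr_rge0 ?invr_gt0 ?mulr_gt0// !maxEle.
by case: (leP 0 (c - r)) => h1; case: (leP 0 (c - d - r)) => h2; nra.
Qed.

Lemma ramp_int_off c d r : 0 < d -> c < r -> ramp_int c d r = 0.
Proof. by move=> d0 cr; rewrite /ramp_int !max_l ?subrr ?mulr0//; lra. Qed.

Lemma is_derive_sqr_pos_sub c r :
  is_derive r (1 : R) (fun y => Num.max 0 (c - y) ^+ 2) (- (2 * Num.max 0 (c - r))).
Proof.
have d1 : is_derive r (1 : R) (fun y => c - y) (- 1).
  by have := is_deriveB (is_derive_cst c r (1 : R)) (is_derive_id r (1 : R)); rewrite sub0r.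
have := @is_derive1_comp R (fun y => Num.max 0 y ^+ 2) (fun y => c - y) r _ _ (is_derive_sqr_pos (c - r)) d1.
by rewrite mulrN1.
Qed.

Lemma is_derive_ramp_int c d r : 0 < d -> is_derive r (1 : R) (ramp_int c d) (- ramp c d r).
Proof.
move=> d0; have d1 := is_deriveB (is_derive_sqr_pos_sub c r) (is_derive_sqr_pos_sub (c - d) r).
have := is_deriveZ (2 * d)^-1 d1; rewrite /GRing.scale /= => d2.
by apply: is_derive_eq d2 _; rewrite /ramp; field; rewrite gt_eqF.
Qed.

Lemma continuous_ramp c d : continuous (ramp c d).
Proof.
have h (e : R) : continuous (fun r => Num.max 0 (e - r)).
  have -> : (fun r => Num.max 0 (e - r)) = (fun r => 2^-1 * ((e - r) + `|e - r|)).
    apply/funext => r; rewrite maxEle; case: (leP 0 (e - r)) => er.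
      by rewrite ger0_norm//; field.
    by rewrite ltr0_norm//; field.
  move=> r; have c1 : e - y @[y --> r] --> e - r by apply: cvgB; [exact: cvg_cst|exact: cvg_id].
  apply: cvgM; first exact: cvg_cst.
  by apply: cvgD => //; exact: cvg_norm.
move=> r; apply: cvgM; first exact: cvg_cst.
by apply: cvgB; exact: h.
Qed.

Lemma u_log_usc : usc_on B u.
Proof.
rewrite ballE => z /= zB b ub; have [z0|z0] := eqVneq z 0.
  pose e := Num.min (expR (- 2)) (expR b).
  have e0 : 0 < e by rewrite lt_min !expR_gt0.
  apply/nbhs_CnP; exists e => // w; rewrite z0 subr0 lt_min => /andP[we wb].
  have [->|w0] := eqVneq w 0; first by rewrite /u_log eqxx ltNyr.
  have r0 := sqnorm_gt0 w0.
  rewrite u_logE// lte_fin /prof.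
  have [_ L _] := prof_domain (introT andP (conj r0 we)).
  have Lb : ln (sqnorm w) < b by rewrite -[b]expRK ltr_ln ?posrE ?expR_gt0.
  have n2 : 2 <= n%:R :> R by rewrite ler_nat.
  (* From [ln (L / 2) <= L / 2 - 1] and [ln 2 <= 1], with [L = - ln |w|^2]. Then
     [u w <= (n - 1) ln |w|^2 <= ln |w|^2 < b]. *)
  have l1 : ln (- ln (sqnorm w)) <= - ln (sqnorm w) / 2.
    have -> : - ln (sqnorm w) = (- ln (sqnorm w) / 2) * 2 by field.
    rewrite lnM ?posrE//; last lra.
    have := @ln_le_sub1 R (- ln (sqnorm w) / 2); have := @ln_le_sub1 R 2; lra.
  nra.
have z01 : 0 < sqnorm z < 1.
  by rewrite sqnorm_gt0//=; apply: lt_trans zB _; rewrite expR_lt1 oppr_lt0.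
move: ub; rewrite u_logE// lte_fin => ub.
have cp : {for z, continuous (prof \o (@sqnorm R n))}.
  apply: continuous_comp; first exact: continuous_sqnorm.
  exact: (is_derive_continuous (is_derive_prof _ z01)).
have [d d0 hd] := (continuous_CnP _ _).1 cp (b - prof (sqnorm z)) ltac:(by rewrite subr_gt0).
apply/nbhs_CnP; exists d => // w /hd /ltr_normlP[] /= h1 h2.
have [->|w0] := eqVneq w 0; first by rewrite /u_log eqxx ltNyr.
by rewrite u_logE// lte_fin; lra.
Qed.

Lemma measurable_eball a r : 0 <= r -> measurable (orc @^-1` eball a r).
Proof. by move=> r0; rewrite eballE//; exact: measurable_orc_open (@open_sqnorm_lt R n' a _). Qed.

Lemma vol_eball0_gt0 r : 0 < r -> (0 < vol (@eball R n (0 : Cn)%R r))%E.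
Proof.
move=> r0; pose c := r / (2 * (n + n)%:R).
have N1 : 1 <= (n + n)%:R :> R by rewrite ler1n.
have c0 : 0 < c by rewrite divr_gt0// mulr_gt0//; lra.
apply: (@lt_le_trans _ _ (lam (Q c))).
  by rewrite [ltRHS](lebesgue_cube n' (ltW c0)) lte_fin exprn_gt0// mulr_gt0.
apply: le_measure; rewrite ?inE; first exact: measurable_cube.
  exact: measurable_eball (ltW r0).
rewrite eballE ?ltW// => t /sqnorm_cube_le /=; rewrite subr0 => /le_lt_trans; apply.
have rE : r = c * (2 * (n + n)%:R) by rewrite /c divfK// mulf_neq0//; rewrite gt_eqF//; lra.
have c2 : 0 < c ^+ 2 by exact: exprn_gt0.
rewrite rE; clearbody c; set N := (n + n)%:R in N1 *; rewrite (exprMn 2) [ltRHS]mulrC ltr_pM2r//; nra.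
Qed.

Lemma vol_eball_fin a r : 0 <= r -> (vol (eball a r) < +oo)%E.
Proof.
move=> r0; pose c := 2 * r ^+ 2 + 2 * sqnorm a.
have c0 : 0 <= c by rewrite addr_ge0// mulr_ge0 ?sqr_ge0 ?sqnorm_ge0.
apply: (@le_lt_trans _ _ (lam (Q (c + 1)))).
  apply: le_measure; rewrite ?inE; [exact: measurable_eball|exact: measurable_cube|].
  rewrite eballE// => t /= ta; apply: sqnorm_cube => //.
  have := sqnormD_le (orc t - a) a; rewrite subrK => /le_trans; apply.
  by rewrite /c lerD2r ler_pM2l// ltW.
by rewrite [ltLHS](lebesgue_cube n' (addr_ge0 c0 ler01)) ltry.
Qed.

Lemma u_log_submean a r : 0 < r -> closed_eball a r `<=` B ->
  (u a * vol (eball a r) <= integral_Cn (eball a r) u)%E.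
Proof.
move=> r0 KB; have rw := ltW r0.
have [->|a0] := eqVneq a 0.
  by rewrite /u_log eqxx gt0_mulNye ?vol_eball0_gt0// leNye.
pose q := r ^+ 2; have q0 : 0 < q by exact: exprn_gt0.
rewrite closed_eballE// in KB.
have cK := @compact_sqnorm_le R n' a q.
have [d d0 dK] := compact_margin cK KB.
pose D := orc @^-1` eball a r; have mD : measurable D := measurable_eball a rw.
have DE t : D t <-> sqnorm (orc t - a) < q by rewrite /D eballE.
(* With [k.+2] the support radius [cc k] is positive; that it stays below [q] leaves room for
   dilations by a factor above 1. *)
pose dl k : R := q / k.+2%:R; pose cc k := q - dl k.
have dl0 k : 0 < dl k by rewrite divr_gt0// ltr0n.
have cc0 k : 0 < cc k.
  by rewrite subr_gt0 /dl ltr_pdivrMr ?ltr0n// ltr_pMr// ltr1n.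
have ccq k : cc k < q by rewrite /cc ltrBlDr ltrDl.
pose psi k := ramp (cc k) (dl k).
have psi01 k s : 0 <= psi k s <= 1 by exact: ramp_ge0_le1.
have cpsi k : continuous (fun z => psi k (sqnorm (z - a))).
  move=> z; have c1 := @continuous_translate R n' _ (- a) (@continuous_sqnorm R n') z.
  exact: (@continuous_comp _ _ _ (fun z : Cn => sqnorm (z - a)) (psi k) z c1 (@continuous_ramp _ _ _)).
have psi_off k z : ~ [set z | sqnorm (z - a) <= cc k] z -> psi k (sqnorm (z - a)) = 0.
  by move=> /= /negP; rewrite -ltNge; exact: ramp_off.
have mpsi k := measurable_orc_continuous (cpsi k).
have psiD k t : ~ D t -> psi k (sqnorm (orc t - a)) = 0.
  by move=> Dt; apply: psi_off => /= h; apply/Dt/DE; exact: le_lt_trans h (ccq k).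
have psi_cvg t : D t -> psi k (sqnorm (orc t - a)) @[k --> \oo] --> (1 : R).
  move=> /DE tq.
  have dl_cvg : dl k @[k --> \oo] --> 0.
    have := @cvg_epsn R q; rewrite -(cvg_shiftS (epsn q)); exact.
  have gap : 0 < (q - sqnorm (orc t - a)) / 2 by rewrite divr_gt0// subr_gt0.
  have /cvgrPdist_lt /(_ _ gap) hd := dl_cvg.
  apply: cvg_near_cst.
  apply: filterS hd => k; rewrite sub0r normrN gtr0_norm// => hk.
  by rewrite /psi ramp_in// /cc; lra.
have Dd t : D t -> sqnorm (orc t) + d < expR (- 2) by move=> /DE /ltW; exact: dK.
have := @integral_ureg_cvg R n' n1 d D (fun k t => psi k (sqnorm (orc t - a))) (fun=> 1) 1 d0 mD Dd
  mpsi (@measurable_cst _ _ _ _ _ _) _ psi_cvg.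
have -> : (\int[lam]_(t in D) (u (orc t) * (1%:E)))%E = integral_Cn (eball a r) u.
  by apply: eq_integral => t _; rewrite mule1.
move=> h; apply: cvge_ge (h _); last first.
  by move=> k t; have /andP[p0 p1] := psi01 k (sqnorm (orc t - a)); rewrite ger0_norm.
near=> k; set eps := epsn d k; have e0 : 0 < eps := epsn_gt0 k d0.
have eK z : sqnorm (z - a) <= q -> sqnorm z + eps < expR (- 2).
  by move=> /dK; apply: le_lt_trans; rewrite lerD2l; exact: epsn_le.
pose A : set Cn := [set z | sqnorm (z - a) <= cc k].
have cA : compact A := @compact_sqnorm_le R n' a (cc k).
have AU : A `<=` udom eps.
  move=> z /= zA; apply: lt_trans (eK _ (le_trans zA (ltW (ccq k)))) _.
  by rewrite expR_lt1 oppr_lt0.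
have cup := continuous_mul_cutoff (@open_udom R n' eps) (compact_closed (@Cn_hausdorff R n') cA) AU
  (continuous_ureg e0) (cpsi k) (psi_off k).
have iup := integrable_cutoff cA cup (fun z h => etrans (congr1 _ (psi_off k z h)) (mulr0 _)).
have ips := integrable_cutoff cA (cpsi k) (psi_off k).
have -> : (\int[lam]_(t in D) (ureg eps (orc t) * psi k (sqnorm (orc t - a)))%:E)%E =
    (\int[lam]_t (ureg eps (orc t) * psi k (sqnorm (orc t - a))))%R%:E.
  rewrite /Rintegral fineK; last exact: integrable_fin_num iup.
  rewrite [LHS]integral_mkcond; apply: eq_integral => t _.
  by rewrite /patch; case: ifPn => // /negP tD; rewrite psiD ?mulr0// => /mem_set.
(* The largest factor by which the support of the weight can be dilated within the closed ball. *)
pose T := Num.sqrt (q / cc k).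
have T2 : T ^+ 2 = q / cc k by rewrite sqr_sqrtr// divr_ge0// ltW.
have T1 : 1 < T.
  by rewrite /T -sqrtr1 ltr_sqrt ?divr_gt0// ltr_pdivlMr// mul1r.
have dom t z : - T < t < T -> sqnorm (z - a) <= cc k -> sqnorm (dilate a t z) + eps < expR (- 2).
  move=> tT zc; apply: eK; rewrite /dilate addrAC subrr add0r sqnormZ.
  have -> : q = T ^+ 2 * cc k by rewrite T2 divfK// gt_eqF.
  apply: ler_pM; rewrite ?sqr_ge0 ?sqnorm_ge0//.
  by rewrite -normr_le_sqr ?sqrtr_ge0// ltW// ltr_norml.
have sm := @ureg_weighted_submean R n' a eps (cc k) T (psi k) (ramp_int (cc k) (dl k)) e0 (cc0 k) T1 n1
  (fun s => is_derive_ramp_int (cc k) s (dl0 k)) (@continuous_ramp (cc k) (dl k))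
  (fun s => ramp_int_ge0 (cc k) s (dl0 k)) _ (fun s => @ramp_int_off (cc k) (dl k) s (dl0 k))
  (fun s => @ramp_off (cc k) (dl k) s (dl0 k)) dom.
have {}sm := sm (fun s => _).
rewrite u_logE//; set P := (\int[lam]_t psi k (sqnorm (orc t - a)))%R in sm.
have volfin : vol (eball a r) \is a fin_num by rewrite ge0_fin_numE ?vol_eball_fin ?measure_ge0.
have P0 : 0 <= P by apply: Rintegral_ge0 => t _; have /andP[] := psi01 k (sqnorm (orc t - a)).
have PV : P <= fine (vol (eball a r)).
  rewrite -lee_fin (fineK volfin) /P /Rintegral fineK; last exact: integrable_fin_num ips.
  have -> : vol (eball a r) = (\int[lam]_t (\1_D t)%:E)%E by rewrite integral_indic ?setIT.
  apply: ge0_le_integral => //.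
  - by move=> t _; rewrite lee_fin; have /andP[] := psi01 k (sqnorm (orc t - a)).
  - by apply/measurable_EFinP; exact: mpsi.
  - by apply/measurable_EFinP; exact: measurable_indic.
  move=> t _; rewrite lee_fin indicE; case: (boolP (t \in D)) => [_|/negP tD].
    by have /andP[] := psi01 k (sqnorm (orc t - a)).
  by rewrite psiD// => /mem_set.
have ae : sqnorm a + eps < expR (- 2) by apply: eK; rewrite subrr sqnorm0 ltW.
have ua : prof (sqnorm a) <= ureg eps a.
  by apply: prof_nondecreasing => //; [exact: sqnorm_gt0|rewrite lerDl ltW].
(* Because of this sign, replacing the mass [P] of the weight by the larger volume only decreases
   the left side. *)
have ua0 : ureg eps a <= 0 by apply: prof_le0; rewrite ?ae ?addr_gt0 ?sqnorm_gt0.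
rewrite -(fineK volfin) -EFinM lee_fin; apply: le_trans (sm _); last first.
  by move=> s; have /andP[p0 p1] := psi01 k s; rewrite ger0_norm.
apply: le_trans (_ : ureg eps a * fine (vol (eball a r)) <= _).
  by rewrite ler_wpM2r//; apply: le_trans P0 PV.
by rewrite ler_wnM2l.
Unshelve. all: by end_near.
Qed.

Lemma L1loc_ballt (g : Cn -> \bar R) : lam.-integrable (@ballt R n') (g \o orc) -> L1loc B g.
Proof.
move=> ig K cK KB; apply: integrableS ig.
- exact: measurable_ballt.
- exact: measurable_orc_compact.
- by rewrite -ball_ballt => t; exact: KB.
Qed.

Lemma u_log_SHm m : (1 <= m < n)%N -> SHm m B u.
Proof.
move=> mn; split.
- rewrite ballE; have := @open_sqnorm_lt R n' 0 (expR (- 2)); congr open.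
  by apply/seteqP; split => z /=; rewrite subr0.
- by apply: L1loc_ballt; exact: integrable_u_log.
- split; [|exact: u_log_usc|exact: u_log_submean].
  by move=> z _; rewrite /u_log; case: ifP; rewrite ?ltNyy ?ltry.
- by move=> alpha; exact: u_log_ddc_wedge_nonneg.
Qed.

Lemma L1loc_expu p : 0 < p -> L1loc B (fun z => expeR (- (p%:E * u z))%E) <-> p <= 1.
Proof.
move=> p0; split=> [L|p1]; last first.
  by apply: L1loc_ballt; apply: (@integrable_expu R n' p n1); rewrite p0.
rewrite leNgt; apply/negP => p1.
pose e : R := expR (- 2) / 2; have e0 : 0 < e by rewrite divr_gt0 ?expR_gt0.
have cK := @compact_sqnorm_le R n' 0 e.
have KB : [set w : Cn | sqnorm (w - 0) <= e] `<=` B.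
  rewrite ballE => z /=; rewrite subr0 => /le_lt_trans; apply.
  by rewrite /e ltr_pdivrMr// ltr_pMr ?expR_gt0// ltr1n.
have := @not_integrable_expu R n' p e _ p1 e0 (measurable_orc_compact cK).
apply; last exact: L _ cK KB.
by move=> t /= /ltW; rewrite subr0.
Qed.

Lemma mult_ideal1 : mult_ideal u (germ0 (fun=> 1)).
Proof.
exists (fun=> 1); split => //; first by near=> z; exact: differentiable_cst.
exists B; split.
- rewrite ballE; have := @open_sqnorm_lt R n' 0 (expR (- 2)); congr open.
  by apply/seteqP; split => z /=; rewrite subr0.
- by rewrite ballE /= sqnorm0 expR_gt0.
rewrite /integrable_Cn ball_ballt; have := integrable_expu1 R n'.
congr integrable; apply/funext => t; rewrite /comp.
by rewrite (_ : Normc.normc 1 = 1 :> R) ?expr1n ?mul1e /expu ?mul1e//; exact: Normc.normc1.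
Unshelve. all: by end_near.
Qed.

Lemma not_mult_ideal_plus1 : ~ mult_ideal_plus u (germ0 (fun=> 1)).
Proof.
move=> [e /= e0 [F [_ gF [V [oV V0 iV]]]]].
(* The constant 1 belongs to its own germ, hence to that of [F]; so every representative equals 1
   near 0. *)
have F1 : \forall z \near (0 : Cn), 1 = F z.
  have : germ0 (fun=> 1) (fun _ : Cn => 1 : C R) by near=> z.
  by rewrite gF.
have nV : \forall z \near (0 : Cn), V z by apply: open_nbhs_nbhs; split.
have [d d0 hd] := (@nbhs_CnP R n' 0 _).1 (filterI F1 nV).
have mW : measurable [set t | sqnorm (orc t) < d].
  have := @measurable_orc_open R n' _ (@open_sqnorm_lt R n' 0 d).
  by congr measurable; apply/seteqP; split => t /=; rewrite subr0.
apply: (@not_integrable_expu R n' (1 + e) d _ _ d0 mW (@subset_refl _ _)); first by rewrite ltrDl.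
have WV : [set t | sqnorm (orc t) < d] `<=` orc @^-1` V.
  by move=> t /= td; apply: (hd _ _).2; rewrite subr0.
have := integrableS (measurable_orc_open oV) mW WV iV.
apply: eq_integrable => // t /set_mem /= td.
have [/esym F1t _] := hd (orc t) ltac:(by rewrite subr0).
rewrite /comp F1t (_ : Normc.normc 1 = 1 :> R) ?expr1n ?mul1e//; exact: Normc.normc1.
Unshelve. all: by end_near.
Qed.

End Subharmonicity.

Theorem theorem4p1 (R : realType) (n m : nat)
    (hn : (2 <= n)%N) (hm : (1 <= m < n)%N) :
  let B : set (Cn R n) := eball 0 (expR (- 1)) in
  let u : Cn R n -> \bar R := @u_log R n in
  [/\ SHm m B u,
      forall p : R, 0 < p ->
        (L1loc B (fun z => expeR (- (p%:E * u z))%E) <-> p <= 1),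
      mult_ideal u (germ0 (fun _ => 1)) &
      ~ mult_ideal_plus u (germ0 (fun _ => 1))].
Proof.
case: n hn hm => [|n'] // n1 mn B u; split.
- exact: u_log_SHm.
- exact: L1loc_expu.
- exact: mult_ideal1.
- exact: not_mult_ideal_plus1.
Qed.
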